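(* Let $\Omega\subseteq\mathbb C$ be a Jordan domain, and let $\gamma,\delta:\mathbb T\to\partial\Omega$ be the boundary homeomorphisms induced by Riemann maps $\phi:D\to\Omega$ and $\psi:\hat{\mathbb C}\setminus\overline D\to\hat{\mathbb C}\setminus\overline\Omega$ respectively. If either one of the following is true: (a) $p=0$ and $\partial \Omega$ has continuous analytic capacity $0$; (b) $1\le p<+\infty$, $\gamma,\delta\in C^p(\mathbb T)$, and $\gamma',\delta'\neq 0$ everywhere on $\mathbb T$; then there is a function in $C^p(\partial \Omega)$ that cannot be decomposed as the sum of a function in $A^p(\Omega)$ and another in $A^p_0(\hat{\mathbb C}\setminus \overline{\Omega})$.
   Context: $D$ is the open unit disc, $\mathbb T=\partial D$, $\hat{\mathbb C}=\mathbb C\cup\{\infty\}$, $p$ a nonnegative integer. A Jordan domain is a simply connected region in $\mathbb C$ whose boundary is a Jordan curve. Riemann maps are biholomorphisms; $\phi$ and $\psi$ are fixed, and by the Carathéodory–Osgood theorem they extend to homeomorphisms of the closures, with $\gamma=\phi|_{\mathbb T}$ and $\delta=\psi|_{\mathbb T}$; primes on $\gamma,\delta$ denote $d/d\theta$. $C^p(\mathbb T)$ is the space of $u:\mathbb T\to\mathbb C$ such that $\theta\mapsto u(e^{i\theta})$ is of class $C^p$, and $C^p(\partial\Omega)$ is the space of $f:\partial\Omega\to\mathbb C$ with $f\circ\gamma\in C^p(\mathbb T)$. $A^p(\Omega)$ is the space of holomorphic functions on $\Omega$ whose derivatives $f^{(l)}$, $0\le l\le p$, extend continuously to $\overline\Omega$.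 $A^p_0(\hat{\mathbb C}\setminus\overline\Omega)$ is the space of functions $f$ holomorphic on $\mathbb C\setminus\overline\Omega$ whose derivatives $f^{(l)}$, $0\le l\le p$, extend continuously to $\mathbb C\setminus\Omega$, with $\lim_{z\to\infty}f(z)=0$. Elements of the latter two spaces are regarded as functions on $\partial\Omega$ via restriction of the continuous extensions. The continuous analytic capacity of a compact set $K\subseteq\mathbb C$ is $\sup|\lim_{z\to\infty}z(f(z)-f(\infty))|$ over all $f$ continuous on $\hat{\mathbb C}$, holomorphic on $\hat{\mathbb C}\setminus K$, with $|f|\le1$; it is $0$ if and only if every function continuous on $\mathbb C$ and holomorphic on $\mathbb C\setminus K$ is entire. *)

(* Defs.v *)
(* MathComp / MathComp-Analysis, over an arbitrary R : realType. *)
From HB Require Import structures.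
From mathcomp Require Import all_boot all_order all_algebra.
From mathcomp Require Import complex.
From mathcomp Require Import all_classical all_reals all_analysis.

Set Implicit Arguments.
Unset Strict Implicit.
Unset Printing Implicit Defensive.

Import Order.TTheory GRing.Theory Num.Theory.
Import numFieldNormedType.Exports.

Local Open Scope classical_set_scope.
Local Open Scope ring_scope.
Local Open Scope complex_scope.

(* Complex numbers with the topology of their norm, as a normed module over
   themselves: [derivable f z 1] is then complex differentiability of f at z,
   and derive1n is the iterated complex derivative. *)
Definition Cplx (R : realType) : numFieldType := R[i].

Section Topology.

Definition boundary (T : topologicalType) (A : set T) : set T :=
  closure A `\` interior A.

Definition homeomorphism_on (T U : topologicalType) (A : set T) (B : set U)
    (f : T -> U) : Prop :=
  [/\ set_bij A B f, {within A, continuous f} &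
      exists2 g : U -> T, {within B, continuous g} &
        forall x, A x -> g (f x) = x].

Definition continuous_extension (T U : topologicalType) (A B : set T)
    (f g : T -> U) : Prop :=
  {within B, continuous g} /\ (forall x, A x -> g x = f x).

End Topology.

Section Plane.
Variable R : realType.
Local Notation C := (Cplx R).

Definition unit_disc : set C := [set z | `|z| < 1].

Definition unit_circle : set C := [set z | `|z| = 1].

Definition expi (t : R) : C := (cos t +i* sin t : R[i]).

Definition infty_nbhs : set_system C :=
  filter_from [set: R] (fun M => [set z : C | (M%:C : C) < `|z|]).

Definition jordan_curve (J : set C) : Prop :=
  exists c : C -> C,
    {within unit_circle, continuous c} /\ set_bij unit_circle J c.

Definition unit_interval : set R := [set t | 0 <= t <= 1].

Definition unit_square : set (R * R) := unit_interval `*` unit_interval.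

Definition simply_connected (A : set C) : Prop :=
  connected A /\
  forall c : R -> C,
    {within unit_interval, continuous c} ->
    (forall t, unit_interval t -> A (c t)) ->
    c 0 = c 1 ->
    exists H : R * R -> C,
      [/\ {within unit_square, continuous H},
          (forall x, unit_square x -> A (H x)),
          (forall t, unit_interval t -> H (0, t) = c t),
          (forall t, unit_interval t -> H (1, t) = c 0) &
          (forall s, unit_interval s -> H (s, 0) = c 0 /\ H (s, 1) = c 0)].

Definition jordan_domain (A : set C) : Prop :=
  [/\ open A, A !=set0, simply_connected A & jordan_curve (boundary A)].

Definition holomorphic_on (A : set C) (f : C -> C) : Prop :=
  forall z, A z -> derivable f z 1.

End Plane.

Arguments unit_disc R : clear implicits.
Arguments unit_circle R : clear implicits.
Arguments infty_nbhs R : clear implicits.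

Section Sphere.
Variable R : realType.
Local Notation C := (Cplx R).

(* The point at infinity is [None]. *)
Definition sphere : topologicalType := one_point_compactification C.

(* [sphere_chart a] is the chart of the sphere centred at a: z if a is finite,
   1/z if a is infinity. Its value at the single point outside the chart domain
   is irrelevant. *)
Definition sphere_chart (a x : sphere) : C :=
  match (a : option C), (x : option C) with
  | Some _, Some z => z
  | None, Some z => z^-1
  | _, None => 0
  end.

Definition sphere_chart_inv (a : sphere) (w : C) : sphere :=
  match (a : option C) with
  | Some _ => Some w
  | None => if w == 0 then None else Some w^-1
  end.

Definition sphere_derivable (f : sphere -> C) (a : sphere) : Prop :=
  derivable (f \o sphere_chart_inv a) (sphere_chart a a) 1.

(* Continuity at a guarantees that f stays, near a, in the domain of the chart
   at f a. *)
Definition sphere_holomorphic_on (A : set sphere) (f : sphere -> sphere) :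
    Prop :=
  forall a, A a ->
    {for a, continuous f} /\ sphere_derivable (sphere_chart (f a) \o f) a.

(* The complement in the sphere of a subset of the plane. *)
Definition sphere_compl (A : set C) : set sphere :=
  ~` [set (Some z : sphere) | z in A].

Definition biholomorphism (T : Type) (hol : set T -> (T -> T) -> Prop)
    (A B : set T) (f : T -> T) : Prop :=
  [/\ set_bij A B f, hol A f &
      exists2 g : T -> T, hol B g & forall x, A x -> g (f x) = x].

Definition interior_riemann_map (Omega : set C) (phi : C -> C) : Prop :=
  biholomorphism (@holomorphic_on R) (unit_disc R) Omega phi.

Definition exterior_riemann_map (Omega : set C) (psi : sphere -> sphere) :
    Prop :=
  biholomorphism sphere_holomorphic_on
    (sphere_compl (closure (unit_disc R))) (sphere_compl (closure Omega)) psi.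

(* In the next two definitions only the values of gamma and delta on the unit
   circle matter. *)
Definition interior_boundary_map (Omega : set C) (phi gamma : C -> C) : Prop :=
  exists Phi : C -> C,
    [/\ homeomorphism_on (closure (unit_disc R)) (closure Omega) Phi,
        (forall z, unit_disc R z -> Phi z = phi z) &
        (forall z, unit_circle R z -> gamma z = Phi z)].

(* For a Jordan domain Omega, the closure of the exterior is the complement of
   Omega. *)
Definition exterior_boundary_map (Omega : set C) (psi : sphere -> sphere)
    (delta : C -> C) : Prop :=
  exists Psi : sphere -> sphere,
    [/\ homeomorphism_on (sphere_compl (unit_disc R)) (sphere_compl Omega) Psi,
        (forall x, sphere_compl (closure (unit_disc R)) x -> Psi x = psi x) &
        (forall z, unit_circle R z -> Some (delta z) = Psi (Some z))].

Definition capacity_admissible (K : set C) (f : sphere -> C) : Prop :=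
  [/\ continuous f,
      (forall x, sphere_compl K x -> sphere_derivable f x) &
      (forall x, `|f x| <= 1)].

Definition continuous_analytic_capacity (K : set C) : \bar R :=
  ereal_sup [set (complex.Re `|l|)%:E | l in
    [set l : C | exists2 f : sphere -> C, capacity_admissible K f &
       z * (f (Some z) - f None) @[z --> infty_nbhs R] --> l]].

End Sphere.

Section Spaces.
Variable R : realType.
Local Notation C := (Cplx R).

Definition Cp_real (p : nat) (v : R -> R) : Prop :=
  (forall l, (l < p)%N -> forall t, derivable v^`(l)%classic t 1) /\
  (forall l, (l <= p)%N -> continuous v^`(l)%classic).

Definition Cp_circle (p : nat) (u : C -> C) : Prop :=
  Cp_real p (fun t => complex.Re (u (expi t))) /\
  Cp_real p (fun t => complex.Im (u (expi t))).

Definition dtheta (u : C -> C) (t : R) : C :=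
  (fun s => complex.Re (u (expi s)))^`()%classic t +i*
  (fun s => complex.Im (u (expi s)))^`()%classic t.

(* Functions on the boundary are represented by functions on C of which only
   the values on the boundary matter. *)
Definition Cp_boundary (p : nat) (gamma f : C -> C) : Prop :=
  Cp_circle p (f \o gamma).

Definition Ap (p : nat) (Omega : set C) (f : C -> C) : Prop :=
  holomorphic_on Omega f /\
  forall l, (l <= p)%N ->
    exists g : C -> C,
      continuous_extension Omega (closure Omega) f^`(l)%classic g.

Definition A0p (p : nat) (Omega : set C) (f : C -> C) : Prop :=
  [/\ holomorphic_on (~` closure Omega) f,
      (forall l, (l <= p)%N ->
         exists g : C -> C,
           continuous_extension (~` closure Omega) (~` Omega) f^`(l)%classic g) &
      f z @[z --> infty_nbhs R] --> (0 : C)].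

Definition Ap_boundary (p : nat) (Omega : set C) (u : C -> C) : Prop :=
  exists f g : C -> C,
    [/\ Ap p Omega f, continuous_extension Omega (closure Omega) f g &
        forall z, boundary Omega z -> u z = g z].

Definition A0p_boundary (p : nat) (Omega : set C) (u : C -> C) : Prop :=
  exists f g : C -> C,
    [/\ A0p p Omega f,
        continuous_extension (~` closure Omega) (~` Omega) f g &
        forall z, boundary Omega z -> u z = g z].

End Spaces.

(* Main.v *)
(* Suppose that every [f] decomposes as [g + h]. If the inner part [g] is unique, then
   [f |-> g] is a linear operator on [C^p] of the circle whose graph is closed, because uniform
   limits of holomorphic functions are holomorphic; hence it is bounded. The functions
   [e^(i k t)], [k >= 0], are their own inner parts, and the inner part of [e^(- i k t)], [k > 0],
   has no Fourier coefficient of index [- k]. So averaging the conjugates of the operator by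
   rotations yields the Riesz projection, which is unbounded on [C^p].

   For uniqueness, let [G] be in the disc algebra and [h] in [A_0] of the exterior, with
   [G = h o gamma] on the circle. (a) They define a continuous function [F] on the sphere,
   holomorphic off the boundary of [Omega], and [(F z - F z0) / (z - z0)] times [z] tends to
   [- F z0] at infinity; capacity 0 gives [F z0 = 0] for all [z0] in [Omega]. (b) By Cauchy's
   formula, [2 pi i (G a1 - G a0)] is the integral along [gamma] of [h] times
   [1 / (z - phi a1) - 1 / (z - phi a0)]. The integral along [delta] of the same function is [0],
   as is seen in the exterior, and the two integrals agree. So [G] is constant, hence so is [h],
   which vanishes at infinity. *)

Require Import Defs.
From HB Require Import structures.
From mathcomp Require Import all_boot all_order all_algebra.
From mathcomp Require Import complex.
From mathcomp Require Import all_classical all_reals all_analysis.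
From mathcomp Require Import ring lra zify.
Set Implicit Arguments.
Unset Strict Implicit.
Unset Printing Implicit Defensive.
Import Order.TTheory GRing.Theory Num.Theory.
Import numFieldNormedType.Exports.
Local Open Scope classical_set_scope.
Local Open Scope ring_scope.
Local Open Scope complex_scope.

(** * Complex numbers and differentiability *)

(** Cauchy's formula is proved for the unit circle alone. Functions on the closed disc are extended
    to the plane by a retraction, the exterior is pulled back to the disc by [w |-> psi (1 / w)],
    and boundary integrals are means over the circle. The price is two exceptional points of the
    pull-back, [0] and the preimage of infinity; hence a finite exceptional set is carried along
    from Goursat's theorem until Cauchy's formula removes it. Smoothness of order [p] is asked of
    the inner part only; the outer part is kept continuous up to the boundary and is controlled as a
    difference. That the inner part of a given decomposition is [C^p] on the circle comes from the
    chain rule on smaller circles, because its derivatives extend continuously. The closed graph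
    theorem is stated for jets, that is, functions together with their derivatives, so that only
    uniform limits occur. Rotating an exponential multiplies it by a constant; hence linearity of
    the graph suffices for the averaging over rotations. *)

Section ComplexPlane.
Variable R : realType.
Local Notation C := (Cplx R).
Implicit Types (z w : C) (x y t : R).

Definition re z : R := complex.Re z.
Definition im z : R := complex.Im z.
Definition rc x : C := x%:C.
Definition iu : C := 'i%C.
Definition nrm z : R := re `|z|.

Lemma nrmE z : `|z| = rc (nrm z).
Proof. by rewrite /rc /nrm /re RRe_real ?normr_real. Qed.
Lemma rc_inj : injective rc. Proof. by move=> x y []. Qed.
Lemma rcD x y : rc (x + y) = rc x + rc y. Proof. exact: rmorphD. Qed.
Lemma rcB x y : rc (x - y) = rc x - rc y. Proof. exact: rmorphB. Qed.
Lemma rcN x : rc (- x) = - rc x. Proof. exact: rmorphN. Qed.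
Lemma rcM x y : rc (x * y) = rc x * rc y. Proof. exact: rmorphM. Qed.
Lemma rcV x : rc x^-1 = (rc x)^-1. Proof. exact: fmorphV. Qed.
Lemma rc0 : rc 0 = 0. Proof. by []. Qed.
Lemma rc1 : rc 1 = 1. Proof. by []. Qed.
Lemma rcn n : rc n%:R = n%:R. Proof. exact: rmorph_nat. Qed.
Lemma rcX x n : rc (x ^+ n) = rc x ^+ n. Proof. exact: rmorphXn. Qed.
Lemma rc_le x y : (rc x <= rc y) = (x <= y). Proof. exact: lecR. Qed.
Lemma rc_lt x y : (rc x < rc y) = (x < y). Proof. exact: ltcR. Qed.
Lemma rc_eq0 x : (rc x == 0) = (x == 0).
Proof. by rewrite -rc0 (inj_eq rc_inj). Qed.

Lemma reD z w : re (z + w) = re z + re w. Proof. by case: z; case: w. Qed.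
Lemma imD z w : im (z + w) = im z + im w. Proof. by case: z; case: w. Qed.
Lemma reN z : re (- z) = - re z. Proof. by case: z. Qed.
Lemma imN z : im (- z) = - im z. Proof. by case: z. Qed.
Lemma reB z w : re (z - w) = re z - re w. Proof. by rewrite reD reN. Qed.
Lemma imB z w : im (z - w) = im z - im w. Proof. by rewrite imD imN. Qed.
Lemma reM z w : re (z * w) = re z * re w - im z * im w.
Proof. by case: z; case: w. Qed.
Lemma imM z w : im (z * w) = re z * im w + im z * re w.
Proof. by case: z; case: w. Qed.
Lemma re_rc x : re (rc x) = x. Proof. by []. Qed.
Lemma im_rc x : im (rc x) = 0. Proof. by []. Qed.
Lemma re_iu : re iu = 0. Proof. by []. Qed.
Lemma im_iu : im iu = 1. Proof. by []. Qed.
Lemma iu_neq0 : iu != 0.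
Proof. by apply/eqP => -[] /eqP; rewrite oner_eq0. Qed.
Lemma cplxE z : z = rc (re z) + iu * rc (im z).
Proof. exact: complexE. Qed.
Lemma cplxP z w : re z = re w -> im z = im w -> z = w.
Proof. by case: z => ??; case: w => ?? /= -> ->. Qed.

Definition cj z : C := (z : R[i])^*.
Lemma re_cj z : re (cj z) = re z. Proof. by case: z. Qed.
Lemma im_cj z : im (cj z) = - im z. Proof. by case: z. Qed.
Lemma cjB z w : cj (z - w) = cj z - cj w. Proof. exact: rmorphB. Qed.
Lemma cjM z w : cj (z * w) = cj z * cj w. Proof. exact: rmorphM. Qed.
Lemma cjV z : cj z^-1 = (cj z)^-1. Proof. exact: fmorphV. Qed.
Lemma cj_rc x : cj (rc x) = rc x. Proof. exact: conjc_real. Qed.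
Lemma cj0 : cj 0 = 0. Proof. exact: conjc0. Qed.
Lemma cj1 : cj 1 = 1. Proof. exact: conjc1. Qed.
Lemma cjK z : cj (cj z) = z. Proof. exact: conjcK. Qed.

Lemma nrm_ge0 z : 0 <= nrm z. Proof. by rewrite -rc_le -nrmE normr_ge0. Qed.
Lemma nrm0 : nrm 0 = 0. Proof. by rewrite /nrm normr0. Qed.
Lemma nrm1 : nrm 1 = 1. Proof. by rewrite /nrm normr1. Qed.
Lemma nrm_eq0 z : (nrm z == 0) = (z == 0).
Proof. by rewrite -rc_eq0 -nrmE normr_eq0. Qed.
Lemma nrm_gt0 z : (0 < nrm z) = (z != 0).
Proof. by rewrite lt_def nrm_ge0 andbT nrm_eq0. Qed.
Lemma nrmM z w : nrm (z * w) = nrm z * nrm w.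
Proof. by apply: rc_inj; rewrite rcM -!nrmE normrM. Qed.
Lemma nrmV z : nrm z^-1 = (nrm z)^-1.
Proof. by apply: rc_inj; rewrite rcV -!nrmE normfV. Qed.
Lemma nrmX z n : nrm (z ^+ n) = nrm z ^+ n.
Proof. by apply: rc_inj; rewrite rcX -!nrmE normrX. Qed.
Lemma nrmN z : nrm (- z) = nrm z.
Proof. by rewrite /nrm normrN. Qed.
Lemma nrmC z w : nrm (z - w) = nrm (w - z).
Proof. by rewrite /nrm distrC. Qed.
Lemma nrmD z w : nrm (z + w) <= nrm z + nrm w.
Proof. by rewrite -rc_le rcD -!nrmE ler_normD. Qed.
Lemma nrmB z w : nrm (z - w) <= nrm z + nrm w.
Proof. by rewrite -(nrmN w) nrmD. Qed.
Lemma nrm_tri w z z' : nrm (z - z') <= nrm (z - w) + nrm (w - z').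
Proof. by rewrite (_ : z - z' = (z - w) + (w - z')) ?nrmD //; ring. Qed.
Lemma rc_ge0 x : (0 <= rc x) = (0 <= x). Proof. exact: ler0c. Qed.
Lemma nrm_rc_ge0 x : 0 <= x -> nrm (rc x) = x.
Proof. by move=> x0; rewrite /nrm ger0_norm ?rc_ge0. Qed.
Lemma nrm_rc x : nrm (rc x) = `|x|.
Proof.
have [x0|x0] := leP 0 x; first by rewrite nrm_rc_ge0 ?ger0_norm.
by rewrite -nrmN -rcN nrm_rc_ge0 ?oppr_ge0 ?ltW // ltr0_norm.
Qed.
Lemma nrm_sum (I : Type) (r : seq I) (P : pred I) (F : I -> C) :
  nrm (\sum_(i <- r | P i) F i) <= \sum_(i <- r | P i) nrm (F i).
Proof.
elim/big_ind2 : _ => //; first by rewrite nrm0.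
by move=> a b c d ab cd; apply: le_trans (nrmD _ _) _; exact: lerD.
Qed.
Lemma nrm2 z : nrm z ^+ 2 = re z ^+ 2 + im z ^+ 2.
Proof. by apply: rc_inj; rewrite rcX -nrmE -add_Re2_Im2. Qed.
Lemma re_le z : `|re z| <= nrm z.
Proof. by rewrite -(ler_pXn2r (ltn0Sn 1)) ?nnegrE ?nrm_ge0 // real_normK ?num_real // nrm2 lerDl sqr_ge0. Qed.
Lemma im_le z : `|im z| <= nrm z.
Proof. by rewrite -(ler_pXn2r (ltn0Sn 1)) ?nnegrE ?nrm_ge0 // real_normK ?num_real // nrm2 lerDr sqr_ge0. Qed.
Lemma nrm_iu : nrm iu = 1.
Proof.
apply/eqP; rewrite -(@eqrXn2 _ 2) ?nrm_ge0 // nrm2 re_iu im_iu.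
by rewrite expr0n expr1n add0r.
Qed.
Lemma nrm_le_reim z : nrm z <= `|re z| + `|im z|.
Proof.
rewrite {1}(cplxE z); apply: le_trans (nrmD _ _) _.
by rewrite nrmM nrm_iu mul1r !nrm_rc.
Qed.

Lemma nrm_expi t : nrm (expi t) = 1.
Proof.
apply/eqP; rewrite -(@eqrXn2 _ 2) ?nrm_ge0 // nrm2 /expi /re /im /=.
by rewrite cos2Dsin2 expr1n.
Qed.
Lemma expi_neq0 t : expi t != 0.
Proof. by rewrite -nrm_gt0 nrm_expi. Qed.
Lemma expiD x y : expi (x + y) = expi x * expi y.
Proof.
apply: cplxP; rewrite ?reM ?imM /expi /re /im /=; first by rewrite cosD.
by rewrite sinD addrC; congr (_ + _); rewrite mulrC.
Qed.
Lemma expi0 : expi 0 = 1 :> C.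
Proof. by rewrite /expi cos0 sin0. Qed.
Lemma expiN t : expi (- t) = (expi t)^-1.
Proof.
by apply: (mulIf (expi_neq0 t)); rewrite -expiD addNr expi0 mulVf ?expi_neq0.
Qed.
Lemma expiMn t n : expi (n%:R * t) = expi t ^+ n.
Proof.
elim: n => [|n IH]; first by rewrite mul0r expi0 expr0.
by rewrite -natr1 mulrDl mul1r expiD IH exprSr.
Qed.
Lemma cj_expi t : cj (expi t) = (expi t)^-1.
Proof. by rewrite -expiN /expi cosN sinN. Qed.
Lemma nrm_cj z : nrm (cj z) = nrm z.
Proof.
apply/eqP; rewrite -(@eqrXn2 _ 2) ?nrm_ge0 // !nrm2 re_cj im_cj sqrrN //.
Qed.
Lemma expi2pi : expi (2 * pi) = 1 :> C.
Proof.
by rewrite mulr_natl /expi cos2pi sin2pi.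
Qed.
Lemma expiD2pi t : expi (t + 2 * pi) = expi t.
Proof. by rewrite expiD expi2pi mulr1. Qed.

End ComplexPlane.

(** * Differentiability expressed by continuous slopes *)

HB.lock Definition cont_at (T U : topologicalType) (f : T -> U) (t : T) : Prop :=
  {for t, continuous f}.

Section Differentiability.
Variable R : realType.
Local Notation C := (Cplx R).
Implicit Types (z w d : C) (x y t : R).

(** The norm of [C] takes its values in [C], so the balls of the topology have complex radii; from
    here on the radii are real. *)
Lemma nbhsCP z (P : set C) :
  nbhs z P <-> exists2 e : R, 0 < e & forall w, nrm (w - z) < e -> P w.
Proof.
split.
  case/nbhs_ballP => e /= e0 eP; exists (nrm e).
    by rewrite nrm_gt0 gt_eqF.
  move=> w we; apply: eP; rewrite -ball_normE /= distrC nrmE.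
  rewrite -(ger0_norm (ltW e0)) nrmE rc_lt; exact: we.
case=> e e0 eP; apply/nbhs_ballP; exists (rc e) => /=; first by rewrite -rc0 rc_lt.
by move=> w; rewrite -ball_normE /= distrC nrmE rc_lt => /eP.
Qed.

Lemma cvgCP (T : Type) (F : set_system T) {FF : Filter F} (f : T -> C) (l : C) :
  f @ F --> l <-> forall e : R, 0 < e -> \forall s \near F, nrm (f s - l) < e.
Proof.
split=> [fl e e0|fl].
  apply: (fl [set w | nrm (w - l) < e]); apply/nbhsCP; by exists e.
move=> P /nbhsCP[e e0 eP]; rewrite /nbhs/=; have := fl _ e0; apply: filterS => s; exact: eP.
Qed.

Lemma cvg_nrm (T : Type) (F : set_system T) {FF : Filter F} (f : T -> C) (l : C) :
  f @ F --> l -> nrm (f s) @[s --> F] --> nrm l.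
Proof.
move=> /cvgCP fl; apply/cvgrPdist_lt => e /fl; apply: filterS => s.
apply: le_lt_trans; rewrite ler_distl; apply/andP; split.
  rewrite lerBlDr; apply: le_trans (nrmD _ _) => //.
  by rewrite addrC subrK.
by have := nrmD (l - f s) (f s); rewrite subrK nrmC addrC.
Qed.
Lemma cvg_re (T : Type) (F : set_system T) {FF : Filter F} (f : T -> C) (l : C) :
  f @ F --> l -> re (f s) @[s --> F] --> re l.
Proof.
move=> /cvgCP fl; apply/cvgrPdist_lt => e /fl; apply: filterS => s.
by apply: le_lt_trans; rewrite distrC -reB re_le.
Qed.
Lemma cvg_im (T : Type) (F : set_system T) {FF : Filter F} (f : T -> C) (l : C) :
  f @ F --> l -> im (f s) @[s --> F] --> im l.
Proof.
move=> /cvgCP fl; apply/cvgrPdist_lt => e /fl; apply: filterS => s.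
by apply: le_lt_trans; rewrite distrC -imB im_le.
Qed.
Lemma cvg_reim (T : Type) (F : set_system T) {FF : Filter F} (f : T -> C) (l : C) :
  re (f s) @[s --> F] --> re l -> im (f s) @[s --> F] --> im l -> f @ F --> l.
Proof.
move=> /cvgrPdist_lt fr /cvgrPdist_lt fi; apply/cvgCP => e e0.
have e20 : 0 < e / 2 by rewrite divr_gt0.
near=> s; apply: le_lt_trans (nrm_le_reim _) _.
rewrite reB imB (splitr e) distrC (distrC (im _)); apply: ltrD; near: s; [exact: fr|exact: fi].
Unshelve. all: by end_near. Qed.

Lemma nrm_continuous : continuous (@nrm R). Proof. by move=> z; exact: (@cvg_nrm _ (nbhs z) _ id). Qed.
Lemma re_continuous : continuous (@re R). Proof. by move=> z; exact: (@cvg_re _ (nbhs z) _ id). Qed.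
Lemma im_continuous : continuous (@im R). Proof. by move=> z; exact: (@cvg_im _ (nbhs z) _ id). Qed.
Lemma rc_continuous : continuous (@rc R).
Proof.
move=> x; apply/cvgCP => e e0; near=> y.
rewrite -rcB nrm_rc distrC; near: y.
by apply: (@cvgr_dist_lt _ _ _ _ _ id) => //.
Unshelve. all: by end_near. Qed.
Lemma expi_continuous : continuous (@expi R).
Proof.
by move=> t; apply: cvg_reim; [exact: continuous_cos|exact: continuous_sin].
Qed.
Lemma cj_continuous : continuous (@cj R).
Proof.
move=> z; apply: (@cvg_reim _ (nbhs z) _ (@cj R)); under eq_fun do rewrite ?re_cj ?im_cj.
  by rewrite re_cj; exact: re_continuous.
by rewrite im_cj; apply: cvgN; exact: im_continuous.
Qed.

Lemma cont_atP (T U : topologicalType) (f : T -> U) (t : T) :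
  cont_at f t <-> f @ t --> f t.
Proof. by rewrite cont_at.unlock. Qed.

Section ContinuousAt.
Variables (T : topologicalType) (t : T).
Implicit Types f g : T -> C.
Lemma cont_at_near f g : (\forall s \near t, f s = g s) -> cont_at f t -> cont_at g t.
Proof.
move=> fg /cont_atP fc; apply/cont_atP; rewrite -(nbhs_singleton fg).
by apply: cvg_trans fc; apply: near_eq_cvg; apply: filterS fg => s ->.
Qed.
Lemma cont_cst (U : topologicalType) (c : U) : cont_at (fun=> c : U) t.
Proof. by apply/cont_atP; exact: cvg_cst. Qed.
Lemma cont_id : cont_at id t.
Proof. by apply/cont_atP; exact: cvg_id. Qed.
Lemma contD f g : cont_at f t -> cont_at g t -> cont_at (fun s => f s + g s) t.
Proof. move=> /cont_atP fc /cont_atP gc; apply/cont_atP; exact: (cvgD fc gc). Qed.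
Lemma contN f : cont_at f t -> cont_at (fun s => - f s) t.
Proof. move=> /cont_atP fc; apply/cont_atP; exact: (cvgN fc). Qed.
Lemma contB f g : cont_at f t -> cont_at g t -> cont_at (fun s => f s - g s) t.
Proof. by move=> fc gc; exact: (contD fc (contN gc)). Qed.
Lemma contM f g : cont_at f t -> cont_at g t -> cont_at (fun s => f s * g s) t.
Proof. move=> /cont_atP fc /cont_atP gc; apply/cont_atP; exact: (cvgM fc gc). Qed.
Lemma contV f : f t != 0 -> cont_at f t -> cont_at (fun s => (f s)^-1) t.
Proof. move=> f0 /cont_atP fc; apply/cont_atP; exact: (cvgV f0 fc). Qed.
Lemma contZ c f : cont_at f t -> cont_at (fun s => c * f s) t.
Proof. by move=> fc; apply: contM => //; exact: cont_cst. Qed.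
Lemma contX f n : cont_at f t -> cont_at (fun s => f s ^+ n) t.
Proof.
move=> fc; elim: n => [|n IH]; first exact: cont_cst.
by under eq_fun do rewrite exprS; exact: contM.
Qed.
Lemma cont_sum (I : Type) (r : seq I) (F : I -> T -> C) :
  (forall i, cont_at (F i) t) -> cont_at (fun s => \sum_(i <- r) F i s) t.
Proof.
move=> Fc; elim: r => [|i r IH].
  by under eq_fun do rewrite big_nil; exact: cont_cst.
by under eq_fun do rewrite big_cons; exact: contD.
Qed.
Lemma cont_comp (U V : topologicalType) (f : T -> U) (g : U -> V) :
  cont_at f t -> cont_at g (f t) -> cont_at (fun s => g (f s)) t.
Proof. move=> /cont_atP fc /cont_atP gc; apply/cont_atP; exact: (@continuous_comp _ _ _ f g). Qed.
Lemma contP f : cont_at f t <-> forall e, 0 < e -> \forall s \near t, nrm (f s - f t) < e.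
Proof. by split=> [/cont_atP/cvgCP|/cvgCP/cont_atP]. Qed.
End ContinuousAt.

(* Caratheodory's form of the derivative: the slope of [f] at [t], measured along
   [iota], extends continuously to [t]. *)
Definition dq (T : topologicalType) (iota f : T -> C) (t : T) (d : C) : Prop :=
  exists q : T -> C, [/\ cont_at q t, q t = d &
    forall s, f s - f t = q s * (iota s - iota t)].

Definition cdiff (f : C -> C) z d := dq id f z d.
Definition rdiff (u : R -> C) t d := dq (@rc R) u t d.

Lemma rc_cont t : cont_at (@rc R) t.
Proof. by apply/cont_atP; exact: rc_continuous. Qed.

Section Rules.
Variables (T : topologicalType) (iota : T -> C) (t : T).
Implicit Types (f g : T -> C).

Lemma dq_cst c : dq iota (fun=> c) t 0.
Proof. by exists (fun=> 0); split => //; [exact: cont_cst|move=> s; rewrite mul0r subrr]. Qed.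
Lemma dq_id : dq iota iota t 1.
Proof. by exists (fun=> 1); split => //; [exact: cont_cst|move=> s; rewrite mul1r]. Qed.
Lemma dqD f g d e : dq iota f t d -> dq iota g t e -> dq iota (fun s => f s + g s) t (d + e).
Proof.
move=> [p [pc pt pE]] [q [qc qt qE]]; exists (fun s => p s + q s); split.
- exact: contD.
- by rewrite pt qt.
- by move=> s; rewrite mulrDl -pE -qE; ring.
Qed.
Lemma dqN f d : dq iota f t d -> dq iota (fun s => - f s) t (- d).
Proof.
move=> [p [pc pt pE]]; exists (fun s => - p s); split.
- exact: contN.
- by rewrite pt.
- by move=> s; rewrite mulNr -pE; ring.
Qed.
Lemma dqB f g d e : dq iota f t d -> dq iota g t e -> dq iota (fun s => f s - g s) t (d - e).
Proof. by move=> fd ge; apply: dqD => //; exact: dqN. Qed.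
Lemma dq_cont f d : cont_at iota t -> dq iota f t d -> cont_at f t.
Proof.
move=> ic [q [qc qt qE]].
have -> : f = fun s => f t + q s * (iota s - iota t).
  by apply/funext => s; rewrite -qE; ring.
apply: contD; first exact: cont_cst.
by apply: contM => //; apply: contB => //; exact: cont_cst.
Qed.
Lemma dqM f g d e : cont_at iota t ->
  dq iota f t d -> dq iota g t e -> dq iota (fun s => f s * g s) t (d * g t + f t * e).
Proof.
move=> ic fd ge; have gc := dq_cont ic ge.
case: fd ge => [p [pc pt pE]] [q [qc qt qE]]; exists (fun s => p s * g s + f t * q s); split.
- by apply: contD; apply: contM => //; exact: cont_cst.
- by rewrite pt qt.
- move=> s; rewrite mulrDl -!mulrA (mulrC (g s)) !mulrA -pE -mulrA -qE; ring.
Qed.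
Lemma dqV_all f d : cont_at iota t -> f t != 0 ->
  (forall s, f s != 0) ->
  dq iota f t d -> dq iota (fun s => (f s)^-1) t (- d / f t ^+ 2).
Proof.
move=> ic ft fs fd; have fc := dq_cont ic fd.
case: fd => [p [pc pt pE]]; exists (fun s => - p s * ((f s)^-1 * (f t)^-1)); split.
- apply: contM; first exact: contN.
  by apply: contM; [exact: contV|exact: cont_cst].
- by rewrite pt; congr (_ * _); rewrite expr2 invfM.
- by move=> s; rewrite mulrAC mulNr -pE; field; apply/andP.
Qed.
Lemma dq_comp f (g : C -> C) d e : cont_at iota t ->
  dq iota f t d -> cdiff g (f t) e -> dq iota (fun s => g (f s)) t (e * d).
Proof.
move=> ic fd [q [qc qt qE]]; have fc := dq_cont ic fd.
case: fd => [p [pc pt pE]]; exists (fun s => q (f s) * p s); split.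
- by apply: contM => //; exact: cont_comp.
- by rewrite pt qt.
- by move=> s; rewrite qE pE; ring.
Qed.
Lemma dq_eq f g d : (forall s, f s = g s) -> dq iota f t d -> dq iota g t d.
Proof. by move=> /funext ->. Qed.
Lemma dqZ f d c : dq iota f t d -> dq iota (fun s => c * f s) t (c * d).
Proof.
move=> [p [pc pt pE]]; exists (fun s => c * p s); split.
- by apply: contM => //; exact: cont_cst.
- by rewrite pt.
- by move=> s; rewrite -mulrA -pE; ring.
Qed.

(** With the value [d] filled in at the base point this is the only candidate for [q] in [dq]. For
    [iota = id] it is used later as a global function, the difference quotient with its singularity
    filled in. *)
Definition slope f d s := if iota s == iota t then d else (f s - f t) / (iota s - iota t).

Hypothesis inj : injective iota.

Lemma dqP f d : dq iota f t d <-> cont_at (slope f d) t.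
Proof.
split=> [[q [qc qt qE]]|sc].
  suff -> : slope f d = q by [].
  apply/funext => s; rewrite /slope; case: eqP => [/inj ->//|/eqP st].
  by rewrite qE mulfK // subr_eq0.
exists (slope f d); split => //; first by rewrite /slope eqxx.
move=> s; rewrite /slope; case: eqP => [/inj ->|/eqP st]; first by rewrite !subrr mulr0.
by rewrite mulfVK // subr_eq0.
Qed.
Lemma dq_near f g d : (\forall s \near t, f s = g s) -> dq iota f t d -> dq iota g t d.
Proof.
move=> fg /dqP sc; apply/dqP; have ft := nbhs_singleton fg.
apply: cont_at_near sc; near=> s.
rewrite /slope -ft; have -> // : f s = g s by near: s.
Unshelve. all: by end_near. Qed.

Lemma cont_neq0 f : cont_at f t -> f t != 0 -> \forall s \near t, f s != 0.
Proof.
move=> /contP fc ft; have := fc (nrm (f t)); rewrite nrm_gt0 => /(_ ft).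
apply: filterS => s; apply: contraTneq => ->.
by rewrite sub0r nrmN ltxx.
Qed.
Lemma dqV f d : cont_at iota t -> f t != 0 ->
  dq iota f t d -> dq iota (fun s => (f s)^-1) t (- d / f t ^+ 2).
Proof.
move=> ic ft fd; have fc := dq_cont ic fd; have fn := cont_neq0 fc ft.
(* Agrees with [f] near [t] and vanishes nowhere, as [dqV_all] requires. *)
pose g s := if f s == 0 then f t else f s.
have gt : g t = f t by rewrite /g; case: ifP.
apply: (@dq_near (fun s => (g s)^-1)).
  by apply: filterS fn => s /negbTE; rewrite /g => ->.
rewrite -gt; apply: dqV_all => //; first by rewrite gt.
  by move=> s; rewrite /g; case: ifP => // /negbT.
by apply: dq_near fd; apply: filterS fn => s /negbTE; rewrite /g => ->.
Qed.
Lemma dq_div f g d e : cont_at iota t -> g t != 0 ->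
  dq iota f t d -> dq iota g t e -> dq iota (fun s => f s / g s) t ((d * g t - f t * e) / g t ^+ 2).
Proof.
move=> ic gt fd ge; rewrite (_ : _ / _ = d * (g t)^-1 + f t * (- e / g t ^+ 2)).
  by apply: (dqM ic fd); exact: dqV.
by field.
Qed.
Lemma dqX f d n : cont_at iota t -> dq iota f t d ->
  dq iota (fun s => f s ^+ n) t (n%:R * f t ^+ n.-1 * d).
Proof.
move=> ic fd; elim: n => [|n IH]; first by rewrite !mul0r; exact: dq_cst.
rewrite (_ : _ * d = d * f t ^+ n + f t * (n%:R * f t ^+ n.-1 * d)).
  by under eq_fun do rewrite exprS; exact: (dqM ic fd IH).
case: n {IH} => [|n] /=; first by rewrite expr0; ring.
by rewrite exprS -[n.+2%:R]natr1; ring.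
Qed.
End Rules.

Lemma cdiff_cont f z d : cdiff f z d -> cont_at f z.
Proof. exact/dq_cont/cont_id. Qed.
Lemma rdiff_cont u t d : rdiff u t d -> cont_at u t.
Proof. exact/dq_cont/rc_cont. Qed.
Lemma cdiff_near (f g : C -> C) z d : (\forall s \near z, f s = g s) -> cdiff f z d -> cdiff g z d.
Proof. by apply: dq_near. Qed.
Lemma rdiff_near (f g : R -> C) t d : (\forall s \near t, f s = g s) -> rdiff f t d -> rdiff g t d.
Proof. by apply: dq_near; exact: rc_inj. Qed.
Lemma cdiff_comp f g z d e : cdiff f z d -> cdiff g (f z) e -> cdiff (fun s => g (f s)) z (e * d).
Proof. by apply: dq_comp; exact: cont_id. Qed.
Lemma rdiff_comp u g t d e : rdiff u t d -> cdiff g (u t) e -> rdiff (fun s => g (u s)) t (e * d).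
Proof. by apply: dq_comp; exact: rc_cont. Qed.

End Differentiability.

(** * Comparison with limits of difference quotients and the mean value inequality *)

Section DerivativeBridges.
Variable R : realType.
Local Notation C := (Cplx R).
Implicit Types (z w d : C) (x y t : R).

Lemma derive_cvgP (K : numFieldType) (f : K -> K) (a d : K) :
  (h^-1 * (f (h + a) - f a) @[h --> 0^'] --> d) <->
  (derivable f a 1 /\ derive1 f a = d).
Proof.
have E : (fun h => h^-1 *: ((f \o shift a) (h *: (1 : K^o)) - f a)) =
         (fun h => h^-1 * (f (h + a) - f a)).
  by apply/funext => h /=; rewrite -![_ *: _]/(_ * _) mulr1.
split.
  move=> fd; split; first by rewrite /derivable E; apply/cvg_ex; exists d.
  by rewrite derive1E /derive E; apply: cvg_lim => //; exact: norm_hausdorff.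
by case=> fa <-; rewrite derive1E /derive E; move: fa; rewrite /derivable E.
Qed.

Lemma cdiffP f z d : cdiff f z d <-> (derivable f z 1 /\ derive1 f z = d).
Proof.
rewrite -derive_cvgP /cdiff; split.
  move=> /(dqP _ (@inj_id _)) /contP sc; apply/cvgCP => e /sc /nbhsCP[r r0 rP].
  rewrite near_withinE; apply/nbhsCP; exists r => // h; rewrite subr0 => hr h0.
  have := rP (h + z); rewrite addrK => /(_ hr); rewrite /slope eqxx.
  have -> : (h + z == z) = false.
    by apply/negbTE; rewrite -subr_eq0 addrK.
  by rewrite addrK mulrC.
move=> /cvgCP sc; apply/(dqP _ (@inj_id _))/contP => e e0; have := sc e e0.
rewrite near_withinE => /nbhsCP[r r0 rP]; apply/nbhsCP; exists r => // w wr.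
rewrite /slope eqxx; case: (eqVneq w z) => [_|wz]; first by rewrite subrr nrm0.
have := rP (w - z); rewrite subr0 subrK mulrC; apply => //.
by rewrite subr_eq0.
Qed.

Lemma is_derive_cvgP (v : R -> R) t (e : R) :
  is_derive t 1 v e <-> (h^-1 * (v (h + t) - v t) @[h --> 0^'] --> e).
Proof.
rewrite (@derive_cvgP R) derive1E; split=> [[vt ve]//|[vt ve]]; exact: DeriveDef.
Qed.

Lemma rdiff_cvgP (u : R -> C) t d :
  rdiff u t d <-> (rc h^-1 * (u (h + t) - u t) @[h --> 0^'] --> d).
Proof.
rewrite /rdiff; split.
  move=> /(dqP _ (@rc_inj _)) /contP sc; apply/cvgCP => e /sc /nbhs_ballP[r /= r0 rP].
  rewrite near_withinE; apply/nbhs_ballP; exists r => // h; rewrite -ball_normE /= distrC subr0 => hr h0.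
  have := rP (h + t); rewrite -ball_normE /= distrC addrK => /(_ hr); rewrite /slope eqxx.
  have -> : (rc (h + t) == rc t) = false.
    by apply/negbTE; rewrite -subr_eq0 -rcB addrK rc_eq0.
  by rewrite -rcB addrK mulrC rcV.
move=> /cvgCP sc; apply/(dqP _ (@rc_inj _))/contP => e e0; have := sc e e0.
rewrite near_withinE => /nbhs_ballP[r /= r0 rP]; apply/nbhs_ballP; exists r => // w.
rewrite -ball_normE /= distrC => wr.
rewrite /slope eqxx; case: (eqVneq (rc w) (rc t)) => [_|wz]; first by rewrite subrr nrm0.
have := rP (w - t); rewrite -ball_normE /= distrC subr0 subrK mulrC rcV rcB; apply => //.
by rewrite -rc_eq0 rcB subr_eq0.
Qed.

Lemma rdiffP (u : R -> C) t d : rdiff u t d <->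
  is_derive t 1 (fun s => re (u s)) (re d) /\ is_derive t 1 (fun s => im (u s)) (im d).
Proof.
rewrite rdiff_cvgP !is_derive_cvgP.
have Er (h : R) : h^-1 * (re (u (h + t)) - re (u t)) = re (rc h^-1 * (u (h + t) - u t)).
  by rewrite reM re_rc im_rc mul0r subr0 reB.
have Ei (h : R) : h^-1 * (im (u (h + t)) - im (u t)) = im (rc h^-1 * (u (h + t) - u t)).
  by rewrite imM re_rc im_rc mul0r addr0 imB.
split=> [uc|[]].
  by split; [under eq_fun do rewrite Er; exact: cvg_re|under eq_fun do rewrite Ei; exact: cvg_im].
under eq_fun do rewrite Er; move=> ucr; under eq_fun do rewrite Ei; move=> uci.
exact: cvg_reim.
Qed.

Lemma rdiff_rc (v : R -> R) t (e : R) : is_derive t 1 v e -> rdiff (fun s => rc (v s)) t (rc e).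
Proof. by move=> ve; apply/rdiffP; split => //=; exact: is_derive_cst. Qed.

Lemma rdiff_uniq (u : R -> C) t d e : rdiff u t d -> rdiff u t e -> d = e.
Proof.
move=> /rdiff_cvgP ud /rdiff_cvgP ue; apply: (cvg_unique _ ud ue); exact: norm_hausdorff.
Qed.

Lemma cdiff_uniq (f : C -> C) z d e : cdiff f z d -> cdiff f z e -> d = e.
Proof. by move=> /cdiffP[_ <-] /cdiffP[_ <-]. Qed.

(* Rotating [u b - u a] onto the positive axis reduces to the real mean value theorem. *)
Lemma mean_value (u u' : R -> C) (a b M : R) : a <= b ->
  (forall t, a <= t <= b -> rdiff u t (u' t)) ->
  (forall t, a <= t <= b -> nrm (u' t) <= M) ->
  nrm (u b - u a) <= M * (b - a).
Proof.
rewrite le_eqVlt => /predU1P[<- _ _|ab ud uM]; first by rewrite !subrr nrm0 mulr0.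
have [->|w0] := eqVneq (u b - u a) 0.
  rewrite nrm0 mulr_ge0 // ?subr_ge0 ?(ltW ab) //.
  by apply: le_trans (uM a _); rewrite ?nrm_ge0 // lexx ltW.
set w := u b - u a in w0 *; pose c := cj w * (rc (nrm w))^-1.
have nw : nrm w != 0 by rewrite nrm_eq0.
have c1 : nrm c = 1.
  by rewrite nrmM nrmV nrm_cj nrm_rc ger0_norm ?nrm_ge0 // divff.
have cw : re (c * w) = nrm w.
  rewrite (_ : c * w = rc (nrm w)) ?re_rc // /c mulrAC (mulrC (cj w)).
  rewrite (_ : w * cj w = rc (nrm w ^+ 2)); first by rewrite rcX expr2 mulfK // rc_eq0.
  by apply: cplxP; rewrite ?reM ?imM re_cj im_cj ?re_rc ?im_rc ?nrm2; ring.
have cd t : a <= t <= b -> is_derive t 1 (fun s => re (c * u s)) (re (c * u' t)).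
  by move=> /ud tu; have /rdiffP[] := dqZ c tu.
have cI s : s \in `]a, b[ -> is_derive s 1 (fun s => re (c * u s)) (re (c * u' s)).
  by rewrite in_itv /= => /andP[/ltW sa /ltW sb]; apply: cd; rewrite sa.
have cW : {within `[a, b], continuous (fun s => re (c * u s))}.
  apply: derivable_within_continuous => t; rewrite in_itv /= => tab.
  by have [] := cd t tab.
have [s] := MVT ab cI cW.
rewrite in_itv /= => /andP[/ltW sa /ltW sb]; rewrite -reB -mulrBr cw => ->.
rewrite ler_pM2r ?subr_gt0 //; apply: le_trans (ler_norm _) _.
by apply: le_trans (re_le _) _; rewrite nrmM c1 mul1r uM // sa.
Qed.

Lemma rdiff0_cst (u : R -> C) (a b : R) :
  (forall t, a <= t <= b -> rdiff u t 0) -> a <= b -> u a = u b.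
Proof.
move=> u0 ab; apply/esym/eqP; rewrite -subr_eq0 -nrm_eq0 eq_le nrm_ge0 andbT.
rewrite -[leRHS](mul0r (b - a)); apply: (@mean_value _ (fun=> 0)) => // t _.
by rewrite nrm0.
Qed.

End DerivativeBridges.

(** * Goursat's theorem and the mean value property *)

Section Integral.
Variable R : realType.
Local Notation C := (Cplx R).
Implicit Types (z w d : C) (x y t a b : R) (u v : R -> C).

Lemma real_primitive_gt (v : R -> R) a : continuous v ->
  exists V : R -> R, forall x, a < x -> is_derive x 1 V (v x).
Proof.
move=> vc; exists (fun y => (\int[lebesgue_measure]_(t in `[a, y]) v t)%R) => x ax.
(* The right end [x + 1] makes [x] an interior point of the segment. *)
have [] := @continuous_FTC1_closed R v a x (x + 1).
- by rewrite ltrDl.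
- apply: continuous_compact_integrable; first exact: segment_compact.
  exact: continuous_subspaceT.
- by [].
- exact: vc.
by move=> dV EV; apply: DeriveDef; [exact: dV|rewrite -derive1E; exact: EV].
Qed.

Lemma primitive_gt u a : (forall t, cont_at u t) ->
  exists V : R -> C, forall x, a < x -> rdiff V x (u x).
Proof.
move=> uc.
have [|V1 V1d] := @real_primitive_gt (fun t => re (u t)) a.
  by move=> t; have /cont_atP := uc t; exact: cvg_re.
have [|V2 V2d] := @real_primitive_gt (fun t => im (u t)) a.
  by move=> t; have /cont_atP := uc t; exact: cvg_im.
exists (fun t => rc (V1 t) + iu R * rc (V2 t)) => x ax.
rewrite (cplxE (u x)); apply: dqD; first exact/rdiff_rc/V1d.
exact/dqZ/rdiff_rc/V2d.
Qed.

(* The library's fundamental theorem of calculus applies to the right of the base point, so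
   primitives with base points further and further to the left are glued. *)
Lemma primitive_ex u : exists V : R -> C,
  (forall t, cont_at u t) -> forall t, rdiff V t (u t).
Proof.
have [uc|nuc] := pselect (forall t, cont_at u t); last by exists (fun=> 0) => /nuc.
have /choice[W Wd] := fun a => primitive_gt a uc.
have key a a' x : a < - `|x| -> a' < - `|x| -> W a x - W a 0 = W a' x - W a' 0.
  move=> ax ax'.
  have D0 t : - `|x| <= t -> rdiff (fun s => W a s - W a' s) t 0.
    move=> xt; rewrite -(subrr (u t)); apply: dqB; apply: Wd; exact: lt_le_trans xt.
  have E1 : W a (- `|x|) - W a' (- `|x|) = W a x - W a' x.
    apply: (@rdiff0_cst _ (fun s => W a s - W a' s)); last by rewrite lerNl -normrN ler_norm.
    by move=> t /andP[xt _]; exact: D0.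
  have E2 : W a (- `|x|) - W a' (- `|x|) = W a 0 - W a' 0.
    apply: (@rdiff0_cst _ (fun s => W a s - W a' s)); last by rewrite oppr_le0.
    by move=> t /andP[xt _]; exact: D0.
  move: E2; rewrite E1 => E2.
  by rewrite -[W a x](subrK (W a' x)) E2; ring.
exists (fun x => W (- `|x| - 1) x - W (- `|x| - 1) 0) => _ t.
apply: (@rdiff_near _ (fun x => W (- `|t| - 2) x - W (- `|t| - 2) 0)).
  near=> x; apply: key; last by rewrite ltrBlDr ltrDl.
  have xt : `|x - t| < 1.
    by rewrite distrC; near: x; apply: (@cvgr_dist_lt _ _ _ _ _ id) => //; exact: ltr01.
  by have := ler_normD (x - t) t; rewrite subrK; lra.
rewrite -[u t]subr0; apply: dqB; last exact: dq_cst.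
by apply: Wd; rewrite ltrBlDr; have := ler_norm (- t); rewrite normrN; lra.
Unshelve. all: by end_near. Qed.

(** In [primitive_ex] continuity stands under the existential quantifier, so a primitive is selected
    for every [u], a meaningless one if [u] is not continuous. Thus [integ] is total and additive
    over intervals unconditionally. *)
Definition prim u : R -> C := projT1 (cid (primitive_ex u)).
Definition integ u a b : C := prim u b - prim u a.

Lemma prim_diff u t : (forall t, cont_at u t) -> rdiff (prim u) t (u t).
Proof. by move=> uc; rewrite /prim; case: cid => V /= /(_ uc). Qed.

Lemma integ_FTC u U a b : a <= b -> (forall t, cont_at u t) ->
  (forall t, a <= t <= b -> rdiff U t (u t)) -> integ u a b = U b - U a.
Proof.
move=> ab uc Ud; have : prim u a - U a = prim u b - U b.
  apply: (@rdiff0_cst _ (fun s => prim u s - U s)) => // t tab.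
  by rewrite -(subrr (u t)); apply: dqB; [exact: prim_diff|exact: Ud].
by rewrite /integ => E; rewrite -[prim u b](subrK (U b)) -E; ring.
Qed.

Lemma integ_bound u a b M : a <= b -> (forall t, cont_at u t) ->
  (forall t, a <= t <= b -> nrm (u t) <= M) -> nrm (integ u a b) <= M * (b - a).
Proof.
move=> ab uc uM; apply: (mean_value ab) uM => t _; exact: prim_diff.
Qed.

Lemma integ_cat u a b c : integ u a c = integ u a b + integ u b c.
Proof. by rewrite /integ; ring. Qed.

Lemma integ_id u a : integ u a a = 0. Proof. by rewrite /integ subrr. Qed.

Lemma integD u v a b : a <= b -> (forall t, cont_at u t) -> (forall t, cont_at v t) ->
  integ (fun t => u t + v t) a b = integ u a b + integ v a b.
Proof.
move=> ab uc vc; rewrite (@integ_FTC _ (fun t => prim u t + prim v t)) //.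
- by rewrite /integ; ring.
- by move=> t; apply: contD.
- by move=> t _; apply: dqD; exact: prim_diff.
Qed.

Lemma integZ c u a b : a <= b -> (forall t, cont_at u t) ->
  integ (fun t => c * u t) a b = c * integ u a b.
Proof.
move=> ab uc; rewrite (@integ_FTC _ (fun t => c * prim u t)) //.
- by rewrite /integ; ring.
- by move=> t; apply: contZ.
- by move=> t _; apply: dqZ; exact: prim_diff.
Qed.

Lemma integB u v a b : a <= b -> (forall t, cont_at u t) -> (forall t, cont_at v t) ->
  integ (fun t => u t - v t) a b = integ u a b - integ v a b.
Proof.
move=> ab uc vc; rewrite (@integ_FTC _ (fun t => prim u t - prim v t)) //.
- by rewrite /integ; ring.
- by move=> t; apply: contB.
- by move=> t _; apply: dqB; exact: prim_diff.
Qed.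

Lemma integ_cst c a b : a <= b -> integ (fun=> c) a b = c * rc (b - a).
Proof.
move=> ab; rewrite (@integ_FTC _ (fun t => c * rc t)) //.
- by rewrite rcB; ring.
- by move=> t; exact: cont_cst.
- by move=> t _; rewrite -[X in rdiff _ _ X]mulr1; apply: dqZ; exact: dq_id.
Qed.

Lemma integ_sum (I : Type) (r : seq I) (F : I -> R -> C) a b : a <= b ->
  (forall i t, cont_at (F i) t) ->
  integ (fun t => \sum_(i <- r) F i t) a b = \sum_(i <- r) integ (F i) a b.
Proof.
move=> ab Fc; elim: r => [|i r IH].
  by under eq_fun do rewrite big_nil; rewrite integ_cst // mul0r big_nil.
under eq_fun do rewrite big_cons.
by rewrite integD ?IH ?big_cons // => t; apply: cont_sum => j.
Qed.

Lemma rdiff_cj u t d : rdiff u t d -> rdiff (fun s => cj (u s)) t (cj d).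
Proof.
move=> [q [qc qt qE]]; exists (fun s => cj (q s)); split.
- by apply: cont_comp => //; apply/cont_atP; exact: cj_continuous.
- by rewrite qt.
- by move=> s; rewrite -cjB qE cjM cjB !cj_rc.
Qed.

Lemma integ_cj u a b : a <= b -> (forall t, cont_at u t) ->
  integ (fun t => cj (u t)) a b = cj (integ u a b).
Proof.
move=> ab uc; rewrite (@integ_FTC _ (fun t => cj (prim u t))) //.
- by rewrite /integ cjB.
- by move=> t; apply: cont_comp => //; apply/cont_atP; exact: cj_continuous.
- by move=> t _; apply: rdiff_cj; exact: prim_diff.
Qed.

Lemma expi_cont t : cont_at (@expi R) t.
Proof. by apply/cont_atP; exact: expi_continuous. Qed.

Lemma expi_diff t : rdiff (@expi R) t (iu R * expi t).
Proof.
apply/rdiffP; split; rewrite ?reM ?imM ?re_iu ?im_iu ?mul0r ?mul1r ?add0r ?sub0r.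
  exact: is_derive_cos.
exact: is_derive_sin.
Qed.

End Integral.

(** * Goursat's theorem for rectangles *)

Section Goursat.
Variable R : realType.
Local Notation C := (Cplx R).
Implicit Types (z w d : C) (x y t a b : R) (F G : C -> C).

Definition pt x y : C := rc x + iu R * rc y.

Lemma re_pt x y : re (pt x y) = x.
Proof. by rewrite reD reM !re_rc re_iu im_rc mul0r mulr0 subr0 addr0. Qed.
Lemma im_pt x y : im (pt x y) = y.
Proof. by rewrite imD imM !im_rc re_rc im_iu mulr0 mul1r !add0r. Qed.
Lemma ptE z : pt (re z) (im z) = z. Proof. exact/esym/cplxE. Qed.
Lemma pt_dist x y x' y' : nrm (pt x y - pt x' y') <= `|x - x'| + `|y - y'|.
Proof. by apply: le_trans (nrm_le_reim _) _; rewrite reB imB !re_pt !im_pt. Qed.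
Lemma pt_diff_l x y : rdiff (fun x => pt x y) x 1.
Proof. by rewrite -[1]addr0; apply: dqD; [exact: dq_id|exact: dq_cst]. Qed.
Lemma pt_diff_r x y : rdiff (fun y => pt x y) y (iu R).
Proof.
rewrite -[iu R]add0r; apply: dqD; first exact: dq_cst.
by rewrite -[X in dq _ _ _ X]mulr1; apply: dqZ; exact: dq_id.
Qed.
Lemma cont_pt_l F y : (forall z, cont_at F z) -> forall x, cont_at (fun x => F (pt x y)) x.
Proof. by move=> Fc x; apply: cont_comp => //; exact: rdiff_cont (pt_diff_l x y). Qed.
Lemma cont_pt_r F x : (forall z, cont_at F z) -> forall y, cont_at (fun y => F (pt x y)) y.
Proof. by move=> Fc y; apply: cont_comp => //; exact: rdiff_cont (pt_diff_r x y). Qed.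

(** The contour integral of [F dz] along the boundary of a rectangle, counterclockwise from the
    bottom side; [iu] is [dz / dy] on the vertical sides. *)
Definition rint F x0 x1 y0 y1 : C :=
  integ (fun x => F (pt x y0)) x0 x1 + iu R * integ (fun y => F (pt x1 y)) y0 y1
  - integ (fun x => F (pt x y1)) x0 x1 - iu R * integ (fun y => F (pt x0 y)) y0 y1.

Lemma rint_hcat F x0 x1 x2 y0 y1 :
  rint F x0 x2 y0 y1 = rint F x0 x1 y0 y1 + rint F x1 x2 y0 y1.
Proof.
rewrite /rint (integ_cat (fun x => F (pt x y0)) x0 x1 x2).
by rewrite (integ_cat (fun x => F (pt x y1)) x0 x1 x2); ring.
Qed.
Lemma rint_vcat F x0 x1 y0 y1 y2 :
  rint F x0 x1 y0 y2 = rint F x0 x1 y0 y1 + rint F x0 x1 y1 y2.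
Proof.
rewrite /rint (integ_cat (fun y => F (pt x1 y)) y0 y1 y2).
by rewrite (integ_cat (fun y => F (pt x0 y)) y0 y1 y2); ring.
Qed.
Lemma rint_hid F x y0 y1 : rint F x x y0 y1 = 0.
Proof. by rewrite /rint !integ_id; ring. Qed.
Lemma rint_vid F x0 x1 y : rint F x0 x1 y y = 0.
Proof. by rewrite /rint !integ_id; ring. Qed.

Lemma rint_primitive F G x0 x1 y0 y1 : x0 <= x1 -> y0 <= y1 ->
  (forall z, cont_at F z) -> (forall z, cdiff G z (F z)) -> rint F x0 x1 y0 y1 = 0.
Proof.
move=> x01 y01 Fc Gd.
have hE y : integ (fun x => F (pt x y)) x0 x1 = G (pt x1 y) - G (pt x0 y).
  apply: (@integ_FTC _ _ (fun x => G (pt x y))) => //; first exact: cont_pt_l.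
  by move=> t _; rewrite -[X in rdiff _ _ X]mulr1; apply: rdiff_comp (pt_diff_l _ _) _.
have vE x : iu R * integ (fun y => F (pt x y)) y0 y1 = G (pt x y1) - G (pt x y0).
  rewrite -integZ //; last exact: cont_pt_r.
  apply: (@integ_FTC _ _ (fun y => G (pt x y))) => //.
    by move=> t; apply: contZ; exact: cont_pt_r.
  by move=> t _; rewrite mulrC; apply: rdiff_comp (pt_diff_r _ _) _.
by rewrite /rint !hE !vE; ring.
Qed.

Lemma rintB F G x0 x1 y0 y1 : x0 <= x1 -> y0 <= y1 ->
  (forall z, cont_at F z) -> (forall z, cont_at G z) ->
  rint (fun z => F z - G z) x0 x1 y0 y1 = rint F x0 x1 y0 y1 - rint G x0 x1 y0 y1.
Proof.
move=> x01 y01 Fc Gc; rewrite /rint.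
have hE y := integB x01 (cont_pt_l y Fc) (cont_pt_l y Gc).
have vE x := integB y01 (cont_pt_r x Fc) (cont_pt_r x Gc).
by rewrite !hE !vE; ring.
Qed.

Lemma rint_bound F x0 x1 y0 y1 M : x0 <= x1 -> y0 <= y1 -> (forall z, cont_at F z) ->
  (forall x y, x0 <= x <= x1 -> y0 <= y <= y1 -> nrm (F (pt x y)) <= M) ->
  nrm (rint F x0 x1 y0 y1) <= M * (2 * ((x1 - x0) + (y1 - y0))).
Proof.
move=> x01 y01 Fc FM.
have hE y : y0 <= y <= y1 -> nrm (integ (fun x => F (pt x y)) x0 x1) <= M * (x1 - x0).
  move=> yy; apply: integ_bound => //; first exact: cont_pt_l.
  by move=> t ?; exact: FM.
have vE x : x0 <= x <= x1 -> nrm (iu R * integ (fun y => F (pt x y)) y0 y1) <= M * (y1 - y0).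
  move=> xx; rewrite nrmM nrm_iu mul1r; apply: integ_bound => //; first exact: cont_pt_r.
  by move=> t ?; exact: FM.
have h0 := hE y0; have h1 := hE y1; have v0 := vE x0; have v1 := vE x1.
rewrite !lexx ?x01 ?y01 /= in h0 h1 v0 v1.
have := nrmB (integ (fun x => F (pt x y0)) x0 x1 + iu R * integ (fun y => F (pt x1 y)) y0 y1
  - integ (fun x => F (pt x y1)) x0 x1) (iu R * integ (fun y => F (pt x0 y)) y0 y1).
have := nrmB (integ (fun x => F (pt x y0)) x0 x1 + iu R * integ (fun y => F (pt x1 y)) y0 y1)
  (integ (fun x => F (pt x y1)) x0 x1).
have := nrmD (integ (fun x => F (pt x y0)) x0 x1) (iu R * integ (fun y => F (pt x1 y)) y0 y1).
have := h0 isT; have := h1 isT; have := v0 isT; have := v1 isT.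
rewrite -/(rint F x0 x1 y0 y1); lra.
Qed.

Lemma dq_leP (T : topologicalType) (iota : T -> C) (f : T -> C) (t : T) d : injective iota ->
  dq iota f t d <-> forall e, 0 < e ->
    \forall s \near t, nrm (f s - f t - d * (iota s - iota t)) <= e * nrm (iota s - iota t).
Proof.
move=> inj; split.
  move=> [q [/contP qc qt qE]] e e0; have := qc e e0; apply: filterS => s sP.
  by rewrite qE -mulrBl nrmM ler_wpM2r ?nrm_ge0 // -qt ltW.
move=> H; apply/(dqP _ inj)/contP => e e0.
have e20 : 0 < e / 2 by rewrite divr_gt0.
have := H _ e20; apply: filterS => s sP; rewrite {2}/slope eqxx /slope.
case: eqP => [_|/eqP st]; first by rewrite subrr nrm0.
have st0 : 0 < nrm (iota s - iota t) by rewrite nrm_gt0 subr_eq0.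
rewrite -(ltr_pM2r st0) -nrmM mulrBl mulfVK ?subr_eq0 //.
by apply: le_lt_trans sP _; rewrite ltr_pM2r //; lra.
Qed.

Lemma two_neq0 : (2 : C) != 0.
Proof. by rewrite pnatr_eq0. Qed.

Definition cdiffable F z := exists d, cdiff F z d.

(** The affine part of [F] at [pt xs ys] has a primitive and contributes nothing. With
    [L = (x1 - x0) + (y1 - y0)] the remainder is at most [e / 2 * L] on a boundary of length
    [2 * L]. *)
Lemma rint_local F xs ys e : 0 < e -> (forall z, cont_at F z) -> cdiffable F (pt xs ys) ->
  exists2 r : R, 0 < r & forall x0 x1 y0 y1, x0 <= xs <= x1 -> y0 <= ys <= y1 ->
    (x1 - x0) + (y1 - y0) < r ->
    nrm (rint F x0 x1 y0 y1) <= e * ((x1 - x0) + (y1 - y0)) ^+ 2.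
Proof.
move=> e0 Fc [d Fd]; have e20 : 0 < e / 2 by rewrite divr_gt0.
have /nbhsCP[r r0 rP] := (dq_leP _ _ _ (@inj_id _)).1 Fd _ e20; exists r => // x0 x1 y0 y1 /andP[x0s xs1] /andP[y0s ys1] lr.
have x01 := le_trans x0s xs1; have y01 := le_trans y0s ys1.
pose zs := pt xs ys; pose A z := F zs + d * (z - zs).
have Ac z : cont_at A z.
  apply: contD; first exact: cont_cst.
  by apply: contZ; apply: contB; [exact: cont_id|exact: cont_cst].
have A0 : rint A x0 x1 y0 y1 = 0.
  apply: (@rint_primitive _ (fun z => F zs * z + d / 2 * (z - zs) ^+ 2)) => // z.
  apply: dqD.
    by rewrite -[X in dq _ _ _ X]mulr1; apply: dqZ; exact: dq_id.
  rewrite (_ : d * (z - zs) = d / 2 * (2%:R * (z - zs) ^+ 1 * 1)); last first.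
    by rewrite mulr1 expr1 mulrA divfK // two_neq0.
  apply/dqZ/dqX; first exact: cont_id.
  by rewrite -[X in dq _ _ _ X]subr0; apply: dqB; [exact: dq_id|exact: dq_cst].
rewrite -[rint F _ _ _ _]subr0 -[X in _ - X]A0 -rintB //.
apply: (@le_trans _ _ ((e / 2 * (x1 - x0 + (y1 - y0))) * (2 * ((x1 - x0) + (y1 - y0))))).
  apply: rint_bound => //; first by move=> z; apply: contB.
  move=> x y /andP[xx0 xx1] /andP[yy0 yy1].
  have dz : nrm (pt x y - zs) <= x1 - x0 + (y1 - y0).
    apply: le_trans (pt_dist _ _ _ _) _; apply: lerD; rewrite ler_norml; apply/andP; split; lra.
  rewrite /A opprD addrA; apply: le_trans (rP _ (le_lt_trans dz lr)) _.
  by rewrite ler_pM2l.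
by rewrite le_eqVlt; apply/orP; left; apply/eqP; field.
Qed.

(** Bisection. One of the four quarters of a rectangle carries at least a quarter of the integral,
    which [bad] records by the factor [(L / 2 ^+ n) ^+ 2]; at the common point of the nested
    rectangles [rint_local] gives the opposite inequality. *)
Lemma goursat F x0 x1 y0 y1 : x0 <= x1 -> y0 <= y1 -> (forall z, cont_at F z) ->
  (forall x y, x0 <= x <= x1 -> y0 <= y <= y1 -> cdiffable F (pt x y)) ->
  rint F x0 x1 y0 y1 = 0.
Proof.
move=> x01 y01 Fc Fd; apply/eqP; rewrite -nrm_eq0 eq_le nrm_ge0 andbT leNgt; apply/negP => I0.
pose w0 := x1 - x0; pose h0 := y1 - y0; pose L := w0 + h0.
have w00 : 0 <= w0 by rewrite subr_ge0.
have h00 : 0 <= h0 by rewrite subr_ge0.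
(* Chosen so that [e * L ^+ 2] is less than the integral, that is, the initial rectangle is [bad];
   the [+ 1] covers [L = 0]. *)
pose e := nrm (rint F x0 x1 y0 y1) / (2 * (L ^+ 2 + 1)).
have L2 : 0 < 2 * (L ^+ 2 + 1) by rewrite mulr_gt0 // ltr_wpDl // sqr_ge0.
have e0 : 0 < e by rewrite divr_gt0.
pose bad n (s : R * R) := e * (L / 2 ^+ n) ^+ 2 <
  nrm (rint F s.1 (s.1 + w0 / 2 ^+ n) s.2 (s.2 + h0 / 2 ^+ n)).
pose sub n (s s' : R * R) := [/\ s.1 <= s'.1, s'.1 + w0 / 2 ^+ n.+1 <= s.1 + w0 / 2 ^+ n,
  s.2 <= s'.2 & s'.2 + h0 / 2 ^+ n.+1 <= s.2 + h0 / 2 ^+ n].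
(* Badness is a premise under the existential quantifier, so that [choice] yields a single function
   to iterate. *)
have step ns : exists s', bad ns.1 ns.2 -> sub ns.1 ns.2 s' /\ bad ns.1.+1 s'.
  case: ns => n [x y] /=.
  have [b|nb] := pselect (bad n (x, y)); last by exists (x, y) => /nb.
  pose w := w0 / 2 ^+ n.+1; pose h := h0 / 2 ^+ n.+1.
  have n2 : (2 ^+ n.+1 : R) != 0 by rewrite expf_neq0.
  have n2' : (2 ^+ n : R) != 0 by rewrite expf_neq0.
  have wE : x + w0 / 2 ^+ n = x + w + w by rewrite /w exprS; field.
  have hE : y + h0 / 2 ^+ n = y + h + h by rewrite /h exprS; field.
  have LE : L / 2 ^+ n = 2 * (L / 2 ^+ n.+1) by rewrite exprS; field.
  have w_ge0 : 0 <= w by rewrite divr_ge0 // exprn_ge0.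
  have h_ge0 : 0 <= h by rewrite divr_ge0 // exprn_ge0.
  apply: contrapT => /forallNP nbad.
  have nb i j : i \in [:: x; x + w] -> j \in [:: y; y + h] ->
      nrm (rint F i (i + w) j (j + h)) <= e * (L / 2 ^+ n.+1) ^+ 2.
    move=> ii jj; rewrite leNgt; apply/negP => bij; apply: (nbad (i, j)) => _; split => //.
    rewrite /sub /= wE hE -/w -/h.
    by move: ii jj; rewrite !inE => /orP[]/eqP-> /orP[]/eqP->; split; lra.
  have := nb x y; have := nb x (y + h); have := nb (x + w) y; have := nb (x + w) (y + h).
  rewrite !inE !eqxx ?orbT => /(_ isT isT) b1 /(_ isT isT) b2 /(_ isT isT) b3 /(_ isT isT) b4.
  move: b; rewrite /bad /= wE hE LE.
  rewrite (rint_hcat _ _ (x + w)) (rint_vcat _ _ _ _ (y + h)) (rint_vcat _ (x + w) _ _ (y + h)).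
  set r1 := rint _ x _ y _ in b4 *; set r2 := rint _ x _ _ _ in b3 *.
  set r3 := rint _ _ _ y _ in b2 *; set r4 := rint _ _ _ _ _ in b1 *.
  have := nrmD (r1 + r2 + r3) r4; have := nrmD (r1 + r2) r3; have := nrmD r1 r2.
  have -> : e * (2 * (L / 2 ^+ n.+1)) ^+ 2 = 4 * (e * (L / 2 ^+ n.+1) ^+ 2) by ring.
  rewrite (addrA (r1 + r2) r3 r4); lra.
have [f fP] := choice step.
pose s := fix s n := if n is m.+1 then f (m, s m) else (x0, y0).
have sbad n : bad n (s n).
  elim: n => [|n IH]; last by have [] := fP (n, s n) IH.
  rewrite /bad expr0 !divr1 /= /w0 /h0 !(addrC x0) !(addrC y0) !subrK /e mulrAC ltr_pdivrMr //.
  by rewrite ltr_pM2l //; have := sqr_ge0 L; lra.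
have ssub n : sub n (s n) (s n.+1) by have [] := fP (n, s n) (sbad n).
have mono n m : [/\ (s n).1 <= (s (n + m)%N).1, (s (n + m)%N).1 + w0 / 2 ^+ (n + m)%N <= (s n).1 + w0 / 2 ^+ n,
    (s n).2 <= (s (n + m)%N).2 & (s (n + m)%N).2 + h0 / 2 ^+ (n + m)%N <= (s n).2 + h0 / 2 ^+ n].
  elim: m => [|m [m1 m2 m3 m4]]; first by rewrite addn0.
  have [n1 n2 n3 n4] := ssub (n + m)%N; rewrite addnS.
  split; [exact: le_trans n1|exact: le_trans m2|exact: le_trans n3|exact: le_trans m4].
have wn n : 0 <= w0 / 2 ^+ n by rewrite divr_ge0 // exprn_ge0.
have hn n : 0 <= h0 / 2 ^+ n by rewrite divr_ge0 // exprn_ge0.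
(* Left ends are compared with right ends of all generations; this puts the supremum of the left
   ends into every interval. *)
have crossx n m : (s n).1 <= (s m).1 + w0 / 2 ^+ m.
  have [nm|/ltnW mn] := leqP n m.
    by have [] := mono n (m - n)%N; rewrite subnKC // => a1 _ _ _; have := wn m; lra.
  by have [] := mono m (n - m)%N; rewrite subnKC // => _ a1 _ _; have := wn n; lra.
have crossy n m : (s n).2 <= (s m).2 + h0 / 2 ^+ m.
  have [nm|/ltnW mn] := leqP n m.
    by have [] := mono n (m - n)%N; rewrite subnKC // => _ _ a1 _; have := hn m; lra.
  by have [] := mono m (n - m)%N; rewrite subnKC // => _ _ _ a1; have := hn n; lra.
have [xs xsP] : exists xs, forall n, (s n).1 <= xs <= (s n).1 + w0 / 2 ^+ n.
  exists (sup (range (fun n => (s n).1))) => n; apply/andP; split.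
    apply: ub_le_sup; last by exists n.
    by exists ((s n).1 + w0 / 2 ^+ n) => _ [m _ <-].
  by apply: ge_sup; [exists (s 0%N).1, 0%N|move=> _ [m _ <-]].
have [ys ysP] : exists ys, forall n, (s n).2 <= ys <= (s n).2 + h0 / 2 ^+ n.
  exists (sup (range (fun n => (s n).2))) => n; apply/andP; split.
    apply: ub_le_sup; last by exists n.
    by exists ((s n).2 + h0 / 2 ^+ n) => _ [m _ <-].
  by apply: ge_sup; [exists (s 0%N).2, 0%N|move=> _ [m _ <-]].
have xs0 := xsP 0%N; have ys0 := ysP 0%N.
rewrite /= expr0 !divr1 /w0 /h0 !(addrC x0) !(addrC y0) !subrK in xs0 ys0.
have [r r0 rP] := rint_local e0 Fc (Fd xs ys xs0 ys0).
have [n nP] : exists n, L / 2 ^+ n < r.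
  have : L * (2^-1) ^+ n @[n --> \oo] --> L * 0.
    by apply: cvgM; [exact: cvg_cst|apply: cvg_expr; rewrite ger0_norm ?invr_ge0 // invf_lt1 // ltr1n].
  rewrite mulr0 => /cvgrPdist_lt/(_ _ r0)[n _ /(_ n (leqnn _))].
  rewrite sub0r normrN => nr; exists n; apply: le_lt_trans nr; rewrite exprVn.
  exact: ler_norm.
have := sbad n; rewrite /bad ltNge => /negP; apply.
have := rP _ _ _ _ (xsP n) (ysP n).
rewrite !(addrC (_.1)) !(addrC (_.2)) !addrK -mulrDl -/L => /(_ nP).
by [].
Qed.

End Goursat.

(** * The complex exponential and polar coordinates *)

Section Exponential.
Variable R : realType.
Local Notation C := (Cplx R).
Implicit Types (z w d : C) (x y t a b : R) (F G : C -> C).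

Definition cexp z : C := rc (expR (re z)) * expi (im z).

Lemma cexpD z w : cexp (z + w) = cexp z * cexp w.
Proof. by rewrite /cexp reD imD expRD rcM expiD; ring. Qed.
Lemma cexp0 : cexp 0 = 1.
Proof. by rewrite /cexp expR0 expi0 mul1r. Qed.
Lemma nrm_cexp z : nrm (cexp z) = expR (re z).
Proof. by rewrite nrmM nrm_expi mulr1 nrm_rc ger0_norm ?expR_ge0. Qed.
Lemma cexp_neq0 z : cexp z != 0.
Proof. by rewrite -nrm_gt0 nrm_cexp expR_gt0. Qed.

Lemma cexp_diff0 : cdiff cexp 0 1.
Proof.
apply/(dq_leP _ _ _ (@inj_id _)) => e e0; rewrite cexp0.
have e40 : 0 < e / 4 by rewrite divr_gt0.
have /dq_leP-/(_ (@rc_inj _) _ e40)/nbhs_ballP[r1 /= r10 r1P] := expi_diff (0 : R).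
have /rdiff_rc/dq_leP-/(_ (@rc_inj _) _ e40)/nbhs_ballP[r2 /= r20 r2P] := is_derive_expR (0 : R).
have : {for 0, continuous (@expR R)} by exact: continuous_expR.
(* The bound [1] serves to get [expR x <= 2], the bound [e / 4] to control the product of the two
   increments. *)
move=> /cvgrPdist_lt /(_ (Num.min (e / 4) 1)); rewrite lt_min e40 ltr01 => /(_ isT).
move=> /nbhs_ballP[r3 /= r30 r3P].
apply/nbhsCP; exists (Num.min r1 (Num.min r2 r3)); first by rewrite !lt_min r10 r20.
move=> h; rewrite subr0 !lt_min => /andP[h1 /andP[h2 h3]].
have xh := re_le h; have yh := im_le h.
set x := re h in xh *; set y := im h in yh *; set n := nrm h in xh yh h1 h2 h3 *.
have b1 := r1P y; have b2 := r2P x; have b3 := r3P x.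
rewrite -ball_normE /= sub0r normrN expi0 mulr1 rc0 subr0 in b1.
rewrite -ball_normE /= sub0r normrN expR0 rc0 rc1 subr0 mul1r in b2.
rewrite -ball_normE /= sub0r normrN expR0 in b3.
have {}b1 := b1 (le_lt_trans yh h1); have {}b2 := b2 (le_lt_trans xh h2).
have {}b3 := b3 (le_lt_trans xh h3).
rewrite !nrm_rc in b1 b2.
rewrite -/n mul1r {2}(cplxE h) /cexp -/x -/y.
(* The errors of [expi] and of [expR] to first order, and a product of two increments: they are at
   most [2 * (e / 4 * n)], [e / 4 * n] and [e / 4 * n]. *)
rewrite (_ : _ - _ = rc (expR x) * (expi y - 1 - iu R * rc y) + (rc (expR x) - 1 - rc x)
   + iu R * rc y * rc (expR x - 1)); last by rewrite rcB rc1; ring.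
have E2 : expR x <= 2.
  by move: b3; rewrite lt_min => /andP[_]; rewrite ltr_norml => /andP[]; lra.
have E3 : `|expR x - 1| <= e / 4.
  by move: b3; rewrite lt_min => /andP[/ltW + _]; rewrite distrC.
apply: le_trans (nrmD _ _) _; apply: (@le_trans _ _ (2 * (e / 4 * n) + e / 4 * n + e / 4 * n)); last by lra.
have n0 : 0 <= n by exact: nrm_ge0.
apply: lerD; last first.
  rewrite !nrmM nrm_iu mul1r !nrm_rc mulrC; apply: ler_pM => //.
apply: le_trans (nrmD _ _) _; apply: lerD; last first.
  by apply: le_trans b2 _; rewrite ler_pM2l.
rewrite nrmM nrm_rc ger0_norm ?expR_ge0 //; apply: ler_pM => //; rewrite ?expR_ge0 ?nrm_ge0 //.
by apply: le_trans b1 _; rewrite ler_pM2l.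
Qed.

Lemma cexp_diff z : cdiff cexp z (cexp z).
Proof.
have -> : cexp = (fun w => cexp z * cexp (w - z)).
  by apply/funext => w; rewrite -cexpD addrC subrK.
rewrite subrr cexp0 mulr1 -[X in cdiff _ _ X]mulr1; apply: dqZ.
rewrite -[1]mulr1; apply: (@cdiff_comp _ (fun w => w - z)).
  by rewrite -[1]subr0; apply: dqB; [exact: dq_id|exact: dq_cst].
by rewrite subrr; exact: cexp_diff0.
Qed.

Lemma re_expi t : re (expi t : C) = cos t. Proof. by []. Qed.
Lemma im_expi t : im (expi t : C) = sin t. Proof. by []. Qed.

Lemma expi_int (k : int) : expi (k%:~R * (2 * pi)) = 1 :> C.
Proof.
have kn (n : nat) : expi (n%:R * (2 * pi)) = 1 :> C by rewrite expiMn expi2pi expr1n.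
case: k => n; first by rewrite -pmulrn kn.
by rewrite NegzE mulrNz mulNr -pmulrn expiN kn invr1.
Qed.

Lemma expi_eq1 t : expi t = 1 :> C -> exists k : int, t = k%:~R * (2 * pi).
Proof.
move=> t1; pose k := Num.floor (t / (2 * pi)).
have pi20 : 0 < 2 * pi :> R by rewrite mulr_gt0 // pi_gt0.
exists k; pose s := t - k%:~R * (2 * pi).
have s1 : expi s = 1 :> C by rewrite /s expiD expiN expi_int t1 invr1 mulr1.
have s0 : 0 <= s by rewrite subr_ge0 -ler_pdivlMr // ge_floor.
have s2 : s < 2 * pi.
  rewrite ltrBlDr -[X in X + _]mul1r -mulrDl -ltr_pdivrMr // addrC.
  by have := floorD1_gt (t / (2 * pi)); rewrite intrD.
suff : s = 0 by move/eqP; rewrite subr_eq0 => /eqP.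
(* From [cos s = 1] follows [sin (s / 2) = 0], and on [[0, pi)] the sine vanishes only at [0]. *)
have sE : s = s / 2 + s / 2 by lra.
move: s1; rewrite {1}sE expiD.
move=> /(congr1 (@re R)); rewrite reM !re_expi !im_expi => c.
have r1 : re (1 : C) = 1 by []; rewrite r1 in c.
have := cos2Dsin2 (s / 2); rewrite !expr2 => c2.
have /eqP : sin (s / 2) * sin (s / 2) = 0 by lra.
rewrite mulf_eq0 orbb => /eqP sn0.
have [//|sn] := eqVneq s 0.
have : 0 < sin (s / 2) by apply: sin_gt0_pi; apply/andP; split; lra.
by rewrite sn0 ltxx.
Qed.

Lemma expi_inj s t : expi s = expi t :> C -> exists k : int, s = t + k%:~R * (2 * pi).
Proof.
move=> st; have [|k kE] := @expi_eq1 (s - t).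
  by rewrite expiD expiN st divff // expi_neq0.
by exists k; rewrite -kE; lra.
Qed.

Lemma polar z : z != 0 -> exists t, 0 <= t <= 2 * pi /\ z = rc (nrm z) * expi t.
Proof.
move=> z0; pose w := z / rc (nrm z).
have nz : 0 < nrm z by rewrite nrm_gt0.
have zw : z = rc (nrm z) * w by rewrite mulrC divfK // rc_eq0 gt_eqF.
have nw : nrm w = 1 by rewrite nrmM nrmV nrm_rc ger0_norm ?nrm_ge0 // divff // gt_eqF.
have w1 : re w ^+ 2 + im w ^+ 2 = 1 by rewrite -nrm2 nw expr1n.
have rw : -1 <= re w <= 1 by rewrite -ler_norml -nw re_le.
have ca : cos (acos (re w)) = re w by apply: acosK; rewrite in_itv.
have a0 := acos_ge0 rw; have ap := acos_lepi rw.
have sE : sin (acos (re w)) = `|im w|.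
  by rewrite sin_acos // -sqrtr_sqr; congr Num.sqrt; lra.
have pi0 := pi_gt0 R.
have [im0|im0] := leP 0 (im w).
  exists (acos (re w)); split; first by apply/andP; split; lra.
  rewrite {1}zw; congr (_ * _); apply: cplxP; rewrite ?re_expi ?im_expi ?ca ?sE ?ger0_norm //.
exists (2 * pi - acos (re w)); split; first by apply/andP; split; lra.
rewrite {1}zw; congr (_ * _); rewrite expiD expi2pi mul1r.
apply: cplxP; rewrite ?re_expi ?im_expi ?cosN ?sinN ?ca ?sE ?ltr0_norm ?opprK //.
Qed.

End Exponential.

(** * Circle means of holomorphic functions *)

Section MeanValueProperty.
Variable R : realType.
Local Notation C := (Cplx R).
Implicit Types (z w d : C) (x y t a b r : R) (F G : C -> C) (u v : R -> C).

Lemma cont_at_continuous (T U : topologicalType) (f : T -> U) :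
  (forall t : T, cont_at f t) <-> continuous f.
Proof. by split=> H t; move: (H t) => /cont_atP. Qed.

Lemma pt_continuous : continuous (fun p : R * R => pt p.1 p.2).
Proof.
move=> [x y]; apply/cvgCP => e e0 /=.
have e20 : 0 < e / 2 by rewrite divr_gt0.
near=> p; apply: le_lt_trans (pt_dist _ _ _ _) _; rewrite (splitr e).
apply: ltrD; rewrite distrC; near: p.
  by have /cvgrPdist_lt/(_ _ e20) : fst @ (x, y) --> x by exact: cvg_fst.
by have /cvgrPdist_lt/(_ _ e20) : snd @ (x, y) --> y by exact: cvg_snd.
Unshelve. all: by end_near. Qed.

Lemma closed_disc_compact r : compact [set z : C | nrm z <= r].
Proof.
apply: (@subclosed_compact _ _ ((fun p : R * R => pt p.1 p.2) @` (`[-r, r] `*` `[-r, r]))).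
- have -> : [set z : C | nrm z <= r] = @nrm R @^-1` [set x | x <= r] by [].
  apply: closed_comp; first by move=> z _; exact: nrm_continuous.
  exact: closed_le.
- apply: continuous_compact; first exact/continuous_subspaceT/pt_continuous.
  by apply: compact_setX; exact: segment_compact.
- move=> z /= zr; exists (re z, im z) => /=; last exact: ptE.
  by rewrite !in_itv /= -!ler_norml (le_trans (re_le z)) // (le_trans (im_le z)).
Qed.

(** Compactness of the disc. Only [z] is confined to it, so that points of the circle can also be
    compared with points slightly outside. *)
Lemma heine F r e : 0 < e -> (forall z, cont_at F z) ->
  exists2 h : R, 0 < h & forall z w, nrm z <= r -> nrm (w - z) < h -> nrm (F w - F z) < e.
Proof.
move=> e0 Fc; have e20 : 0 < e / 2 by rewrite divr_gt0.
have /compact_near_coveringP/(_ R (0 : R)^'+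
   (fun h z => forall w, nrm (w - z) < h -> nrm (F w - F z) < e) _) := @closed_disc_compact r.
have H z : [set z | nrm z <= r] z -> \forall x' \near z & i \near (0 : R)^'+,
    forall w, nrm (w - x') < i -> nrm (F w - F x') < e.
  move=> _; have /contP/(_ _ e20)/nbhsCP[k k0 kP] := Fc z.
  have k20 : 0 < k / 2 by rewrite divr_gt0.
  exists ([set x | nrm (x - z) < k / 2], [set i | i < k / 2]) => /=.
    split; first by apply/nbhsCP; exists (k / 2).
    by apply: nbhs_right_lt.
  move=> [x i] /= [xk ik] w wx.
  have xz : nrm (x - z) < k by lra.
  have wz : nrm (w - z) < k by apply: le_lt_trans (nrm_tri x _ _) _; lra.
  have := kP _ wz; have := kP _ xz; have := nrm_tri (F z) (F w) (F x).
  by rewrite (nrmC (F z)); lra.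
move=> /(_ H) [h /= h0 hP]; exists (h / 2) => [|z w zr wz]; first by rewrite divr_gt0.
apply: (hP (h / 2)) wz => //=; last by rewrite divr_gt0.
by rewrite sub0r normrN gtr0_norm; lra.
Qed.

(** [cexp] has period [2 pi i], so the horizontal sides cancel; it maps the vertical sides onto
    circles of radii [expR x0] and [expR x1]. *)
Lemma rint_cexp_edges G x0 x1 y :
  rint (fun z => G (cexp z)) x0 x1 y (y + 2 * pi) =
  iu R * (integ (fun t => G (rc (expR x1) * expi t)) y (y + 2 * pi)
          - integ (fun t => G (rc (expR x0) * expi t)) y (y + 2 * pi)).
Proof.
have E x t : cexp (pt x t) = rc (expR x) * expi t by rewrite /cexp re_pt im_pt.
have P x : cexp (pt x (y + 2 * pi)) = cexp (pt x y) by rewrite !E expiD2pi.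
have EE x : (fun t => G (cexp (pt x t))) = (fun t => G (rc (expR x) * expi t)).
  by apply/funext => t; rewrite E.
have PE : (fun x => G (cexp (pt x (y + 2 * pi)))) = (fun x => G (cexp (pt x y))).
  by apply/funext => x; rewrite P.
have I x a b := congr1 (fun f => integ f a b) (EE x).
have J a b := congr1 (fun f => integ f a b) PE.
by rewrite /= in I J; rewrite /rint (I x1) (I x0) J; ring.
Qed.

(* An exceptional point is enclosed in a rectangle of perimeter [O(e)], on which [F] is
   bounded. *)
Lemma goursat_finite (s : seq C) F x0 x1 y0 y1 : x0 <= x1 -> y0 <= y1 ->
  (forall z, cont_at F z) ->
  (forall x y, x0 <= x <= x1 -> y0 <= y <= y1 -> pt x y \notin s -> cdiffable F (pt x y)) ->
  rint F x0 x1 y0 y1 = 0.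
Proof.
move=> + + Fc; elim: s x0 x1 y0 y1 => [|c s IH] x0 x1 y0 y1 x01 y01 Fd.
  by apply: goursat => // x y xx yy; exact: Fd.
pose a := re c; pose b := im c.
have outside (u0 u1 v0 v1 : R) : u0 <= u1 -> v0 <= v1 -> x0 <= u0 -> u1 <= x1 -> y0 <= v0 -> v1 <= y1 ->
    ~~ ((u0 <= a <= u1) && (v0 <= b <= v1)) -> rint F u0 u1 v0 v1 = 0.
  move=> u01 v01 xu ux yv vy nin; apply: IH => // x y /andP[ux0 ux1] /andP[vy0 vy1] ns.
  apply: Fd; rewrite ?(le_trans xu) ?(le_trans ux1) ?(le_trans yv) ?(le_trans vy1) //.
  rewrite inE negb_or ns andbT; apply: contra nin => /eqP E.
  by rewrite /a /b -E re_pt im_pt ux0 ux1 vy0 vy1.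
have [inR|] := boolP ((x0 <= a <= x1) && (y0 <= b <= y1)); last exact: outside.
have /andP[/andP[xa ax] /andP[yb by1]] := inR.
have /contP/(_ _ ltr01)/nbhsCP[k k0 kP] := Fc c.
pose M := nrm (F c) + 1.
have M0 : 0 < M by rewrite ltr_wpDl ?nrm_ge0.
have small e : 0 < e -> e < k / 2 -> nrm (rint F x0 x1 y0 y1) <= M * (8 * e).
  move=> e0 ek.
  (* The box of half-width [e] around [c], clipped because [c] may lie near or on the boundary of
     the rectangle. The four strips around the box avoid [c]. *)
  pose l := Num.max x0 (a - e); pose r := Num.min x1 (a + e).
  pose d := Num.max y0 (b - e); pose t := Num.min y1 (b + e).
  have la : l <= a by rewrite ge_max xa /=; lra.
  have ar : a <= r by rewrite le_min ax /=; lra.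
  have db : d <= b by rewrite ge_max yb /=; lra.
  have bt : b <= t by rewrite le_min by1 /=; lra.
  have xl : x0 <= l by rewrite le_max lexx.
  have rx : r <= x1 by rewrite ge_min lexx.
  have yd : y0 <= d by rewrite le_max lexx.
  have ty : t <= y1 by rewrite ge_min lexx.
  have lr := le_trans la ar; have dt := le_trans db bt.
  have I1 : rint F x0 l y0 y1 = 0.
    rewrite /l; case: leP => xae; last by rewrite rint_hid.
    by apply: outside => //; try lra; apply/negP => /andP[/andP[? ?] /andP[? ?]]; lra.
  have I2 : rint F r x1 y0 y1 = 0.
    rewrite /r; case: leP => xae; first by rewrite rint_hid.
    by apply: outside => //; try lra; apply/negP => /andP[/andP[? ?] /andP[? ?]]; lra.
  have I3 : rint F l r y0 d = 0.
    rewrite /d; case: leP => xae; last by rewrite rint_vid.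
    by apply: outside => //; try lra; apply/negP => /andP[/andP[? ?] /andP[? ?]]; lra.
  have I4 : rint F l r t y1 = 0.
    rewrite /t; case: leP => xae; first by rewrite rint_vid.
    by apply: outside => //; try lra; apply/negP => /andP[/andP[? ?] /andP[? ?]]; lra.
  rewrite (rint_hcat _ _ l) I1 add0r (rint_hcat _ _ r) I2 addr0.
  rewrite (rint_vcat _ _ _ _ d) I3 add0r (rint_vcat _ _ _ _ t) I4 addr0.
  have l' : a - e <= l by rewrite le_max lexx orbT.
  have r' : r <= a + e by rewrite ge_min lexx orbT.
  have d' : b - e <= d by rewrite le_max lexx orbT.
  have t' : t <= b + e by rewrite ge_min lexx orbT.
  apply: le_trans (rint_bound lr dt Fc (M := M) _) _; last first.
    by rewrite ler_pM2l //; lra.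
  move=> x y /andP[lx xr] /andP[dy yt].
  have : nrm (pt x y - c) < k.
    rewrite -(ptE c); apply: le_lt_trans (pt_dist _ _ _ _) _.
    have : `|x - re c| <= e by rewrite ler_distl -/a; apply/andP; split; lra.
    have : `|y - im c| <= e by rewrite ler_distl -/b; apply/andP; split; lra.
    lra.
  move=> /kP; have := nrmD (F (pt x y) - F c) (F c); rewrite subrK /M; lra.
apply/eqP; rewrite -nrm_eq0 eq_le nrm_ge0 andbT leNgt; apply/negP => I0.
(* The first bound keeps the box within distance [k] of [c], the second makes [M * (8 * e)] at most
   half of the integral. *)
pose e := Num.min (k / 4) (nrm (rint F x0 x1 y0 y1) / (16 * M)).
have e0 : 0 < e by rewrite lt_min !divr_gt0 // mulr_gt0.
have ek : e < k / 2 by rewrite gt_min; apply/orP; left; lra.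
have := small e e0 ek; apply/negP; rewrite -ltNge.
have : e <= nrm (rint F x0 x1 y0 y1) / (16 * M) by rewrite ge_min lexx orbT.
by rewrite ler_pdivlMr ?mulr_gt0 //; lra.
Qed.

Definition arg z : R := xget 0 [set t | 0 <= t <= 2 * pi /\ z = rc (nrm z) * expi t].

Lemma argP z : z != 0 -> 0 <= arg z <= 2 * pi /\ z = rc (nrm z) * expi (arg z).
Proof.
by move=> /polar[t tP]; rewrite /arg; case: xgetP => [x _ //|/(_ t)].
Qed.

(** Contains every logarithm of [z] with imaginary part in [[0, 2 pi]]: since [arg z] lies in the
    same interval, the two differ by at most one turn. In the strip a finite exceptional set thus
    stays finite under [cexp]. *)
Definition logs z : seq C :=
  [:: pt (ln (nrm z)) (arg z - 2 * pi); pt (ln (nrm z)) (arg z); pt (ln (nrm z)) (arg z + 2 * pi)].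

Lemma logsP x y z : 0 <= y <= 2 * pi -> cexp (pt x y) = z -> pt x y \in logs z.
Proof.
move=> /andP[y0 y2] E; have z0 : z != 0 by rewrite -E cexp_neq0.
have [/andP[a0 a2] zE] := argP z0.
have xE : x = ln (nrm z) by rewrite -E nrm_cexp re_pt expRK.
have pi0 := pi_gt0 R.
have [k kE] : exists k : int, y = arg z + k%:~R * (2 * pi).
  apply: expi_inj; apply: (mulfI (x := rc (nrm z))); first by rewrite rc_eq0 nrm_eq0.
  by rewrite -zE -E /cexp re_pt im_pt nrmM nrm_expi mulr1 nrm_rc ger0_norm ?expR_ge0.
have n2 : (-2)%:~R = -2 :> R by rewrite mulrNz.
have k1 : (-1 <= k)%R.
  rewrite leNgt; apply/negP => h; have : (k <= -2)%R by lia.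
  rewrite -(ler_int R) n2 => h2.
  have : k%:~R * (2 * pi) <= (-2) * (2 * pi) :> R by rewrite ler_pM2r; lra.
  lra.
have k2 : (k <= 1)%R.
  rewrite leNgt; apply/negP => h; have : (2 <= k)%R by lia.
  rewrite -(ler_int R) => h2.
  have : 2 * (2 * pi) <= k%:~R * (2 * pi) :> R by rewrite ler_pM2r; lra.
  lra.
have : k \in [:: -1; 0; 1 : int] by rewrite !inE; lia.
rewrite !inE => /or3P[]/eqP kk; rewrite -xE kE kk.
- by rewrite mulrN1z mulN1r eqxx.
- by rewrite mul0r addr0 eqxx orbT.
- by rewrite mul1r eqxx !orbT.
Qed.

(* In logarithmic coordinates Goursat's theorem says that the integral over the circle of
   radius [r] does not depend on [r]. *)
Lemma mean_value_property (s : seq C) G : (forall z, cont_at G z) ->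
  (forall z, nrm z < 1 -> z \notin s -> cdiffable G z) ->
  integ (fun t => G (expi t)) 0 (2 * pi) = rc (2 * pi) * G 0.
Proof.
move=> Gc Gd; have pi20 : 0 < 2 * pi :> R by rewrite mulr_gt0 // pi_gt0.
have pi2 := ltW pi20.
pose M r := integ (fun t => G (rc r * expi t)) 0 (2 * pi).
have contr r t : cont_at (fun t => G (rc r * expi t)) t.
  by apply: cont_comp => //; apply: contZ; exact: expi_cont.
have Mcst r r' : 0 < r -> r < r' -> r' < 1 -> M r = M r'.
  move=> r0 rr r1; have r'0 := lt_trans r0 rr.
  (* The points of the strip that [cexp] maps into [s] are among these logarithms. *)
  have := @goursat_finite (flatten [seq logs c | c <- s]) (fun z => G (cexp z)) (ln r) (ln r') 0 (2 * pi).
  have -> : rint (fun z => G (cexp z)) (ln r) (ln r') 0 (2 * pi) = iu R * (M r' - M r).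
    by have := rint_cexp_edges G (ln r) (ln r') 0; rewrite add0r !lnK ?posrE.
  move=> H; apply/eqP; rewrite eq_sym -subr_eq0; apply/eqP; apply: (mulfI (iu_neq0 R)); rewrite mulr0.
  apply: H => //.
  - by rewrite ler_ln ?posrE // ltW.
  - by move=> z; apply: cont_comp => //; exact: cdiff_cont (cexp_diff z).
  - move=> x y /andP[_ xr] yy ns; have [||d Hd] := Gd (cexp (pt x y)).
    + by rewrite nrm_cexp re_pt (le_lt_trans _ r1) // -[leRHS]lnK ?posrE // ler_expR.
    + apply: contra ns => ins; apply/flatten_mapP; exists (cexp (pt x y)) => //.
      exact: logsP.
    + exists (d * cexp (pt x y)); exact: cdiff_comp (cexp_diff _) Hd.
have Mcont r e : 0 <= r <= 1 -> 0 < e -> exists2 h, 0 < h & forall r', `|r' - r| < h -> nrm (M r' - M r) <= e.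
  move=> /andP[r0 r1] e0; have e20 : 0 < e / (2 * pi) by rewrite divr_gt0.
  have [h h0 hP] := heine 1 e20 Gc; exists h => // r' rr.
  rewrite /M -integB //; apply: le_trans (integ_bound (M := e / (2 * pi)) _ _ _) _ => //.
  - by move=> t; apply: contB.
  - move=> t _; apply/ltW/hP; first by rewrite nrmM nrm_expi mulr1 nrm_rc ger0_norm.
    by rewrite -mulrBl nrmM nrm_expi mulr1 -rcB nrm_rc.
  - by rewrite subr0 divfK ?gt_eqF.
have -> : integ (fun t => G (expi t)) 0 (2 * pi) = M 1.
  by rewrite /M; under [in RHS]eq_fun do rewrite rc1 mul1r.
have -> : rc (2 * pi) * G 0 = M 0.
  by rewrite /M; under eq_fun do rewrite rc0 mul0r; rewrite integ_cst // subr0 mulrC.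
apply/eqP; rewrite -subr_eq0 -nrm_eq0 eq_le nrm_ge0 andbT leNgt; apply/negP => I0.
(* [Mcst] compares only radii strictly between [0] and [1]. The two ends are reached by continuity,
   each at a cost of at most [e], and [2 * e] is half of the assumed gap. *)
pose e := nrm (M 1 - M 0) / 4; have e0 : 0 < e by rewrite divr_gt0.
have [h0 h00 h0P] := Mcont 0 e (introT andP (conj (lexx _) ler01)) e0.
have [h1 h10 h1P] := Mcont 1 e (introT andP (conj ler01 (lexx _))) e0.
pose r := Num.min (1 / 4) (h0 / 2); pose r' := Num.max (3 / 4) (1 - h1 / 2).
have r0 : 0 < r by rewrite lt_min !divr_gt0.
have r4 : r <= 1 / 4 by rewrite ge_min lexx.
have rh : r <= h0 / 2 by rewrite ge_min lexx orbT.
have r'4 : 3 / 4 <= r' by rewrite le_max lexx.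
have r'1 : r' < 1 by rewrite gt_max; apply/andP; split; lra.
have r'h : 1 - h1 / 2 <= r' by rewrite le_max lexx orbT.
have a0 := h0P r; have a1 := h1P r'.
rewrite subr0 gtr0_norm // in a0; rewrite distrC gtr0_norm ?subr_gt0 // in a1.
have {}a0 := a0 ltac:(lra); have {}a1 := a1 ltac:(lra).
have rr : M r = M r' by apply: Mcst => //; lra.
have := nrm_tri (M r') (M 1) (M 0); rewrite (nrmC (M 1) (M r')); rewrite rr in a0; rewrite /e in a0 a1; lra.
Qed.

End MeanValueProperty.

(** * The disc algebra *)

Section CauchyFormula.
Variable R : realType.
Local Notation C := (Cplx R).
Implicit Types (z w d : C) (x y t r M : R) (F G : C -> C) (u v : R -> C) (s : seq C).

Lemma pi2_gt0 : 0 < 2 * pi :> R.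
Proof. by rewrite mulr_gt0 // pi_gt0. Qed.

Lemma pi2_ge0 : 0 <= 2 * pi :> R.
Proof. exact: ltW pi2_gt0. Qed.

Definition cavg u : C := (rc (2 * pi))^-1 * integ u 0 (2 * pi).

Let rcpi : rc (2 * pi) != 0 :> C.
Proof. by rewrite rc_eq0 gt_eqF // pi2_gt0. Qed.

Lemma cavgD u v : (forall t, cont_at u t) -> (forall t, cont_at v t) ->
  cavg (fun t => u t + v t) = cavg u + cavg v.
Proof. by move=> uc vc; rewrite /cavg (integD pi2_ge0 uc vc) mulrDr. Qed.
Lemma cavgB u v : (forall t, cont_at u t) -> (forall t, cont_at v t) ->
  cavg (fun t => u t - v t) = cavg u - cavg v.
Proof. by move=> uc vc; rewrite /cavg (integB pi2_ge0 uc vc) mulrBr. Qed.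
Lemma cavgZ c u : (forall t, cont_at u t) -> cavg (fun t => c * u t) = c * cavg u.
Proof. by move=> uc; rewrite /cavg (integZ c pi2_ge0 uc) mulrCA. Qed.
Lemma cavg_cst c : cavg (fun=> c) = c.
Proof. by rewrite /cavg (integ_cst c pi2_ge0) subr0 mulrC mulfK. Qed.
Lemma cavg_cj u : (forall t, cont_at u t) -> cavg (fun t => cj (u t)) = cj (cavg u).
Proof.
by move=> uc; rewrite /cavg (integ_cj pi2_ge0 uc) cjM cjV cj_rc.
Qed.
Lemma cavg_bound u M : (forall t, cont_at u t) ->
  (forall t, 0 <= t <= 2 * pi -> nrm (u t) <= M) -> nrm (cavg u) <= M.
Proof.
move=> uc uM; rewrite nrmM nrmV nrm_rc gtr0_norm ?pi2_gt0 // ler_pdivrMl ?pi2_gt0 //.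
by have := integ_bound pi2_ge0 uc uM; rewrite subr0 (mulrC M).
Qed.
Lemma cavg_eq u v : (forall t, u t = v t) -> cavg u = cavg v.
Proof. by move=> /funext ->. Qed.
Lemma cavg_sum (I : Type) (q : seq I) (F : I -> R -> C) :
  (forall i t, cont_at (F i) t) ->
  cavg (fun t => \sum_(i <- q) F i t) = \sum_(i <- q) cavg (F i).
Proof. by move=> Fc; rewrite /cavg (integ_sum q pi2_ge0 Fc) mulr_sumr. Qed.
Lemma cavg_derive u u' : (forall t, cont_at u' t) -> (forall t, rdiff u t (u' t)) ->
  u (2 * pi) = u 0 -> cavg u' = 0.
Proof.
move=> uc ud up; rewrite /cavg (integ_FTC pi2_ge0 uc (fun t _ => ud t)) up subrr mulr0.
by [].
Qed.

(* The radial retraction of the plane onto the closed unit disc; it makes every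
   function on the closed disc a function on the plane. *)
Definition ret z : C := z / rc (Num.max 1 (nrm z)).

Lemma ret_id z : nrm z <= 1 -> ret z = z.
Proof. by move=> z1; rewrite /ret max_l // rc1 divr1. Qed.
Lemma ret_le1 z : nrm (ret z) <= 1.
Proof.
have m0 : 0 < Num.max 1 (nrm z) by rewrite lt_max ltr01.
by rewrite nrmM nrmV nrm_rc gtr0_norm // ler_pdivrMr // mul1r le_max lexx orbT.
Qed.
Lemma ret_cont z : cont_at ret z.
Proof.
apply: contM; first exact: cont_id.
apply: contV; first by rewrite rc_eq0 gt_eqF // lt_max ltr01.
apply: cont_comp; last exact: rc_cont.
have /cont_atP h1 : cont_at (fun _ : C => 1 : R^o) z by exact: cont_cst.
by apply/cont_atP; have := continuous_max h1 (@nrm_continuous R z).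
Qed.
Lemma ret_expi t : ret (expi t) = expi t.
Proof. by rewrite ret_id // nrm_expi. Qed.
Lemma ret_near z : nrm z < 1 -> \forall w \near z, ret w = w.
Proof.
move=> z1; apply/nbhsCP; exists (1 - nrm z) => [|w wz]; first by rewrite subr_gt0.
by rewrite ret_id //; have := nrmD (w - z) z; rewrite subrK; lra.
Qed.

(** The disc algebra, with functions continuous on the whole plane. The finite set [s] of
    exceptional points is kept until [AD_removable] disposes of it. *)
Definition AD s G := (forall z, cont_at G z) /\
  (forall z, nrm z < 1 -> z \notin s -> cdiffable G z).

Lemma AD_ret s F : (forall z, cont_at (fun z => F (ret z)) z) ->
  (forall z, nrm z < 1 -> z \notin s -> cdiffable F z) -> AD s (fun z => F (ret z)).
Proof.
move=> Fc Fd; split => // z z1 zs; have [d Fzd] := Fd z z1 zs; exists d.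
by apply: cdiff_near Fzd; have := ret_near z1; apply: filterS => w ->.
Qed.

Lemma AD_avg s G : AD s G -> cavg (fun t => G (expi t)) = G 0.
Proof.
by move=> [Gc Gd]; rewrite /cavg (mean_value_property Gc Gd) mulrA mulVf ?mul1r.
Qed.

Lemma disc_sub_neq0 z t : nrm z < 1 -> expi t - z != 0.
Proof.
move=> z1; rewrite subr_eq0; apply/eqP => E; move: z1.
by rewrite -E nrm_expi ltxx.
Qed.

Lemma kernel_cont z t : nrm z < 1 -> cont_at (fun t => (expi t - z)^-1) t.
Proof.
move=> z1; apply: contV; first exact: disc_sub_neq0.
by apply: contB; [exact: expi_cont|exact: cont_cst].
Qed.

(* On the circle [1 / (e - a)] is the conjugate of [e / (1 - conj a * e)], which is
   holomorphic in the disc and vanishes at [0]. *)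
Lemma cavg_kernel a : nrm a < 1 -> cavg (fun t => (expi t - a)^-1) = 0.
Proof.
move=> a1; pose F z := z / (1 - cj a * z).
have den z : nrm z <= 1 -> 1 - cj a * z != 0.
  move=> z1; rewrite subr_eq0; apply/eqP => E; have := nrm1 R.
  rewrite E nrmM nrm_cj => E2.
  have : nrm a * nrm z <= nrm a by rewrite -[leRHS]mulr1 ler_wpM2l ?nrm_ge0.
  by rewrite E2; lra.
have FAD : AD [::] (fun z => F (ret z)).
  apply: AD_ret => [z|z z1 _].
    apply: contM; first exact: ret_cont.
    apply: contV; first by rewrite den // ret_le1.
    by apply: contB; [exact: cont_cst|apply: contZ; exact: ret_cont].
  eexists; apply: dq_div; first exact: inj_id.
  - exact: cont_id.
  - by rewrite den // ltW.
  - exact: dq_id.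
  - by apply: dqB; [exact: dq_cst|apply: dqZ; exact: dq_id].
have := AD_avg FAD; rewrite ret_id ?nrm0 // /F mul0r => E.
have FAc := FAD.1.
rewrite -[RHS]cj0 -{}E -cavg_cj; last by move=> t; exact: (cont_comp (expi_cont t) (FAc _)).
apply: cavg_eq => t; rewrite ret_expi cjM cjV cjB cj1 cjM cjK cj_expi -invfM.
by rewrite mulrBr mulr1 [X in _ = (_ - X)^-1]mulrCA mulfV ?mulr1 // expi_neq0.
Qed.

Lemma cavg_kernel1 a : nrm a < 1 -> cavg (fun t => expi t / (expi t - a)) = 1.
Proof.
move=> a1; have E t : expi t / (expi t - a) = 1 + a * (expi t - a)^-1.
  by rewrite -[1](mulfV (disc_sub_neq0 t a1)) -mulrDl subrK.
rewrite (cavg_eq E) cavgD ?cavgZ ?cavg_kernel ?cavg_cst ?mulr0 ?addr0 // => t.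
- exact: kernel_cont.
- exact: cont_cst.
- by apply: contZ; exact: kernel_cont.
Qed.

Lemma slope_cont (f : C -> C) z d : cdiff f z d -> (forall w, cont_at f w) ->
  forall w, cont_at (slope id z f d) w.
Proof.
move=> fd fc w; have [->|wz] := eqVneq w z; first exact/(dqP _ (@inj_id _)).
apply: (@cont_at_near _ _ _ (fun v : C => (f v - f z) / (v - z))).
  apply/nbhsCP; exists (nrm (w - z)); first by rewrite nrm_gt0 subr_eq0.
  move=> v vw; rewrite /slope /=; case: eqP => // E.
  by move: vw; rewrite E nrmC ltxx.
apply: contM; first by apply: contB; [exact: fc|exact: cont_cst].
apply: contV; first by rewrite subr_eq0.
by apply: contB; [exact: cont_id|exact: cont_cst].
Qed.

Lemma slope_diff (f : C -> C) z d w : w != z -> cdiffable f w -> cdiffable (slope id z f d) w.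
Proof.
move=> wz [e fe]; have near_ : \forall v \near w, (f v - f z) / (v - z) = slope id z f d v.
  apply/nbhsCP; exists (nrm (w - z)); first by rewrite nrm_gt0 subr_eq0.
  move=> v vw; rewrite /slope /=; case: eqP => // E.
  by move: vw; rewrite E nrmC ltxx.
eexists; apply: cdiff_near near_ _; apply: dq_div; first exact: inj_id.
- exact: cont_id.
- by rewrite subr_eq0.
- by apply: dqB; [exact: fe|exact: dq_cst].
- by apply: dqB; [exact: dq_id|exact: dq_cst].
Qed.

(** The mean value property for [z (G z - G a) / (z - a)], which vanishes at [0], together with
    [cavg_kernel1]. The point [a] joins the exceptional points, since the quotient is only known to
    be continuous there. *)
Lemma cauchy_formula s G a : AD s G -> nrm a < 1 -> cdiffable G a ->
  G a = cavg (fun t => G (expi t) * expi t / (expi t - a)).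
Proof.
move=> [Gc Gd] a1 [d Gad]; pose W z := slope id a G d z * z.
have WAD : AD (a :: s) W.
  split=> [z|z z1]; first by apply: contM; [exact: slope_cont|exact: cont_id].
  rewrite inE negb_or => /andP[za zs].
  have [e We] := slope_diff d za (Gd z z1 zs); eexists.
  by apply: dqM We _; [exact: cont_id|exact: dq_id].
have := AD_avg WAD; rewrite {2}/W mulr0 => W0.
have E t : W (expi t) = G (expi t) * expi t / (expi t - a) - G a * (expi t / (expi t - a)).
  rewrite /W /slope /= -(subr_eq0 (expi t)) (negbTE (disc_sub_neq0 t a1)).
  by rewrite mulrAC -!mulrA -mulrBl.
have c1 t : cont_at (fun t => expi t / (expi t - a)) t.
  by apply: contM; [exact: expi_cont|exact: kernel_cont].
have c2 t : cont_at (fun t => G (expi t) * expi t / (expi t - a)) t.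
  apply: contM; last exact: kernel_cont.
  by apply: contM; [apply: cont_comp => //|]; exact: expi_cont.
move: W0; rewrite (cavg_eq E) cavgB //; last by move=> t; exact: contZ.
by rewrite cavgZ // cavg_kernel1 // mulr1 => /eqP; rewrite subr_eq0 => /eqP.
Qed.

Lemma bounded_disc F r : (forall z, cont_at F z) -> exists M, forall z, nrm z <= r -> nrm (F z) <= M.
Proof.
move=> Fc; have /compact_near_coveringP/(_ R (pinfty_nbhs R)
   (fun M z => nrm (F z) <= M) _) := @closed_disc_compact R r.
have H z : [set z | nrm z <= r] z -> \forall x' \near z & i \near pinfty_nbhs R, nrm (F x') <= i.
  move=> _; have /contP/(_ _ ltr01)/nbhsCP[k k0 kP] := Fc z.
  exists ([set x | nrm (x - z) < k], [set i | nrm (F z) + 1 < i]) => /=.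
    split; first by apply/nbhsCP; exists k.
    by exists (nrm (F z) + 1); split => //; exact: num_real.
  move=> [x i] /= [xk ik]; have := nrmD (F x - F z) (F z); rewrite subrK.
  have := kP _ xk; lra.
move=> /(_ H) [h /= [_ hP]]; exists (h + 1) => z zr.
by apply: (hP (h + 1)) zr; rewrite ltrDl.
Qed.

Lemma bounded_segment u : (forall t, cont_at u t) ->
  exists2 M, 0 < M & forall t, 0 <= t <= 2 * pi -> nrm (u t) <= M.
Proof.
move=> uc; have [z|M MP] := @bounded_disc (fun z => u (re z)) (2 * pi).
  by apply: cont_comp => //; apply/cont_atP; exact: re_continuous.
exists (Num.max M 1) => [|t /andP[t0 t2]]; first by rewrite lt_max ltr01 orbT.
by rewrite le_max -{1}(re_rc t) MP // nrm_rc ger0_norm.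
Qed.

(** Differentiation under the integral sign, from a remainder that is quadratic in [b - a] uniformly
    in [t]. *)
Lemma cavg_param (k k' : C -> R -> C) a r B : 0 < r -> 0 <= B ->
  (forall b t, nrm (b - a) < r -> cont_at (k b) t) -> (forall t, cont_at (k' a) t) ->
  (forall b t, nrm (b - a) < r -> 0 <= t <= 2 * pi ->
     nrm (k b t - k a t - (b - a) * k' a t) <= B * nrm (b - a) ^+ 2) ->
  cdiff (fun b => cavg (k b)) a (cavg (k' a)).
Proof.
move=> r0 B0 kc k'c kP; apply/(dq_leP _ _ _ (@inj_id _)) => e e0.
apply/nbhsCP; exists (Num.min r (e / (B + 1))).
  by rewrite lt_min r0 divr_gt0 // ltr_wpDl.
move=> b; rewrite lt_min => /andP[br be].
have ac : forall t, cont_at (k a) t by move=> t; apply: kc; rewrite subrr nrm0.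
rewrite -cavgB //; last by move=> t; exact: kc.
rewrite mulrC -cavgZ // -cavgB //; first last.
- by move=> t; exact: contZ.
- by move=> t; apply: contB => //; exact: kc.
apply: cavg_bound => [t|t tt].
  by apply: contB; [apply: contB => //; exact: kc|exact: contZ].
apply: le_trans (kP b t br tt) _; rewrite expr2 mulrA ler_wpM2r ?nrm_ge0 //.
apply: (@le_trans _ _ ((B + 1) * nrm (b - a))).
  by rewrite ler_wpM2r ?nrm_ge0 // lerDl.
by rewrite mulrC -ler_pdivlMr ?ltW // ltr_wpDl.
Qed.

(** The Cauchy integral of [u] and, in the next two definitions, its first and second derivatives in
    [a]; the factor [expi t] comes from the differential of [expi t]. *)
Definition cauchy1 u a := cavg (fun t => u t * expi t / (expi t - a)).
Definition cauchy2 u a := cavg (fun t => u t * expi t * (expi t - a)^-1 ^+ 2).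
Definition cauchy3 u a := cavg (fun t => u t * expi t * (2 * (expi t - a)^-1 ^+ 3)).

Section CauchyIntegral.
Variable u : R -> C.
Hypothesis uc : forall t, cont_at u t.
Variable a : C.
Hypothesis a1 : nrm a < 1.
(** A point [b] with [nrm (b - a) < r] keeps distance at least [1 / q] from the circle, so the
    kernels are bounded by powers of [q]. *)
Let q : R := 2 / (1 - nrm a).
Let r : R := (1 - nrm a) / 2.

Let q0 : 0 < q. Proof. by rewrite divr_gt0 // subr_gt0. Qed.
Let r0 : 0 < r. Proof. by rewrite divr_gt0 // subr_gt0. Qed.
Let b1 b : nrm (b - a) < r -> nrm b < 1.
Proof.
rewrite /r => br; have := nrmD (b - a) a; rewrite subrK => h; apply: le_lt_trans h _.
by move: br a1; lra.
Qed.
Let kq b t : nrm (b - a) < r -> nrm (expi t - b)^-1 <= q.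
Proof.
move=> br; rewrite nrmV /q -[leRHS]invrK lef_pV2 ?posrE ?invr_gt0 ?divr_gt0 ?subr_gt0 //; last first.
  by rewrite nrm_gt0 disc_sub_neq0 // b1.
rewrite invf_div; have := nrmD (expi t - b) b; have := nrmD (b - a) a; rewrite !subrK nrm_expi.
by move: br; rewrite /r; lra.
Qed.
Let aa : nrm (a - a) < r. Proof. by rewrite subrr nrm0. Qed.
Let ue t : cont_at (fun t => u t * expi t) t.
Proof. by apply: contM => //; exact: expi_cont. Qed.

Lemma cauchy1_diff : cdiff (cauchy1 u) a (cauchy2 u a).
Proof.
have [M M0 MP] := bounded_segment uc.
apply: (@cavg_param _ (fun a t => u t * expi t * (expi t - a)^-1 ^+ 2) _ r (M * q ^+ 3) r0).
- by apply: ltW; apply: mulr_gt0 => //; exact: exprn_gt0.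
- by move=> b t br; apply: contM => //; apply: kernel_cont; exact: b1.
- by move=> t; apply: contM => //; apply: contX; exact: kernel_cont.
move=> b t br tt; have ba := disc_sub_neq0 t a1; have bb := disc_sub_neq0 t (b1 br).
have -> : u t * expi t / (expi t - b) - u t * expi t / (expi t - a) - (b - a) * (u t * expi t * (expi t - a)^-1 ^+ 2)
    = u t * expi t * ((expi t - a)^-1 ^+ 2 * (expi t - b)^-1) * (b - a) ^+ 2.
  by field; apply/andP.
rewrite nrmM nrmX ler_wpM2r ?exprn_ge0 ?nrm_ge0 // !nrmM nrm_expi mulr1.
have -> : q ^+ 3 = q * q * q by ring.
apply: ler_pM; rewrite ?mulr_ge0 ?nrm_ge0 ?MP //.
by apply: ler_pM; rewrite ?mulr_ge0 ?nrm_ge0 ?kq //; apply: ler_pM; rewrite ?nrm_ge0 ?kq.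
Qed.

Lemma cauchy2_diff : cdiff (cauchy2 u) a (cauchy3 u a).
Proof.
have [M M0 MP] := bounded_segment uc.
apply: (@cavg_param _ (fun a t => u t * expi t * (2 * (expi t - a)^-1 ^+ 3)) _ r (M * (q * q * q * (3 * q))) r0).
- exact: ltW (mulr_gt0 M0 (mulr_gt0 (mulr_gt0 (mulr_gt0 q0 q0) q0) (mulr_gt0 (ltr0Sn _ _) q0))).
- by move=> b t br; apply: contM => //; apply: contX; apply: kernel_cont; exact: b1.
- by move=> t; apply: contM => //; apply: contZ; apply: contX; exact: kernel_cont.
move=> b t br tt; have ba := disc_sub_neq0 t a1; have bb := disc_sub_neq0 t (b1 br).
have -> : u t * expi t * (expi t - b)^-1 ^+ 2 - u t * expi t * (expi t - a)^-1 ^+ 2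
     - (b - a) * (u t * expi t * (2 * (expi t - a)^-1 ^+ 3))
    = u t * expi t * ((expi t - a)^-1 ^+ 2 * (expi t - b)^-1
      * ((expi t - b)^-1 + 2 * (expi t - a)^-1)) * (b - a) ^+ 2.
  by field; apply/andP.
rewrite nrmM nrmX ler_wpM2r ?exprn_ge0 ?nrm_ge0 // !nrmM nrm_expi mulr1.
apply: ler_pM; rewrite ?mulr_ge0 ?nrm_ge0 ?MP //; apply: ler_pM; rewrite ?mulr_ge0 ?nrm_ge0 //.
  by apply: ler_pM; rewrite ?mulr_ge0 ?nrm_ge0 ?kq //; apply: ler_pM; rewrite ?nrm_ge0 ?kq.
apply: le_trans (nrmD _ _) _; rewrite nrmM -rcn nrm_rc normr_nat.
by have := kq t br; have := kq t aa; lra.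
Qed.
End CauchyIntegral.

End CauchyFormula.

(** * Removable singularities, the maximum principle and uniform limits *)

Section Consequences.
Variable R : realType.
Local Notation C := (Cplx R).
Implicit Types (z w d : C) (x y t r M : R) (F G : C -> C) (u v : R -> C) (s : seq C).

Lemma AD_expi_cont s G t : AD s G -> cont_at (fun t => G (expi t)) t.
Proof. by move=> [Gc _]; apply: cont_comp => //; exact: expi_cont. Qed.

Lemma avoid_seq s z : \forall w \near z^', w \notin s.
Proof.
elim: s => [|c s IH]; first by apply: filterE => w.
have : \forall w \near z^', w != c.
  have [<-|zc] := eqVneq z c; first exact: nbhs_dnbhs_neq.
  apply: nbhs_dnbhs; apply/nbhsCP; exists (nrm (z - c)); first by rewrite nrm_gt0 subr_eq0.
  by move=> w wz; apply/eqP => E; move: wz; rewrite E nrmC ltxx.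
by apply: filterS2 IH => w ws wc; rewrite inE negb_or wc.
Qed.

Lemma disc_near z : nrm z < 1 -> \forall w \near z, nrm w < 1.
Proof.
move=> z1; apply/nbhsCP; exists (1 - nrm z); first by rewrite subr_gt0.
by move=> w wz; have := nrmD (w - z) z; rewrite subrK; lra.
Qed.

(** Off [s] this is [cauchy_formula]. Both sides are continuous and points off the finite set [s]
    lie arbitrarily close to [a], so the formula, and with it differentiability, extends to the
    exceptional points. *)
Lemma AD_formula s G a : AD s G -> nrm a < 1 -> G a = cauchy1 (fun t => G (expi t)) a.
Proof.
move=> GAD a1; have uc t := AD_expi_cont t GAD.
have off b : nrm b < 1 -> b \notin s -> G b = cauchy1 (fun t => G (expi t)) b.
  by move=> b1 bs; apply: (cauchy_formula GAD) => //; apply GAD.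
set K := cauchy1 _ in off *.
apply/eqP; rewrite -subr_eq0 -nrm_eq0 eq_le nrm_ge0 andbT leNgt; apply/negP => D0.
have : cont_at (fun b => G b - K b) a.
  by apply: contB; [apply GAD|exact: cdiff_cont (cauchy1_diff uc a1)].
move=> /contP/(_ _ D0) near1.
have near2 : \forall w \near a^', False.
  near=> w.
  have ws : w \notin s by near: w; exact: avoid_seq.
  have w1 : nrm w < 1 by near: w; apply: nbhs_dnbhs; exact: disc_near.
  have : nrm (G w - K w - (G a - K a)) < nrm (G a - K a) by near: w; exact: nbhs_dnbhs.
  by rewrite off // subrr sub0r nrmN ltxx.
by have [] := filter_ex near2.
Unshelve. all: by end_near. Qed.

Lemma AD_cdiff s G a : AD s G -> nrm a < 1 -> cdiff G a (cauchy2 (fun t => G (expi t)) a).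
Proof.
move=> GAD a1; have uc t := AD_expi_cont t GAD.
apply: cdiff_near (cauchy1_diff uc a1); have := disc_near a1; apply: filterS => w w1.
by rewrite (AD_formula GAD).
Qed.

Lemma AD_removable s G : AD s G -> AD [::] G.
Proof. by move=> GAD; split; [apply GAD|move=> z z1 _; eexists; exact: (AD_cdiff GAD)]. Qed.

Lemma AD_cst c : AD [::] (fun z : C => c).
Proof. by split=> [z|z _ _]; [exact: cont_cst|exists 0; exact: dq_cst]. Qed.
Lemma AD_id : AD [::] (fun z : C => z).
Proof. by split=> [z|z _ _]; [exact: cont_id|exists 1; exact: dq_id]. Qed.
Lemma AD_D s F G : AD s F -> AD s G -> AD s (fun z => F z + G z).
Proof.
move=> [Fc Fd] [Gc Gd]; split=> [z|z z1 zs]; first exact: contD.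
by have [d Hd] := Fd z z1 zs; have [e He] := Gd z z1 zs; exists (d + e); exact: dqD.
Qed.
Lemma AD_B s F G : AD s F -> AD s G -> AD s (fun z => F z - G z).
Proof.
move=> [Fc Fd] [Gc Gd]; split=> [z|z z1 zs]; first exact: contB.
by have [d Hd] := Fd z z1 zs; have [e He] := Gd z z1 zs; exists (d - e); exact: dqB.
Qed.
Lemma AD_M s F G : AD s F -> AD s G -> AD s (fun z => F z * G z).
Proof.
move=> [Fc Fd] [Gc Gd]; split=> [z|z z1 zs]; first exact: contM.
have [d Hd] := Fd z z1 zs; have [e He] := Gd z z1 zs; eexists.
by apply: dqM Hd He; exact: cont_id.
Qed.
Lemma AD_X s F n : AD s F -> AD s (fun z => F z ^+ n).
Proof.
move=> [Fc Fd]; split=> [z|z z1 zs]; first exact: contX.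
by have [d Hd] := Fd z z1 zs; eexists; apply: dqX Hd; exact: cont_id.
Qed.

Lemma cauchy1_bound u a M : (forall t, cont_at u t) -> nrm a < 1 ->
  (forall t, nrm (u t) <= M) -> nrm (cauchy1 u a) <= M / (1 - nrm a).
Proof.
move=> uc a1 uM; apply: cavg_bound => [t|t _].
  by apply: contM; [apply: contM => //; exact: expi_cont|exact: kernel_cont].
have a10 : 0 < 1 - nrm a by rewrite subr_gt0.
rewrite !nrmM nrm_expi mulr1 nrmV; apply: ler_pM; rewrite ?invr_ge0 ?nrm_ge0 //.
rewrite lef_pV2 ?posrE // ?nrm_gt0 ?disc_sub_neq0 //.
by have := nrmD (expi t - a) a; rewrite subrK nrm_expi; lra.
Qed.

(* Cauchy's formula for the powers of [G] gives [|G a|^n <= M^n / (1 - |a|)] for all [n]. *)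
Lemma max_principle s G M a : AD s G -> (forall t, nrm (G (expi t)) <= M) ->
  nrm a < 1 -> nrm (G a) <= M.
Proof.
move=> GAD GM a1; have a10 : 0 < 1 - nrm a by rewrite subr_gt0.
have M0 : 0 <= M by exact: le_trans (nrm_ge0 _) (GM 0).
have key n : nrm (G a) ^+ n * (1 - nrm a) <= M ^+ n.
  rewrite -ler_pdivlMr // -nrmX (AD_formula (AD_X n GAD) a1); apply: cauchy1_bound => // t.
    exact: AD_expi_cont (AD_X n GAD).
  by rewrite nrmX lerXn2r ?nnegrE ?nrm_ge0.
rewrite leNgt; apply/negP => MG; have G0 : 0 < nrm (G a) by exact: le_lt_trans MG.
pose q := M / nrm (G a); have q1 : `|q| < 1.
  have q0 : 0 <= q by rewrite divr_ge0 // ltW.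
  by rewrite (ger0_norm q0) ltr_pdivrMr // mul1r.
have /cvgrPdist_lt/(_ _ a10)[n _ /(_ n (leqnn _))] := cvg_expr q1.
rewrite sub0r normrN; apply/negP; rewrite -leNgt.
apply: le_trans (ler_norm _); rewrite expr_div_n ler_pdivlMr ?exprn_gt0 //.
by rewrite mulrC key.
Qed.

Lemma circle_expi z : nrm z = 1 -> exists t, 0 <= t <= 2 * pi /\ z = expi t.
Proof.
move=> z1; have z0 : z != 0 by rewrite -nrm_eq0 z1 oner_eq0.
have [t [tt zE]] := polar z0; exists t; split => //.
by rewrite zE z1 rc1 mul1r.
Qed.

Lemma max_principle_closed s G M a : AD s G -> (forall t, nrm (G (expi t)) <= M) ->
  nrm a <= 1 -> nrm (G a) <= M.
Proof.
move=> GAD GM; rewrite le_eqVlt => /predU1P[/circle_expi[t [_ ->]]//|].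
exact: max_principle GAD GM.
Qed.

Lemma AD_eq s F G : AD s F -> AD s G -> (forall t, F (expi t) = G (expi t)) ->
  forall z, nrm z <= 1 -> F z = G z.
Proof.
move=> FAD GAD FG z z1; apply/eqP; rewrite -subr_eq0 -nrm_eq0 eq_le nrm_ge0 andbT.
apply: (max_principle_closed (AD_B FAD GAD)) z1 => t.
by rewrite FG subrr nrm0.
Qed.

Definition ucauchy (T : Type) (A : set T) (f : nat -> T -> C) :=
  forall e : R, 0 < e -> exists N, forall n m (x : T), (N <= n)%N -> (N <= m)%N -> A x -> nrm (f n x - f m x) <= e.
Definition ulim (T : Type) (A : set T) (f : nat -> T -> C) (g : T -> C) :=
  forall e : R, 0 < e -> exists N, forall n (x : T), (N <= n)%N -> A x -> nrm (f n x - g x) <= e.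

Lemma real_cauchy (x : nat -> R) : (forall e, 0 < e -> exists N : nat, forall n m,
   (N <= n)%N -> (N <= m)%N -> `|x n - x m| <= e) -> exists l : R, x @ \oo --> l.
Proof.
move=> xc; apply/cvg_ex/cauchy_cvgP/cauchyP => e e0.
have e20 : 0 < e / 2 by rewrite divr_gt0.
have [N NP] := xc _ e20; exists (x N); exists N => // n /= Nn.
by rewrite -ball_normE /=; have := NP N n (leqnn _) Nn; lra.
Qed.

Lemma ucauchy_lim (T : Type) (A : set T) f : ucauchy A f -> exists g, ulim A f g.
Proof.
move=> fc; have H (x : T) : exists l, A x -> (fun n => f n x) @ \oo --> (l : C).
  have [Ax|nA] := pselect (A x); last by exists 0.
  have [l1 l1P] : exists l : R, (fun n => re (f n x)) @ \oo --> l.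
    apply: real_cauchy => e /fc[N NP]; exists N => n m Nn Nm.
    by rewrite -reB; apply: le_trans (re_le _) _; exact: NP.
  have [l2 l2P] : exists l : R, (fun n => im (f n x)) @ \oo --> l.
    apply: real_cauchy => e /fc[N NP]; exists N => n m Nn Nm.
    by rewrite -imB; apply: le_trans (im_le _) _; exact: NP.
  by exists (pt l1 l2) => _; apply: cvg_reim; rewrite ?re_pt ?im_pt.
have [g gP] := choice H; exists g => e /fc[N NP]; exists N => n x Nn Ax.
apply/ler_addgt0Pr => e' e'0.
have /cvgCP/(_ _ e'0)[M _ MP] := gP x Ax; have := MP (maxn N M) (leq_maxr _ _).
have := NP n (maxn N M) x Nn (leq_maxl _ _) Ax.
by have := nrm_tri (f (maxn N M) x) (f n x) (g x); lra.
Qed.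

Lemma ulim_ucauchy (T : Type) (A : set T) f g : ulim A f g -> ucauchy A f.
Proof.
move=> fg e e0; have e20 : 0 < e / 2 by rewrite divr_gt0.
have [N NP] := fg _ e20; exists N => n m x Nn Nm Ax.
have := nrm_tri (g x) (f n x) (f m x); rewrite (nrmC (g x)).
by have := NP n x Nn Ax; have := NP m x Nm Ax; lra.
Qed.

Lemma ulim_pt (T : Type) (A : set T) f g (x : T) : ulim A f g -> A x -> (fun n => f n x) @ \oo --> (g x : C).
Proof.
move=> fg Ax; apply/cvgCP => e e0; have e20 : 0 < e / 2 by rewrite divr_gt0.
have [N NP] := fg _ e20; exists N => // n /= Nn; have := NP n x Nn Ax; lra.
Qed.

Lemma ulim_near (T : topologicalType) (A : set T) (f : nat -> T -> C) g (t : T) :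
  ulim A f g -> nbhs t A -> (forall n, cont_at (f n) t) -> cont_at g t.
Proof.
move=> fg At fc.
apply/contP => e e0; have e30 : 0 < e / 4 by rewrite divr_gt0.
have At' := nbhs_singleton At.
have [N NP] := fg _ e30; have /contP/(_ _ e30) := fc N; apply: filterS2 At => s As sP.
have := NP N s (leqnn _) As; have := NP N t (leqnn _) At'.
have := nrm_tri (f N s) (g s) (g t); have := nrm_tri (f N t) (f N s) (g t).
rewrite (nrmC (g s) (f N s)); lra.
Qed.

(** Weierstrass: Cauchy's formula for [f n] passes to the limit, and a Cauchy integral is
    differentiable. *)
Lemma AD_ulim (f : nat -> C -> C) g : (forall n, AD [::] (f n)) ->
  ulim [set z | nrm z <= 1] f g -> AD [::] (fun z => g (ret z)).
Proof.
move=> fAD fg; have gc z : cont_at (fun z => g (ret z)) z.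
  apply: (@ulim_near _ setT (fun n z => f n (ret z))) => [e /fg[N NP]||n].
  - by exists N => n x Nn _; apply: NP => //; exact: ret_le1.
  - exact: filterT.
  - by apply: cont_comp; [exact: ret_cont|apply fAD].
have uc t : cont_at (fun t => g (ret (expi t))) t := cont_comp (expi_cont t) (gc _).
split => // z z1 _; exists (cauchy2 (fun t => g (ret (expi t))) z).
apply: cdiff_near (cauchy1_diff uc z1); have := disc_near z1; apply: filterS => w w1.
rewrite ret_id ?ltW //; have w10 : 0 < 1 - nrm w by rewrite subr_gt0.
apply/eqP; rewrite -subr_eq0 -nrm_eq0 eq_le nrm_ge0 andbT; apply/ler_addgt0Pl => e e0.
(* The factor compensates the division by [1 - nrm w] in [cauchy1_bound]. *)
rewrite addr0; pose h := e / 2 * (1 - nrm w).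
have h0 : 0 < h by rewrite mulr_gt0 // divr_gt0.
have [N NP] := fg _ h0.
have E : cauchy1 (fun t => g (ret (expi t))) w - f N w = cauchy1 (fun t => g (ret (expi t)) - f N (expi t)) w.
  rewrite (AD_formula (fAD N) w1) /cauchy1 -cavgB.
  - by apply: cavg_eq => t; ring.
  - move=> t; apply: contM; last exact: kernel_cont.
    by apply: contM; [exact: uc|exact: expi_cont].
  - move=> t; apply: contM; last exact: kernel_cont.
    by apply: contM; [exact: AD_expi_cont (fAD N)|exact: expi_cont].
have : nrm (cauchy1 (fun t => g (ret (expi t)) - f N (expi t)) w) <= h / (1 - nrm w).
  apply: cauchy1_bound => // t; first by apply: contB; [exact: uc|exact: AD_expi_cont (fAD N)].
  by rewrite ret_expi nrmC; apply: NP => //=; rewrite nrm_expi.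
rewrite -E mulfK ?gt_eqF // => b1.
have b2 : nrm (f N w - g w) <= h by apply: NP => //; exact: ltW.
have b3 : h <= e / 2.
  by apply: ler_piMr; [rewrite divr_ge0 // ltW|rewrite lerBlDr lerDl nrm_ge0].
have := nrm_tri (f N w) (cauchy1 (fun t => g (ret (expi t))) w) (g w); lra.
Qed.

(** By the maximum principle a sequence that is uniformly Cauchy on the circle is so on the closed
    disc. *)
Lemma AD_circle_lim (f : nat -> C -> C) : (forall n, AD [::] (f n)) ->
  ucauchy setT (fun n t => f n (expi t)) ->
  exists2 g, AD [::] g & ulim [set z | nrm z <= 1] f g.
Proof.
move=> fAD fc; have fD : ucauchy [set z | nrm z <= 1] f.
  move=> e /fc[N NP]; exists N => n m z Nn Nm z1.
  by apply: (max_principle_closed (AD_B (fAD n) (fAD m))) z1 => t; exact: NP.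
have [g gP] := ucauchy_lim fD; exists (fun z => g (ret z)); first exact: AD_ulim gP.
move=> e /gP[N NP]; exists N => n x Nn x1; rewrite ret_id //; exact: NP.
Qed.

(** Transfers statements about a ball to the unit disc by an affine map. Because [q < r] the closed
    disc fits into the ball, and [ret] makes the composite a function on the plane. *)
Lemma ball_AD s F a r q : 0 < q -> q < r ->
  (forall z, nrm (z - a) < r -> cont_at F z) ->
  (forall z, nrm (z - a) < r -> z \notin s -> cdiffable F z) ->
  AD [seq (c - a) / rc q | c <- s] (fun z => F (a + rc q * ret z)).
Proof.
move=> q0 qr Fc Fd; have inb z : nrm z <= 1 -> nrm (a + rc q * z - a) < r.
  move=> z1; rewrite addrC addKr nrmM nrm_rc gtr0_norm //.
  by apply: le_lt_trans qr; rewrite -[leRHS]mulr1 ler_pM2l.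
apply: (@AD_ret _ _ (fun z => F (a + rc q * z))) => [z|z z1 zs].
  apply: cont_comp; last by apply: Fc; apply: inb; exact: ret_le1.
  by apply: contD; [exact: cont_cst|apply: contZ; exact: ret_cont].
have [||d Fdz] := Fd (a + rc q * z); first by apply: inb; exact: ltW.
  apply: contra zs => zs; apply/mapP; exists (a + rc q * z) => //.
  by rewrite addrC addKr mulrAC mulfV ?mul1r // rc_eq0 gt_eqF.
exists (d * rc q); apply: (@cdiff_comp _ (fun z => a + rc q * z)) Fdz.
rewrite -[X in cdiff _ _ X]add0r; apply: dqD; first exact: dq_cst.
by rewrite -[X in dq _ _ _ X]mulr1; apply: dqZ; exact: dq_id.
Qed.

Lemma ball_cdiff F a q z d : 0 < q -> nrm z < 1 ->
  cdiff (fun z => F (a + rc q * ret z)) z d -> cdiff F (a + rc q * z) (d / rc q).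
Proof.
move=> q0 z1 Fd; have q0' : rc q != 0 :> C by rewrite rc_eq0 gt_eqF.
have lin : cdiff (fun w => (w - a) / rc q) (a + rc q * z) (rc q)^-1.
  rewrite -[X in cdiff _ _ X]mulr1; under eq_fun do rewrite mulrC; apply: dqZ.
  by rewrite -[1]subr0; apply: dqB; [exact: dq_id|exact: dq_cst].
have E : (a + rc q * z - a) / rc q = z by rewrite addrC addKr mulrAC mulfV ?mul1r.
apply: cdiff_near; last by apply: cdiff_comp lin _; rewrite E; exact: Fd.
have : cont_at (fun w => (w - a) / rc q) (a + rc q * z) by exact: cdiff_cont lin.
move=> /cont_atP; rewrite E => H.
have : \forall w \near a + rc q * z, ret ((w - a) / rc q) = (w - a) / rc q by exact: (H _ (ret_near z1)).
apply: filterS => w ->.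
by rewrite mulrCA mulfV // mulr1 addrC subrK.
Qed.

Lemma removable F a r : 0 < r -> (forall z, nrm (z - a) < r -> cont_at F z) ->
  (forall z, nrm (z - a) < r -> z != a -> cdiffable F z) -> cdiffable F a.
Proof.
move=> r0 Fc Fd; have q0 : 0 < r / 2 by rewrite divr_gt0.
have qr : r / 2 < r by lra.
have FAD : AD [seq (c - a) / rc (r / 2) | c <- [:: a]] (fun z => F (a + rc (r / 2) * ret z)).
  by apply: (@ball_AD [:: a] F a r (r / 2)) => // z zr; rewrite inE => za; exact: Fd.
have := AD_cdiff FAD (_ : nrm 0 < 1); rewrite nrm0 => /(_ ltr01) H.
by have := ball_cdiff q0 _ H; rewrite nrm0 mulr0 addr0 => /(_ ltr01) ?; eexists; eassumption.
Qed.

(** After rescaling to the unit disc [F'] is [cauchy2] up to a factor, and [cauchy2] has the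
    derivative [cauchy3]. *)
Lemma derivative_holomorphic F F' a r : 0 < r ->
  (forall z, nrm (z - a) < r -> cdiff F z (F' z)) -> cdiffable F' a.
Proof.
move=> r0 Fd; have q0 : 0 < r / 2 by rewrite divr_gt0.
have qr : r / 2 < r by lra.
pose q := r / 2; rewrite -/q in q0 qr; have q0' : rc q != 0 :> C by rewrite rc_eq0 gt_eqF.
have FAD : AD [seq (c - a) / rc q | c <- [::]] (fun z => F (a + rc q * ret z)).
  apply: (@ball_AD _ _ _ r) => // z zr; first exact: cdiff_cont (Fd z zr).
  by move=> _; exists (F' z); exact: Fd.
have uc t := AD_expi_cont t FAD.
pose K z := cauchy2 (fun t => F (a + rc q * ret (expi t))) z / rc q.
have E z : nrm z < 1 -> F' (a + rc q * z) = K z.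
  move=> z1; apply: cdiff_uniq (ball_cdiff q0 z1 (AD_cdiff FAD z1)).
  apply: Fd; rewrite addrC addKr nrmM nrm_rc gtr0_norm //.
  apply: le_lt_trans qr; rewrite -[leRHS]mulr1 ler_pM2l // ltW //.
have n0 : nrm (0 : C) < 1 by rewrite nrm0.
exists (cauchy3 (fun t => F (a + rc q * ret (expi t))) 0 / rc q / rc q).
suff H : cdiff (fun z => F' (a + rc q * ret z)) 0 (cauchy3 (fun t => F (a + rc q * ret (expi t))) 0 / rc q).
  by have := ball_cdiff q0 n0 H; rewrite mulr0 addr0.
apply: (@cdiff_near _ K).
  by have := disc_near n0; apply: filterS => w w1; rewrite ret_id ?E // ltW.
rewrite /K; under eq_fun do rewrite mulrC; rewrite mulrC; apply: dqZ.
exact: cauchy2_diff uc _ n0.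
Qed.

Lemma ulim_holomorphic (f : nat -> C -> C) g a r : 0 < r ->
  (forall n z, nrm (z - a) < r -> cdiffable (f n) z) ->
  ulim [set z | nrm (z - a) < r] f g -> cdiffable g a.
Proof.
move=> r0 fd fg; have q0 : 0 < r / 2 by rewrite divr_gt0.
have qr : r / 2 < r by lra.
pose q := r / 2; rewrite -/q in q0 qr.
have inb z : nrm z <= 1 -> nrm (a + rc q * z - a) < r.
  move=> z1; rewrite addrC addKr nrmM nrm_rc gtr0_norm //.
  by apply: le_lt_trans qr; rewrite -[leRHS]mulr1 ler_pM2l.
have fAD n : AD [::] (fun z => f n (a + rc q * ret z)).
  apply: (@ball_AD [::] (f n) a r q) => // z zr; last by move=> _; exact: fd.
  by have [d] := fd n z zr; exact: cdiff_cont.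
have gAD : AD [::] (fun z => g (a + rc q * ret z)).
  apply: (AD_ulim (g := fun z => g (a + rc q * z)) fAD) => e /fg[N NP].
  by exists N => n x Nn x1; rewrite ret_id //; apply: NP => //; exact: inb.
have n0 : nrm (0 : C) < 1 by rewrite nrm0.
have := ball_cdiff q0 n0 (AD_cdiff gAD n0); rewrite mulr0 addr0 => ?; eexists; eassumption.
Qed.

End Consequences.

(** * Jets of periodic functions *)

Section Jets.
Variable R : realType.
Local Notation C := (Cplx R).
Implicit Types (z w d : C) (x y s t r M : R) (u v : R -> C) (U V : nat -> R -> C).

Lemma mean_value_sym u u' s t M :
  (forall x, `|x - t| <= `|s - t| -> rdiff u x (u' x)) ->
  (forall x, `|x - t| <= `|s - t| -> nrm (u' x) <= M) ->
  nrm (u s - u t) <= M * `|s - t|.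
Proof.
have [ts|/ltW st] := leP t s => ud uM.
  rewrite [X in _ * X]ger0_norm ?subr_ge0 //; apply: (mean_value (u' := u')) => // x /andP[tx xs].
    by apply: ud; rewrite !ger0_norm ?subr_ge0 //; lra.
  by apply: uM; rewrite !ger0_norm ?subr_ge0 //; lra.
rewrite nrmC distrC [X in _ * X]ger0_norm ?subr_ge0 //; apply: (mean_value (u' := u')) => // x /andP[tx xs].
  by apply: ud; rewrite distrC (distrC s) !ger0_norm ?subr_ge0 //; lra.
by apply: uM; rewrite distrC (distrC s) !ger0_norm ?subr_ge0 //; lra.
Qed.

(** The mean value inequality for [f n s - g' t * s], whose derivative is small near [t] uniformly
    in large [n]; then [n] tends to infinity. *)
Lemma ulim_rdiff (f f' : nat -> R -> C) g g' t :
  (forall n s, rdiff (f n) s (f' n s)) -> ulim setT f g -> ulim setT f' g' ->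
  cont_at g' t -> rdiff g t (g' t).
Proof.
move=> fd fg fg' /contP g'c; apply/(dq_leP _ _ _ (@rc_inj _)) => e e0.
have e20 : 0 < e / 2 by rewrite divr_gt0.
have /nbhs_ballP[h /= h0 hP] := g'c _ e20.
have [N NP] := fg' _ e20.
apply/nbhs_ballP; exists h => // s; rewrite -ball_normE /= => ts.
rewrite -rcB nrm_rc; apply/ler_addgt0Pr => e' e'0.
have e'20 : 0 < e' / 2 by rewrite divr_gt0.
have [N' N'P] := fg _ e'20; pose n := maxn N N'.
have := N'P n s (leq_maxr _ _) I; have := N'P n t (leq_maxr _ _) I.
have : nrm (f n s - g' t * rc s - (f n t - g' t * rc t)) <= e * `|s - t|.
  apply: (@mean_value_sym (fun s => f n s - g' t * rc s) (fun s => f' n s - g' t * 1)) => x xs.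
    by apply: dqB; [exact: fd|apply: dqZ; exact: dq_id].
  rewrite mulr1; have xh : ball t h x by rewrite -ball_normE /= distrC (le_lt_trans xs) // distrC.
  have := hP _ xh; have := NP n x (leq_maxl _ _) I; have := nrm_tri (g' x) (f' n x) (g' t); lra.
rewrite rcB; set A := _ - _ - (_ - _) => nA n1 n2.
have -> : g s - g t - g' t * (rc s - rc t) = (g s - f n s) + A + (f n t - g t) by rewrite /A; ring.
have := nrmD (g s - f n s + A) (f n t - g t); have := nrmD (g s - f n s) A.
rewrite (nrmC (g s) (f n s)); lra.
Qed.

Lemma per_int (T : Type) (f : R -> T) : (forall t, f (t + 2 * pi) = f t) ->
  forall (k : int) t, f (t + k%:~R * (2 * pi)) = f t.
Proof.
move=> fp k; have fn (n : nat) t : f (t + n%:R * (2 * pi)) = f t.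
  elim: n => [|n IH]; first by rewrite mul0r addr0.
  by rewrite -natr1 mulrDl mul1r addrA fp.
case: k => n t; first exact: fn.
by rewrite NegzE mulrNz mulNr -[in RHS](subrK (n.+1%:R * (2 * pi)) t) fn.
Qed.

Lemma per_expi (T : Type) (f : R -> T) : (forall t, f (t + 2 * pi) = f t) ->
  forall s t, expi s = expi t :> C -> f s = f t.
Proof. by move=> fp s t /expi_inj[k ->]; exact: per_int. Qed.

Lemma per_reduce t : exists s, 0 <= s <= 2 * pi /\ expi t = expi s :> C.
Proof. by have [s [ss E]] := circle_expi (nrm_expi t : nrm (expi t) = 1); exists s. Qed.

Lemma per_bounded u : (forall t, cont_at u t) -> (forall t, u (t + 2 * pi) = u t) ->
  exists2 M, 0 < M & forall t, nrm (u t) <= M.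
Proof.
move=> uc up; have [M M0 MP] := bounded_segment uc; exists M => // t.
by have [s [ss E]] := per_reduce t; rewrite (per_expi up E) MP.
Qed.

Lemma shift_cont (c : R) t : cont_at (fun s => s + c) t.
Proof. by apply/cont_atP; apply: cvgD; [exact: cvg_id|exact: cvg_cst]. Qed.

Lemma rdiff_shift u c t d : rdiff u (t + c) d -> rdiff (fun s => u (s + c)) t d.
Proof.
move=> [q [qc qt qE]]; exists (fun s => q (s + c)); split => //.
  exact: (cont_comp (shift_cont c t) qc).
by move=> s; rewrite qE !rcD; congr (_ * _); ring.
Qed.

Lemma rdiff_per u u' : (forall t, rdiff u t (u' t)) -> (forall t, u (t + 2 * pi) = u t) ->
  forall t, u' (t + 2 * pi) = u' t.
Proof.
move=> ud up t; apply: rdiff_uniq (ud t).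
by have := rdiff_shift (ud (t + 2 * pi)); apply: dq_eq.
Qed.

Fixpoint Ck n u : Prop :=
  if n is m.+1 then exists2 v, (forall t, rdiff u t (v t)) & Ck m v
  else forall t, cont_at u t.

Lemma Ck_cont n u : Ck n u -> forall t, cont_at u t.
Proof. by case: n => [//|n [v vd _]] t; exact: rdiff_cont (vd t). Qed.
Lemma CkS n u : Ck n.+1 u -> Ck n u.
Proof.
elim: n u => [|n IH] u [v vd vC]; first by move=> t; exact: rdiff_cont (vd t).
by exists v => //; exact: IH.
Qed.
Lemma CkD n u v : Ck n u -> Ck n v -> Ck n (fun t => u t + v t).
Proof.
elim: n u v => [|n IH] u v; first by move=> uc vc t; exact: contD.
move=> [u' ud uC] [v' vd vC]; exists (fun t => u' t + v' t); last exact: IH.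
by move=> t; exact: (dqD (ud t) (vd t)).
Qed.
Lemma CkM n u v : Ck n u -> Ck n v -> Ck n (fun t => u t * v t).
Proof.
elim: n u v => [|n IH] u v; first by move=> uc vc t; exact: contM.
move=> uC vC; have [u' ud uC'] := uC; have [v' vd vC'] := vC.
exists (fun t => u' t * v t + u t * v' t).
  by move=> t; apply: dqM (ud t) (vd t); exact: rc_cont.
by apply: CkD; apply: IH => //; exact: CkS.
Qed.

(** A [C^p] function on the circle that carries its derivatives as data, so that convergence in
    [C^p] is uniform convergence of the entries [0] to [p]. Later entries are unconstrained. *)
Definition jet p U :=
  [/\ forall l t, (l < p)%N -> rdiff (U l) t (U l.+1 t),
      forall l t, (l <= p)%N -> cont_at (U l) t &
      forall l t, (l <= p)%N -> U l (t + 2 * pi) = U l t].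

Definition jbound p U M := forall l t, (l <= p)%N -> nrm (U l t) <= M.

Lemma chain_jet p U : (forall l t, (l < p)%N -> rdiff (U l) t (U l.+1 t)) ->
  (forall l t, (l <= p)%N -> cont_at (U l) t) -> (forall t, U 0%N (t + 2 * pi) = U 0%N t) ->
  jet p U.
Proof.
move=> Ud Uc U0; split => // l; elim: l => [|l IH] t lp; first exact: U0.
apply: (rdiff_per (u := U l)) => [s|s]; first exact: Ud.
by apply: IH; exact: ltnW.
Qed.

Lemma Ck_jet p u : Ck p u -> (forall t, u (t + 2 * pi) = u t) -> exists2 U, jet p U & U 0%N = u.
Proof.
move=> uC up; suff [U [Ud Uc UE]] : exists U, [/\ forall l t, (l < p)%N -> rdiff (U l) t (U l.+1 t),
      forall l t, (l <= p)%N -> cont_at (U l) t & U 0%N = u].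
  by exists U => //; apply: chain_jet => //; rewrite UE.
elim: p u uC {up} => [|p IH] u.
  by move=> uc; exists (fun=> u); split => // l t; rewrite leqn0 => _; exact: uc.
move=> [v vd vC]; have [U [Ud Uc UE]] := IH _ vC.
exists (fun l => if l is m.+1 then U m else u); split => //.
  by case=> [|l] t lp; [rewrite UE|exact: Ud].
by case=> [|l] t lp; [exact: rdiff_cont (vd t)|exact: Uc].
Qed.

Lemma jet_Ck p U : jet p U -> Ck p (U 0%N).
Proof.
move=> [Ud Uc _]; suff H n : forall l, (l + n)%N = p -> Ck n (U l) by apply: H.
elim: n => [|n IH] l lp; first by move=> t; apply: Uc; rewrite -lp addn0.
exists (U l.+1); last by apply: IH; rewrite addSnnS.
by move=> t; apply: Ud; rewrite -lp -addSnnS leq_addr.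
Qed.

Lemma Cp_circle_jet p (u : C -> C) : Cp_circle p u ->
  exists2 U, jet p U & forall t, U 0%N t = u (expi t).
Proof.
move=> [[r1 r2] [i1 i2]].
pose a l := derive1n l (fun t => complex.Re (u (expi t))).
pose b l := derive1n l (fun t => complex.Im (u (expi t))).
exists (fun l t => pt (a l t) (b l t)); last by move=> t; exact: ptE.
have D (c : R -> R) l t : derivable (derive1n l c) t 1 -> is_derive t 1 (derive1n l c) (derive1n l.+1 c t).
  by move=> H; apply: DeriveDef; [exact: H|rewrite derive1nS derive1E].
apply: chain_jet => [l t lp|l t lp|t].
- apply/rdiffP; split; rewrite ?re_pt ?im_pt.
    by under eq_fun do rewrite re_pt; apply: D; exact: r1.
  by under eq_fun do rewrite im_pt; apply: D; exact: i1.
- by apply/cont_atP; apply: cvg_reim; under eq_fun do rewrite ?re_pt ?im_pt; rewrite ?re_pt ?im_pt; [exact: r2|exact: i2].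
- by rewrite /a /b /= expiD2pi.
Qed.

Lemma jet_Cp_circle p U (u : C -> C) : jet p U -> (forall t, U 0%N t = u (expi t)) -> Cp_circle p u.
Proof.
move=> [Ud Uc _] U0.
have E1 l : (l <= p)%N -> derive1n l (fun t => complex.Re (u (expi t))) = (fun t => re (U l t)).
  elim: l => [|l IH] lp; first by apply/funext => t; rewrite U0.
  rewrite derive1nS IH 1?ltnW //; apply/funext => t; rewrite derive1E.
  by have /rdiffP[[_ ->]] := Ud l t lp.
have E2 l : (l <= p)%N -> derive1n l (fun t => complex.Im (u (expi t))) = (fun t => im (U l t)).
  elim: l => [|l IH] lp; first by apply/funext => t; rewrite U0.
  rewrite derive1nS IH 1?ltnW //; apply/funext => t; rewrite derive1E.
  by have /rdiffP[_ [_ ->]] := Ud l t lp.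
split; split=> l lp t.
- by rewrite (E1 _ (ltnW lp)); have /rdiffP[[H _] _] := Ud l t lp; exact: H.
- by rewrite (E1 _ lp); have /cont_atP H := Uc l t lp; exact: (cvg_re H).
- by rewrite (E2 _ (ltnW lp)); have /rdiffP[_ [H _]] := Ud l t lp; exact: H.
- by rewrite (E2 _ lp); have /cont_atP H := Uc l t lp; exact: (cvg_im H).
Qed.

Lemma jet_bounded p U : jet p U -> exists2 M, 0 < M & jbound p U M.
Proof.
move=> [_ Uc Up]; suff H n : (n <= p)%N -> exists2 M, 0 < M & forall l t, (l <= n)%N -> nrm (U l t) <= M.
  by have [M M0 MP] := H p (leqnn p); exists M.
elim: n => [|n IH] np.
  have [M M0 MP] := per_bounded (fun t => Uc 0%N t np) (fun t => Up 0%N t np).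
  by exists M => // l t; rewrite leqn0 => /eqP->.
have [M M0 MP] := IH (ltnW np).
have [M' M'0 M'P] := per_bounded (fun t => Uc n.+1 t np) (fun t => Up n.+1 t np).
exists (Num.max M M') => [|l t]; first by rewrite lt_max M0.
rewrite leq_eqVlt => /predU1P[->|ln]; first by rewrite le_max M'P orbT.
by rewrite le_max MP.
Qed.

Lemma jetD p U V : jet p U -> jet p V -> jet p (fun l t => U l t + V l t).
Proof.
move=> [Ud Uc Up] [Vd Vc Vp]; split=> l t lp.
- by apply: dqD; [exact: Ud|exact: Vd].
- by apply: contD; [exact: Uc|exact: Vc].
- by rewrite Up ?Vp.
Qed.
Lemma jetZ p c U : jet p U -> jet p (fun l t => c * U l t).
Proof.
move=> [Ud Uc Up]; split=> l t lp.
- by apply: dqZ; exact: Ud.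
- by apply: contZ; exact: Uc.
- by rewrite Up.
Qed.
Lemma jet0 p : jet p (fun _ _ => 0).
Proof. by split=> l t lp; [exact: dq_cst|exact: cont_cst|]. Qed.
Lemma jetB p U V : jet p U -> jet p V -> jet p (fun l t => U l t - V l t).
Proof.
move=> Uj Vj; have := jetD Uj (jetZ (-1) Vj); congr (jet _ _).
by apply/funext => l; apply/funext => t; rewrite mulN1r.
Qed.

(** Completeness of [C^p] of the circle, on which both Baire's theorem and the successive
    approximations below rest. *)
Lemma jet_lim p (F : nat -> nat -> R -> C) : (forall n, jet p (F n)) ->
  (forall l, (l <= p)%N -> ucauchy setT (fun n => F n l)) ->
  exists2 U, jet p U & forall l, (l <= p)%N -> ulim setT (fun n => F n l) (U l).
Proof.
move=> Fj Fc; have H l : exists g, (l <= p)%N -> ulim setT (fun n => F n l) g.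
  have [lp|pl] := leqP l p; last by exists (fun=> 0).
  by have [g gP] := ucauchy_lim (Fc l lp); exists g.
have [U UP] := choice H; exists U => //.
have Uc l t : (l <= p)%N -> cont_at (U l) t.
  move=> lp; apply: ulim_near (UP l lp) _ _; first exact: filterT.
  by move=> n; have [_ c _] := Fj n; exact: c.
apply: chain_jet => // [l t lp|t].
  apply: (ulim_rdiff (f := fun n => F n l) (f' := fun n => F n l.+1)).
  - by move=> n s; have [d _ _] := Fj n; exact: d.
  - by apply: UP; exact: ltnW.
  - exact: UP.
  - exact: Uc.
have l1 := ulim_pt (UP 0%N (leq0n _)) (x := t + 2 * pi) I.
have l2 := ulim_pt (UP 0%N (leq0n _)) (x := t) I.
apply: (cvg_unique _ l1); first exact: norm_hausdorff.
have -> // : (fun n => F n 0%N (t + 2 * pi)) = (fun n => F n 0%N t).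
by apply/funext => n; have [_ _ ->] := Fj n.
Qed.

End Jets.

(** * The closed graph theorem and the Riesz projection *)

Section OpenMapping.
Variable R : realType.
Local Notation C := (Cplx R).
Local Notation V := (nat -> R -> C).
Implicit Types (f g h U : V) (x y s t r e M : R).

Variable p : nat.
(** The operator enters as a relation between jets; as their entries above [p] are arbitrary, it is
    single-valued only up to order [p]. *)
Variable Gam : V -> V -> Prop.
Hypothesis Gam_jet : forall f g, Gam f g -> jet p f /\ jet p g.
Hypothesis Gam_total : forall f, jet p f -> exists g, Gam f g.
Hypothesis Gam_add : forall f g f' g', Gam f g -> Gam f' g' ->
  Gam (fun l t => f l t + f' l t) (fun l t => g l t + g' l t).
Hypothesis Gam_scale : forall c f g, Gam f g -> Gam (fun l t => c * f l t) (fun l t => c * g l t).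
Hypothesis Gam_closed : forall (F G : nat -> V) f g, (forall n, Gam (F n) (G n)) ->
  jet p f -> jet p g ->
  (forall l, (l <= p)%N -> ulim setT (fun n => F n l) (f l)) ->
  (forall l, (l <= p)%N -> ulim setT (fun n => G n l) (g l)) -> Gam f g.
Hypothesis Gam_uniq : forall f g g', Gam f g -> Gam f g' ->
  forall l t, (l <= p)%N -> g l t = g' l t.

Definition jdist f g M := jbound p (fun l t => f l t - g l t) M.

Lemma jdist_tri g f h r s : jdist f g r -> jdist g h s -> jdist f h (r + s).
Proof.
move=> fg gh l t lp; apply: le_trans (nrm_tri (g l t) _ _) _.
by apply: lerD; [exact: fg|exact: gh].
Qed.
Lemma jdist_sym f g r : jdist f g r -> jdist g f r.
Proof. by move=> fg l t lp; rewrite nrmC; exact: fg. Qed.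
Lemma jdist_le f g r s : r <= s -> jdist f g r -> jdist f g s.
Proof. by move=> rs fg l t lp; exact: le_trans (fg l t lp) rs. Qed.
Lemma Gam_sub f g f' g' : Gam f g -> Gam f' g' ->
  Gam (fun l t => f l t - f' l t) (fun l t => g l t - g' l t).
Proof.
move=> fg fg'; have := Gam_add fg (Gam_scale (-1) fg').
by congr Gam; apply/funext => l; apply/funext => t; rewrite mulN1r.
Qed.

Lemma ulim_jdist (F : nat -> V) f g r N : (forall l, (l <= p)%N -> ulim setT (fun n => F n l) (f l)) ->
  (forall n, (N <= n)%N -> jdist (F n) g r) -> jdist f g r.
Proof.
move=> Ff Fg l t lp; apply/ler_addgt0Pr => e e0.
have [N' N'P] := Ff l lp e e0; have := N'P (maxn N N') t (leq_maxr _ _) I.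
have := Fg (maxn N N') (leq_maxl _ _) l t lp.
have := nrm_tri (F (maxn N N') l t) (f l t) (g l t); rewrite (nrmC (f l t) (F (maxn N N') l t)); lra.
Qed.

(* Baire's theorem for the sets of those [f] that are limits of first components of pairs in
   [Gam] whose second component is bounded by [n]. *)
Lemma baire : exists (n : nat) f0 (r : R), [/\ 0 < r, jet p f0 & forall f, jet p f -> jdist f f0 r ->
  forall e, 0 < e -> exists f1 g1, [/\ Gam f1 g1, jbound p g1 n%:R & jdist f1 f e]].
Proof.
apply: contrapT => noball.
have step (s : nat * (V * R)) : exists s' : V * R, jet p s.2.1 -> 0 < s.2.2 ->
    [/\ jet p s'.1, 0 < s'.2, s'.2 <= s.2.2 / 2, jdist s'.1 s.2.1 (s.2.2 / 2) &
      forall f1 g1, Gam f1 g1 -> jbound p g1 s.1%:R -> ~ jdist f1 s'.1 s'.2].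
  case: s => n [f0 r] /=; apply: contrapT => no; apply: noball.
  (* With half the radius, a ball of radius at most [r / 2] around a point of this ball fits into
     the ball of radius [r]. *)
  exists n, f0, (r / 2).
  have [f0j|nf0] := pselect (jet p f0); last by exfalso; apply: no; exists (f0, r) => /nf0.
  have [r0|r0] := ltP 0 r; last by exfalso; apply: no; exists (f0, r) => _; rewrite ltNge r0.
  split => //; first by rewrite divr_gt0.
  move=> f fj ff0 e e0; apply: contrapT => nofg; apply: no.
  exists (f, Num.min e (r / 2)) => _ _ /=; split => //.
  - by rewrite lt_min e0 divr_gt0.
  - by rewrite ge_min lexx orbT.
  - move=> f1 g1 fg1 g1n f1f; apply: nofg; exists f1, g1; split => //.
    by apply: jdist_le f1f; rewrite ge_min lexx.
have [phi phiP] := choice step.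
pose s := fix s n := if n is m.+1 then phi (m, s m) else ((fun _ _ => 0), 1) : V * R.
have sP n : jet p (s n).1 /\ 0 < (s n).2.
  elim: n => [|n [IH1 IH2]] /=; first by split=> //; exact: jet0.
  by have [] := phiP (n, s n) IH1 IH2.
have nxt n := phiP (n, s n) (sP n).1 (sP n).2.
have rn n : (s n).2 <= 1 / 2 ^+ n.
  elim: n => [|n IH]; first by rewrite expr0 divr1.
  have [_ _ h _ _] := nxt n; apply: le_trans h _.
  by rewrite exprSr invfM mulrA ler_pM2r ?invr_gt0.
(* The distance moved is paid for by the loss of radius, so all later centres stay in the [n]-th
   ball. *)
have tele n m : jdist (s (n + m)%N).1 (s n).1 ((s n).2 - (s (n + m)%N).2).
  elim: m => [|m IH]; first by rewrite addn0 subrr => l t _; rewrite subrr nrm0.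
  rewrite addnS; have [_ _ h1 h2 _] := nxt (n + m)%N.
  apply: jdist_le (jdist_tri h2 IH) => /=; move: h1 => /=; lra.
have near_ n m : (n <= m)%N -> jdist (s m).1 (s n).1 (s n).2.
  move=> /subnKC <-; apply: jdist_le (tele n _).
  by rewrite gerBl ltW //; have [] := sP (n + (m - n))%N.
have [|f fj fP] := @jet_lim _ p (fun n => (s n).1) (fun n => (sP n).1).
  move=> l lp e e0; have e20 : 0 < e / 2 by rewrite divr_gt0.
  have [N NP] : exists N, (s N).2 <= e / 2.
    have h1 : `|2^-1 : R| < 1 by rewrite ger0_norm ?invr_ge0 // invf_lt1 // ltr1n.
    have /cvgrPdist_lt/(_ _ e20)[N _ /(_ N (leqnn _))] := cvg_expr h1.
    rewrite sub0r normrN => h2; exists N; apply: le_trans (rn N) _.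
    by rewrite div1r -exprVn; apply: le_trans (ltW h2); exact: ler_norm.
  exists N => n m t Nn Nm _; have := near_ N n Nn l t lp; have := near_ N m Nm l t lp.
  have := nrm_tri ((s N).1 l t) ((s n).1 l t) ((s m).1 l t); rewrite (nrmC ((s N).1 l t)); lra.
(* The common point [f] has an image, bounded by some integer [n]. Then [f] itself belongs to the
   [n]-th set, which ball number [n.+1] was chosen to avoid. *)
have [g fg] := Gam_total fj; have [_ gj] := Gam_jet fg.
have [M M0 MP] := jet_bounded gj.
pose n := Num.bound M; have Mn : M <= n%:R by apply/ltW/archi_boundP/ltW.
have [_ _ _ _ nog] := nxt n; apply: (nog f g fg); first by move=> l t lp; exact: le_trans (MP l t lp) Mn.
exact: (ulim_jdist (N := n.+1) fP (near_ n.+1)).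
Qed.

(** If [f] is bounded by [M], then [f0] and [f0 + (r / M) f] lie in the ball of [baire]. The
    difference of their approximants, multiplied by [M / r], approximates [f] and has an image of
    size at most [2 n M / r]; [n + 1] in place of [n] keeps [K] positive. *)
Lemma almost_open : exists2 K, 0 < K & forall f M, jet p f -> 0 < M -> jbound p f M ->
  forall e, 0 < e -> exists f1 g1, [/\ Gam f1 g1, jbound p g1 (K * M) & jdist f1 f e].
Proof.
have [n [f0 [r [r0 f0j H]]]] := baire.
exists (2 * (n%:R + 1) / r) => [|f M fj M0 fM e e0].
  by rewrite divr_gt0 // mulr_gt0 // ltr_wpDl.
pose c := r / M; have c0 : 0 < c by rewrite divr_gt0.
have e'0 : 0 < e * c / 2 by rewrite divr_gt0 // mulr_gt0.
have [|l t lp|fa [ga [fga gan fad]]] := H (fun l t => f0 l t + rc c * f l t) _ _ _ e'0.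
- by apply: jetD => //; exact: jetZ.
- rewrite addrC addKr nrmM nrm_rc gtr0_norm //.
  have -> : r = c * M by rewrite /c divfK // gt_eqF.
  by rewrite ler_pM2l // fM.
have d0 : jdist f0 f0 r by move=> l t lp; rewrite subrr nrm0 ltW.
have [fb [gb [fgb gbn fbd]]] := H f0 f0j d0 _ e'0.
exists (fun l t => rc c^-1 * (fa l t - fb l t)), (fun l t => rc c^-1 * (ga l t - gb l t)).
split; first exact/Gam_scale/Gam_sub.
  move=> l t lp; rewrite nrmM nrm_rc gtr0_norm ?invr_gt0 //.
  have := nrmB (ga l t) (gb l t); have := gan l t lp; have := gbn l t lp => h1 h2 h3.
  rewrite /c invf_div; apply: (@le_trans _ _ (M / r * (2 * (n%:R + 1)))).
    by rewrite ler_pM2l ?divr_gt0 //; lra.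
  by rewrite le_eqVlt; apply/orP; left; apply/eqP; field; rewrite gt_eqF.
move=> l t lp; have c0' : rc c != 0 :> C by rewrite rc_eq0 gt_eqF.
have -> : rc c^-1 * (fa l t - fb l t) - f l t =
    rc c^-1 * ((fa l t - (f0 l t + rc c * f l t)) - (fb l t - f0 l t)).
  by rewrite rcV; field.
rewrite nrmM nrm_rc gtr0_norm ?invr_gt0 // -ler_pdivlMl ?invr_gt0 // invrK.
have := nrmB (fa l t - (f0 l t + rc c * f l t)) (fb l t - f0 l t).
have := fad l t lp; have := fbd l t lp; lra.
Qed.

(** Successive approximation: [almost_open] is applied to the remainder, whose bound each step
    halves, so the images are bounded by a geometric series of sum [2 * K * M]. By closedness their
    limit is an image of [f], and by uniqueness it is [g]. *)
Lemma Gam_bounded : exists2 K, 0 < K & forall f g M, Gam f g -> 0 < M -> jbound p f M -> jbound p g (K * M).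
Proof.
have [K K0 H] := almost_open; exists (2 * K) => [|f g M fg M0 fM]; first by rewrite mulr_gt0.
have [fj gj] := Gam_jet fg.
have Mn n : 0 < M / 2 ^+ n by rewrite divr_gt0 // exprn_gt0.
have step (s : nat * (V * V)) : exists s' : V * V, Gam s.2.1 s.2.2 -> jdist f s.2.1 (M / 2 ^+ s.1) ->
    [/\ Gam s'.1 s'.2, jdist f s'.1 (M / 2 ^+ s.1.+1) & jdist s'.2 s.2.2 (K * (M / 2 ^+ s.1))].
  case: s => n [A B] /=; have [AB|nAB] := pselect (Gam A B); last by exists (A, B) => /nAB.
  have [fA|nfA] := pselect (jdist f A (M / 2 ^+ n)); last by exists (A, B) => _ /nfA.
  have [a [b [ab bK af]]] := H _ _ (jetB fj (Gam_jet AB).1) (Mn n) fA _ (Mn n.+1).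
  exists (fun l t => A l t + a l t, fun l t => B l t + b l t) => _ _ /=; split.
  - exact: Gam_add.
  - by apply: jdist_sym => l t lp; have := af l t lp; rewrite opprB addrA (addrC (a l t)).
  - by move=> l t lp; rewrite addrC addKr; exact: bK.
have [phi phiP] := choice step.
pose s := fix s n := if n is m.+1 then phi (m, s m) else ((fun _ _ => 0), (fun _ _ => 0)) : V * V.
have G0 : Gam (fun _ _ => 0) (fun _ _ => 0).
  by have := Gam_scale 0 fg; congr Gam; apply/funext => l; apply/funext => t; rewrite mul0r.
have sP n : Gam (s n).1 (s n).2 /\ jdist f (s n).1 (M / 2 ^+ n).
  elim: n => [|n [IH1 IH2]] /=; first by split => // l t lp; rewrite subr0 expr0 divr1 fM.
  by have [] := phiP (n, s n) IH1 IH2.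
have sB n : jdist (s n.+1).2 (s n).2 (K * (M / 2 ^+ n)).
  by have [] := phiP (n, s n) (sP n).1 (sP n).2.
have h1 : `|2^-1 : R| < 1 by rewrite ger0_norm ?invr_ge0 // invf_lt1 // ltr1n.
have small c e : 0 < c -> 0 < e -> exists N : nat, forall n, (N <= n)%N -> c / 2 ^+ n <= e.
  move=> c0 e0; have ec : 0 < e / c by rewrite divr_gt0.
  have /cvgrPdist_lt/(_ _ ec)[N _ NP] := cvg_expr h1; exists N => n Nn.
  have := NP n Nn; rewrite sub0r normrN => h2.
  by rewrite mulrC -ler_pdivlMr // -exprVn; apply: le_trans (ltW h2); exact: ler_norm.
have cauchyB n m : jdist (s (n + m)%N).2 (s n).2 (2 * K * M / 2 ^+ n - 2 * K * M / 2 ^+ (n + m)).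
  elim: m => [|m IH]; first by rewrite addn0 subrr => l t _; rewrite subrr nrm0.
  rewrite addnS; apply: jdist_le (jdist_tri (sB _) IH).
  set q := 2 ^+ (n + m); have q0 : q != 0 by rewrite expf_neq0.
  by rewrite exprS -/q le_eqVlt; apply/orP; left; apply/eqP; field; apply/andP; split; rewrite ?q0 ?expf_neq0.
have nearB n m : (n <= m)%N -> jdist (s m).2 (s n).2 (2 * K * M / 2 ^+ n).
  move=> /subnKC <-; apply: jdist_le (cauchyB n _).
  by rewrite gerBl !mulr_ge0 ?invr_ge0 ?exprn_ge0 ?ltW.
have KM0 : 0 < 2 * K * M by rewrite !mulr_gt0.
have [|g' g'j g'P] := @jet_lim _ p (fun n => (s n).2) (fun n => (Gam_jet (sP n).1).2).
  move=> l lp e e0; have e20 : 0 < e / 2 by rewrite divr_gt0.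
  have [N NP] := small _ _ KM0 e20.
  exists N => n m t Nn Nm _; have := nearB N n Nn l t lp; have := nearB N m Nm l t lp.
  have := NP N (leqnn _).
  have := nrm_tri ((s N).2 l t) ((s n).2 l t) ((s m).2 l t); rewrite (nrmC ((s N).2 l t)); lra.
have fg' : Gam f g'.
  apply: (Gam_closed (F := fun n => (s n).1) (G := fun n => (s n).2)) => //.
    by move=> n; exact: (sP n).1.
  move=> l lp e e0; have [N NP] := small _ _ M0 e0; exists N => n t Nn _.
  by rewrite nrmC; apply: le_trans ((sP n).2 l t lp) (NP n Nn).
move=> l t lp; rewrite (Gam_uniq fg fg' t lp).
have := ulim_jdist (N := 0%N) (g := (s 0%N).2) g'P (nearB 0%N) t lp.
by rewrite subr0 expr0 divr1.
Qed.

End OpenMapping.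

(** * Unboundedness of the Riesz projection *)

Section RieszProjection.
Variable R : realType.
Local Notation C := (Cplx R).
Local Notation V := (nat -> R -> C).
Implicit Types (f g h U : V) (x y s t r e M : R).

Lemma sin_mul_le x k : `|sin (k%:R * x)| <= k%:R * `|sin x|.
Proof.
elim: k => [|k IH]; first by rewrite !mul0r sin0 normr0.
rewrite -natr1 !mulrDl !mul1r sinD; apply: le_trans (ler_normD _ _) _; apply: lerD.
  by rewrite normrM (le_trans _ IH) // ler_piMr // ler_norml cos_geN1 cos_le1.
by rewrite normrM ler_piMl // ler_norml cos_geN1 cos_le1.
Qed.

(* The sum is cut at [m ~ 1 / |sin (x / 2)|]; the tail is summed by parts, since
   [2 sin (x / 2) sin ((k + 1) x)] telescopes. *)
Lemma sin_sum_le x n : `|\sum_(0 <= k < n) sin (k.+1%:R * x) / k.+1%:R| <= 3.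
Proof.
pose q : R := `|sin (x / 2)|; have q_ge0 : 0 <= q by exact: normr_ge0.
have term k : `|sin (k.+1%:R * x) / k.+1%:R| <= 2 * q.
  rewrite normrM normfV normr_nat ler_pdivrMr ?ltr0Sn //.
  apply: le_trans (sin_mul_le x k.+1) _; rewrite mulrC ler_pM2r ?ltr0Sn //.
  have -> : sin x = 2 * (sin (x / 2) * cos (x / 2)).
    by rewrite [in LHS](_ : x = x / 2 + x / 2) ?sinD; lra.
  rewrite !normrM normr_nat ler_pM2l // -[leRHS]mulr1; apply: ler_pM => //.
  by rewrite ler_norml cos_geN1 cos_le1.
have first_ m : `|\sum_(0 <= k < m) sin (k.+1%:R * x) / k.+1%:R| <= m%:R * (2 * q).
  elim: m => [|m IH]; first by rewrite big_geq // normr0 mul0r.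
  rewrite big_nat_recr //= -[m.+1%:R in leRHS]natr1 mulrDl mul1r.
  by apply: le_trans (ler_normD _ _) _; apply: lerD => //; exact: term.
have [q0|q0] := eqVneq q 0.
  by apply: le_trans (first_ n) _; rewrite q0 !mulr0.
have {}q0 : 0 < q by rewrite lt_def q0.
pose m := Num.truncn q^-1.
have /andP[mq qm] : m%:R <= q^-1 < m.+1%:R by apply: truncn_itv; rewrite invr_ge0.
have mq1 : m%:R * q <= 1 by rewrite -ler_pdivlMr // div1r.
have [nm|/ltnW mn] := leqP n m.
  apply: le_trans (first_ n) _; have : n%:R * q <= m%:R * q by rewrite ler_pM2r // ler_nat.
  by lra.
rewrite (big_cat_nat (leq0n m) mn) /=; apply: le_trans (ler_normD _ _) _.
have := first_ m; set S2 := \sum_(m <= k < n) _ => S1.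
suff : `|S2| <= 1 by lra.
pose c k := cos ((k%:R + 1 / 2) * x).
have c1 k : `|c k| <= 1 by rewrite ler_norml cos_geN1 cos_le1.
have ck k : 2 * sin (x / 2) * sin (k.+1%:R * x) = c k - c k.+1.
  have -> : c k = cos (k.+1%:R * x - x / 2) by rewrite /c -[k.+1%:R]natr1; congr cos; field.
  have -> : c k.+1 = cos (k.+1%:R * x + x / 2) by rewrite /c; congr cos; field.
  by rewrite cosB cosD; ring.
pose T j := \sum_(m <= k < m + j) (c k - c k.+1) / k.+1%:R.
(* Summation by parts as an invariant: with the boundary term added, each step changes the left side
   by at most [1 / N.+1 - 1 / N.+2], where [N = m + j], and these telescope. *)
have TP j : `|T j + c (m + j)%N / (m + j).+1%:R| <= 2 / m.+1%:R - 1 / (m + j).+1%:R.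
  elim: j => [|j IH].
    rewrite addn0 /T addn0 big_geq // add0r normrM normfV normr_nat.
    have -> : 2 / m.+1%:R - 1 / m.+1%:R = 1 / m.+1%:R :> R.
      by rewrite -mulrBl; congr (_ * _); ring.
    by rewrite ler_pM2r ?invr_gt0 ?ltr0Sn.
  rewrite /T addnS big_nat_recr ?leq_addr //= -/(T j).
  set N := (m + j)%N in IH *; have N0 : (0 : R) < N.+1%:R by exact: ltr0Sn.
  have N1 : (0 : R) < N.+2%:R by exact: ltr0Sn.
  have -> : T j + (c N - c N.+1) / N.+1%:R + c N.+1 / N.+2%:R =
     (T j + c N / N.+1%:R) - c N.+1 * (1 / N.+1%:R - 1 / N.+2%:R).
    by field; rewrite !gt_eqF.
  have d0 : 0 <= 1 / N.+1%:R - 1 / N.+2%:R :> R.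
    by rewrite subr_ge0 !div1r lef_pV2 ?posrE // ler_nat.
  have : `|c N.+1 * (1 / N.+1%:R - 1 / N.+2%:R)| <= 1 / N.+1%:R - 1 / N.+2%:R.
    by rewrite normrM (ger0_norm d0) ler_piMl.
  move=> h; apply: le_trans (ler_normB _ _) _; apply: le_trans (lerD IH h) _.
  by rewrite addrA subrK.
have Tle : `|T (n - m)%N| <= 2 / m.+1%:R.
  have := TP (n - m)%N; rewrite subnKC //.
  set a := T _; set b := c n / n.+1%:R => ab.
  have : `|b| <= 1 / n.+1%:R by rewrite normrM normfV normr_nat ler_pM2r ?invr_gt0 ?ltr0Sn.
  move=> hb; have := ler_normB (a + b) b; rewrite addrK => h; apply: le_trans h _.
  by apply: le_trans (lerD ab hb) _; rewrite subrK.
have TS : T (n - m)%N = 2 * sin (x / 2) * S2.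
  rewrite /T subnKC // /S2 mulr_sumr; apply: eq_bigr => k _.
  by rewrite -ck mulrA.
move: Tle; rewrite TS !normrM normr_nat -/q.
rewrite -mulrA ler_pM2l // => H; rewrite -(ler_pM2l q0) mulr1; apply: le_trans H _.
rewrite -[leRHS]invrK lef_pV2 ?posrE ?invr_gt0 //; exact: ltW.
Qed.

Lemma inv_consecutive (y : R) : 0 < y -> 2 / y - 2 / (y + 1) = (y * (y + 1) / 2)^-1.
Proof.
move=> y0; have yn : y != 0 by rewrite gt_eqF.
have y1n : y + 1 != 0 by rewrite gt_eqF // addr_gt0.
rewrite invf_div; apply: (mulIf (mulf_neq0 yn y1n)); rewrite divfK ?mulf_neq0 //.
by rewrite mulrBl mulrA divfK // [y * _]mulrC mulrA divfK //; ring.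
Qed.

(** The induction carries the sharper bound [2 - 2 / n.+1]; its step is
    [1 / y^2 <= 2 / y - 2 / (y + 1)] for [y >= 1]. *)
Lemma inv_square_sum_le n : \sum_(0 <= k < n) (k.+1%:R ^+ 2)^-1 <= 2 :> R.
Proof.
suff : \sum_(0 <= k < n) (k.+1%:R ^+ 2)^-1 <= 2 - 2 / n.+1%:R :> R.
  by move=> h; apply: le_trans h _; rewrite gerBl divr_ge0.
elim: n => [|n IH]; first by rewrite big_geq // divr1 subrr.
rewrite big_nat_recr //=; apply: le_trans (lerD IH (lexx _)) _.
have n1 : 0 < n.+1%:R :> R by exact: ltr0Sn.
have n2 : 0 < n.+2%:R :> R by exact: ltr0Sn.
have n12 : n.+2%:R = n.+1%:R + 1 :> R by rewrite natr1.
have n1' : 1 <= n.+1%:R :> R by rewrite ler1n.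
have : (n.+1%:R ^+ 2)^-1 <= 2 / n.+1%:R - 2 / n.+2%:R :> R.
  rewrite n12 inv_consecutive // -n12.
  by rewrite lef_pV2 ?posrE ?divr_gt0 ?mulr_gt0 ?exprn_gt0 // n12 expr2; nra.
move=> h; apply: le_trans (lerD (lexx _) h) _; by rewrite addrA subrK.
Qed.

Lemma harmonic_unbounded (M : R) : exists n, M < \sum_(0 <= k < n) k.+1%:R^-1.
Proof.
apply: contrapT => /forallNP H; have := @dvg_harmonic R; apply.
apply: nondecreasing_is_cvgn.
  apply: nondecreasing_series => n _ _; exact: harmonic_ge0.
exists M => _ [n _ <-]; by have /negP := H n; rewrite -leNgt.
Qed.

Lemma rc_sum (u : nat -> R) n : rc (\sum_(0 <= k < n) u k) = \sum_(0 <= k < n) rc (u k).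
Proof.
elim: n => [|n IH]; first by rewrite !big_geq.
by rewrite !big_nat_recr //= rcD IH.
Qed.

Lemma expi_sub x : expi x - expi (- x) = 2 * (iu R * rc (sin x)) :> C.
Proof.
rewrite (cplxE (expi x)) (cplxE (expi (- x))) !re_expi !im_expi cosN sinN rcN.
by ring.
Qed.

Section Contradiction.
Variable p : nat.
Variable Gam : V -> V -> Prop.
Hypothesis Gam_add : forall f g f' g', Gam f g -> Gam f' g' ->
  Gam (fun l t => f l t + f' l t) (fun l t => g l t + g' l t).
Hypothesis Gam_scale : forall c f g, Gam f g -> Gam (fun l t => c * f l t) (fun l t => c * g l t).

Definition epos (k : nat) : V := fun l t => (iu R * k%:R) ^+ l * expi (k%:R * t).
Definition eneg (k : nat) : V := fun l t => (- iu R * k%:R) ^+ l * expi (- (k%:R * t)).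

Lemma Gam_sum (F G : nat -> V) n : Gam (fun _ _ => 0) (fun _ _ => 0) ->
  (forall k, Gam (F k) (G k)) ->
  Gam (fun l t => \sum_(0 <= k < n) F k l t) (fun l t => \sum_(0 <= k < n) G k l t).
Proof.
move=> G0 FG; elim: n => [|n IH].
  have E : (fun=> (fun=> 0)) = (fun (l : nat) (t : R) => \sum_(0 <= k < 0) (0 : C)).
    by apply/funext => l; apply/funext => t; rewrite big_geq.
  congr Gam: G0; apply/funext => l; apply/funext => t; by rewrite big_geq.
have := Gam_add IH (FG n).
by congr Gam; apply/funext => l; apply/funext => t; rewrite big_nat_recr.
Qed.

(** Integration by parts: the Fourier coefficient of index [- k] of [g l.+1] is [- i k] times that
    of [g l]. *)
Lemma cavg_shift_jet k g : jet p g -> cavg (fun t => expi (k%:R * t) * g 0%N t) = 0 ->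
  forall l, (l <= p)%N -> cavg (fun t => expi (k%:R * t) * g l t) = 0.
Proof.
move=> [gd gc gp] g0; have ed t : rdiff (fun t => expi (k%:R * t)) t (iu R * k%:R * expi (k%:R * t)).
  have E s : expi (k%:R * s) = expi s ^+ k :> C by exact: expiMn.
  rewrite E; apply: (dq_eq (f := fun s => expi s ^+ k)) => //.
  rewrite (_ : _ * _ = k%:R * expi t ^+ k.-1 * (iu R * expi t)); first by apply: dqX (expi_diff t); exact: rc_cont.
  case: k {g0 E} => [|k]; first by rewrite mulr0 !mul0r.
  by rewrite /= exprS; ring.
have ec t : cont_at (fun t => expi (k%:R * t) : C) t by exact: rdiff_cont (ed t).
elim=> [//|l IH] lp.
have : cavg (fun t => iu R * k%:R * expi (k%:R * t) * g l t + expi (k%:R * t) * g l.+1 t) = 0.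
  apply: (@cavg_derive _ (fun t => expi (k%:R * t) * g l t)).
  - move=> t; apply: contD; apply: contM => //; [apply: contZ => //|apply: gc; exact: ltnW|exact: gc].
  - by move=> t; apply: (dqM (rc_cont t) (ed t)); exact: gd.
  - have gp' := gp l 0 (ltnW lp); rewrite add0r in gp'.
    by rewrite gp' mulr0 expi0 expiMn expi2pi expr1n.
rewrite cavgD.
- rewrite (cavg_eq (v := fun t => iu R * k%:R * (expi (k%:R * t) * g l t))); last by move=> t; rewrite mulrA.
  rewrite cavgZ ?IH ?mulr0 ?add0r 1?ltnW // => t; apply: contM => //; apply: gc; exact: ltnW.
- by move=> t; apply: contM; [apply: contZ|apply: gc; exact: ltnW].
- by move=> t; apply: contM => //; exact: gc.
Qed.

(* The sum of [(epos k / (i k)^p - eneg k / (- i k)^p) / k] has bounded derivatives up to order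
   [p], the last one being [2 i sum_k sin (k t) / k]. Averaging the conjugates by rotations of
   its image leaves the positive frequencies, that is, the harmonic series. *)
Lemma riesz_unbounded :
  (forall k, Gam (epos k) (epos k)) ->
  (forall k, exists g, [/\ Gam (eneg k.+1) g, jet p g & cavg (fun t => expi (k.+1%:R * t) * g 0%N t) = 0]) ->
  ~ exists2 K, 0 < K & forall f g M, Gam f g -> 0 < M -> jbound p f M -> jbound p g (K * M).
Proof.
move=> Gpos /choice[G GP] [K K0 KP].
(* Normalized so that in the derivative of order [p] the exponentials have coefficients [1 / k.+1]
   and [- 1 / k.+1]. *)
pose a k : C := (k.+1%:R * (iu R * k.+1%:R) ^+ p)^-1.
pose b k : C := - (k.+1%:R * (- iu R * k.+1%:R) ^+ p)^-1.
have kn k : k.+1%:R != 0 :> C by rewrite -rcn rc_eq0 pnatr_eq0.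
have ik k : iu R * k.+1%:R != 0 by rewrite mulf_neq0 // iu_neq0.
have nik k : - iu R * k.+1%:R != 0 by rewrite mulf_neq0 // oppr_eq0 iu_neq0.
have nrmk k : nrm (k.+1%:R : C) = k.+1%:R by rewrite -rcn nrm_rc normr_nat.
have nrmik k : nrm (iu R * k.+1%:R) = k.+1%:R by rewrite nrmM nrm_iu mul1r.
have nrmnik k : nrm (- iu R * k.+1%:R) = k.+1%:R by rewrite nrmM nrmN nrm_iu mul1r.
(* The [k]-th summand translated by [s]. Translation multiplies the exponentials by constants, so
   linearity puts the pair [F s k], [H s k] into the graph. *)
pose F s k l t := a k * expi (k.+1%:R * s) * epos k.+1 l t + b k * expi (- (k.+1%:R * s)) * eneg k.+1 l t.
pose H s k l t := a k * expi (k.+1%:R * s) * epos k.+1 l t + b k * expi (- (k.+1%:R * s)) * G k l t.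
have FH s k : Gam (F s k) (H s k).
  by apply: Gam_add; apply: Gam_scale => //; have [] := GP k.
have G0 : Gam (fun _ _ => 0) (fun _ _ => 0).
  by have := Gam_scale 0 (Gpos 0%N); congr Gam; apply/funext => l; apply/funext => t; rewrite mul0r.
have FE s k l t : F s k l t =
    (iu R * k.+1%:R) ^+ l / (k.+1%:R * (iu R * k.+1%:R) ^+ p) * expi (k.+1%:R * (t + s))
    - (- iu R * k.+1%:R) ^+ l / (k.+1%:R * (- iu R * k.+1%:R) ^+ p) * expi (- (k.+1%:R * (t + s))).
  by rewrite /F /a /b /epos /eneg mulrDr opprD !expiD; ring.
(* The bound is [2 * 3] for [l = p], by [sin_sum_le], and [2 * 2] for [l < p], by
   [inv_square_sum_le]. *)
have Fb s n : jbound p (fun l t => \sum_(0 <= k < n) F s k l t) 6.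
  move=> l t; rewrite leq_eqVlt => /predU1P[->|lp].
    have E k : F s k p t = 2 * iu R * rc (sin (k.+1%:R * (t + s)) / k.+1%:R).
      have cc (x y : C) : y != 0 -> y / (x * y) = x^-1.
        by move=> y0; rewrite invfM mulrCA mulfV ?mulr1.
      rewrite FE (cc _ _ (expf_neq0 p (ik k))) (cc _ _ (expf_neq0 p (nik k))) -mulrBr expi_sub rcM rcV rcn.
      by rewrite mulrC !mulrA.
    under eq_bigr do rewrite E; rewrite -mulr_sumr -rc_sum !nrmM nrm_iu nrm_rc mulr1.
    by rewrite -rcn nrm_rc normr_nat; have := sin_sum_le (t + s) n; lra.
  apply: le_trans (nrm_sum _ _ _) _.
  apply: (@le_trans _ _ (\sum_(0 <= k < n) 2 * (k.+1%:R ^+ 2)^-1)); last first.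
    by rewrite -mulr_sumr; have := inv_square_sum_le n; lra.
  apply: ler_sum => k _; rewrite FE; apply: le_trans (nrmB _ _) _.
  have h (x : C) y : nrm x = k.+1%:R -> nrm (x ^+ l / (k.+1%:R * x ^+ p) * expi y) <= (k.+1%:R ^+ 2)^-1.
    move=> xk; rewrite !nrmM nrm_expi mulr1 nrmV nrmM !nrmX xk nrmk -exprS.
    rewrite ler_pdivrMr ?exprn_gt0 ?ltr0Sn // mulrC ler_pdivlMr ?exprn_gt0 ?ltr0Sn // -exprD.
    by rewrite ler_weXn2l ?ler1n // addn2 ltnS.
  apply: le_trans (lerD (h _ _ (nrmik k)) (h _ _ (nrmnik k))) _.
  by rewrite -mulr2n mulr_natl.
have [n nK] := harmonic_unbounded (K * 6).
(* The image of the translate by [- t], evaluated at [t]. Positive frequencies contribute the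
   constants [1 / k.+1]; the other terms have mean [0]. *)
pose Phi t := \sum_(0 <= k < n) H (- t) k p t.
have PhiE t : Phi t = \sum_(0 <= k < n) (rc (k.+1%:R^-1) + b k * (expi (k.+1%:R * t) * G k p t)).
  apply: eq_bigr => k _; rewrite /H /a /epos mulrN opprK; congr (_ + _); last by rewrite mulrA.
  rewrite rcV rcn invfM mulrACA -(mulrA (k.+1%:R)^-1) mulVf ?expf_neq0 // mulr1 expiN.
  by rewrite mulVf ?mulr1 // expi_neq0.
have Gc k t : cont_at (fun t => b k * (expi (k.+1%:R * t) * G k p t)) t.
  apply: contZ; apply: contM; last by have [_ [_ gc _] _] := GP k; exact: gc.
  have -> : (fun t => expi (k.+1%:R * t)) = (fun t => expi t ^+ k.+1 : C) by apply/funext => u; exact: expiMn.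
  by apply: contX; exact: expi_cont.
have Hc k t : cont_at (fun t => rc (k.+1%:R^-1) + b k * (expi (k.+1%:R * t) * G k p t)) t.
  by apply: contD; [exact: cont_cst|exact: Gc].
have avgPhi : cavg Phi = rc (\sum_(0 <= k < n) k.+1%:R^-1).
  rewrite (cavg_eq PhiE) cavg_sum // rc_sum; apply: eq_bigr => k _.
  rewrite cavgD; [|by move=> t; exact: cont_cst|by move=> t; exact: Gc].
  rewrite cavg_cst cavgZ; last first.
    move=> t; apply: contM; last by have [_ [_ gc _] _] := GP k; exact: gc.
    have -> : (fun t => expi (k.+1%:R * t)) = (fun t => expi t ^+ k.+1 : C) by apply/funext => u; exact: expiMn.
    by apply: contX; exact: expi_cont.
  by have [_ gj g0] := GP k; rewrite (cavg_shift_jet gj g0 (leqnn p)) mulr0 addr0.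
have : nrm (cavg Phi) <= K * 6.
  apply: cavg_bound => [t|t _].
    have -> : Phi = (fun t => \sum_(0 <= k < n) (rc k.+1%:R^-1 + b k * (expi (k.+1%:R * t) * G k p t))).
      by apply/funext => v; exact: PhiE.
    by apply: cont_sum => k; exact: Hc.
  have := KP _ _ 6 (Gam_sum n G0 (FH (- t))) (ltr0Sn _ _) (Fb (- t) n) p t (leqnn p).
  by [].
rewrite avgPhi nrm_rc ger0_norm; first by rewrite leNgt nK.
by apply: sumr_ge0 => k _; rewrite invr_ge0.
Qed.
End Contradiction.
End RieszProjection.

(** * Boundary values of the Riemann maps *)

Section PlaneTopology.
Variable R : realType.
Local Notation C := (Cplx R).
Local Notation S := (sphere R).
Implicit Types (z w d : C) (t r e M : R) (A B Omega : set C) (f g h : C -> C).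

Lemma within_comp (T U V : topologicalType) (A : set U) (f : U -> V) (g : T -> U) (t : T) :
  {within A, continuous f} -> (forall s, A (g s)) -> cont_at g t -> cont_at (fun s => f (g s)) t.
Proof.
move=> /subspace_continuousP fc gA /cont_atP gc; apply/cont_atP => W fW.
have H : \forall s \near t, A (g s) -> W (f (g s)) := gc _ (fc _ (gA t) _ fW).
have : \forall s \near t, W (f (g s)) by apply: filterS H => s; apply.
by [].
Qed.

Lemma within_nearP A f : {within A, continuous f} <->
  forall z, A z -> forall e, 0 < e -> \forall w \near z, A w -> nrm (f w - f z) < e.
Proof.
split=> [/subspace_continuousP fc z Az e e0|fc].
  have : \forall w \near f z, nrm (w - f z) < e by apply/nbhsCP; exists e.
  by move=> /(fc z Az); rewrite nbhs_filterE.
apply/subspace_continuousP => z Az W /nbhsCP[e e0 eW].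
by have := fc z Az e e0; apply: filterS => w wP Aw; apply: eW; exact: wP.
Qed.

Lemma closure_disc : closure (unit_disc R) = [set z : C | nrm z <= 1].
Proof.
have discE z : unit_disc R z <-> nrm z < 1.
  by rewrite /unit_disc /= nrmE -rc1 rc_lt.
apply/seteqP; split=> z.
  move=> zc; rewrite /= leNgt; apply/negP => z1.
  have [w [/discE w1]] : (unit_disc R `&` [set w | nrm (w - z) < nrm z - 1]) !=set0.
    by apply: zc; apply/nbhsCP; exists (nrm z - 1) => //; rewrite subr_gt0.
  by rewrite /= nrmC => wz; have := nrmD (z - w) w; rewrite subrK; lra.
move=> /= z1 W /nbhsCP[e e0 eW].
pose q := 1 - Num.min (e / 2) (1 / 2).
have m0 : 0 < Num.min (e / 2) (1 / 2) by rewrite lt_min !divr_gt0.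
have m1 : Num.min (e / 2) (1 / 2) <= 1 / 2 by rewrite ge_min lexx orbT.
have m2 : Num.min (e / 2) (1 / 2) <= e / 2 by rewrite ge_min lexx.
have q0 : 0 <= q by rewrite /q; lra.
exists (rc q * z); split.
  apply/discE; rewrite nrmM nrm_rc ger0_norm //.
  by apply: (@le_lt_trans _ _ (q * 1)); [rewrite ler_wpM2l|rewrite mulr1 /q; lra].
apply: eW; have -> : rc q * z - z = - (rc (Num.min (e / 2) (1 / 2)) * z).
  by rewrite /q rcB rc1; ring.
rewrite nrmN nrmM nrm_rc gtr0_norm //; apply: (@le_lt_trans _ _ (e / 2 * 1)); last by lra.
by apply: ler_pM => //; [exact: ltW|exact: nrm_ge0].
Qed.

Lemma unit_discP z : unit_disc R z <-> nrm z < 1.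
Proof. by rewrite /unit_disc /= nrmE -rc1 rc_lt. Qed.

Lemma unit_circleP z : unit_circle R z <-> nrm z = 1.
Proof. by rewrite /unit_circle /= nrmE -rc1; split=> [/rc_inj|->]. Qed.

Lemma unit_circle_expi t : unit_circle R (expi t).
Proof. by apply/unit_circleP; exact: nrm_expi. Qed.

Lemma nbhs_open A z : open A -> A z -> nbhs z A.
Proof. by move=> Ao Az; apply: open_nbhs_nbhs; split. Qed.

Lemma sphere_compl_some A z : sphere_compl A (Some z) <-> ~ A z.
Proof.
split=> [H Az|nA [w Aw [wz]]]; first by apply: H; exists z.
by apply: nA; rewrite -wz.
Qed.
Lemma sphere_compl_none A : sphere_compl A None.
Proof. by case=> z _. Qed.

Lemma compact_bounded_nrm (K : set C) : compact K -> exists M, forall z, K z -> nrm z <= M.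
Proof.
move=> Kc; have : compact (@nrm R @` K).
  by apply: continuous_compact => //; apply: continuous_subspaceT; exact: nrm_continuous.
move=> /compact_bounded [M [_ MP]]; exists (M + 1) => z Kz.
have M1 : M < M + 1 by rewrite ltrDl.
by apply: le_trans (ler_norm _) (MP (M + 1) M1 (nrm z) _); exists z.
Qed.

Lemma sphere_nbhs_none M : nbhs (None : S) [set x | if x is Some z then M < nrm z else True].
Proof.
exists [set z : C | nrm z <= M]; first split.
- exact: closed_disc_compact.
- have -> : [set z : C | nrm z <= M] = @nrm R @^-1` [set x | x <= M] by [].
  by apply: closed_comp; [move=> z _; exact: nrm_continuous|exact: closed_le].
- by move=> x [[z /= /negP]|->//]; rewrite -ltNge => ? <-.
Qed.

Lemma sphere_nbhs_some z (W : set C) : nbhs z W -> nbhs (Some z : S) [set Some w | w in W].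
Proof. exact: one_point_compactification_some_nbhs. Qed.

(** Convertible to [sphere_chart_inv None]. As a map from the plane to the sphere it is continuous
    at [0] as well. *)
Definition inv_chart w : S := if w == 0 then None else Some w^-1.

Lemma inv_chart_cont w : cont_at inv_chart w.
Proof.
have [->|w0] := eqVneq w 0.
  apply/cont_atP; rewrite /inv_chart eqxx => W [K [Kc Kcl] KW].
  have [M MP] := compact_bounded_nrm Kc; pose N := Num.max M 1.
  have N0 : 0 < N by rewrite lt_max ltr01 orbT.
  have : \forall v \near (0 : C), W (inv_chart v).
    apply/nbhsCP; exists N^-1; rewrite ?invr_gt0 // => v; rewrite subr0 => vN.
    apply: KW; rewrite /inv_chart; case: eqP => [_|/eqP v0]; first by right.
    left; exists v^-1 => // /MP; rewrite nrmV => vM.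
    have v0' : 0 < nrm v by rewrite nrm_gt0.
    have : (nrm v)^-1 <= N by rewrite (le_trans vM) // le_max lexx.
    by rewrite leNgt -[N]invrK ltf_pV2 ?posrE ?invr_gt0 // vN.
  by [].
apply/cont_atP; rewrite /inv_chart (negbTE w0) => W sW.
have vc : cont_at (fun v : C => v^-1) w by apply: contV => //; exact: cont_id.
have /cont_atP/(_ _ sW) : cont_at (fun v : C => Some v^-1 : S) w.
  apply: (cont_comp vc); apply/cont_atP; exact: one_point_compactification_some_continuous.
have : \forall v \near w, v != 0 by exact: cont_neq0 (@cont_id _ w) w0.
move=> H1 H2; have : \forall v \near w, W (inv_chart v).
  by apply: filterS2 H1 H2 => v; rewrite /inv_chart => /negbTE ->.
by [].
Qed.

(** [Phi] is the boundary extension composed with the retraction, and [iPhi] the given inverse on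
    the closure. The derivative of [Phi] does not vanish, by the chain rule for
    [iPhi (Phi z) = z]. *)
Lemma interior_setup Omega (phi gamma : C -> C) : open Omega ->
  interior_riemann_map Omega phi -> interior_boundary_map Omega phi gamma ->
  exists Phi iPhi : C -> C,
  [/\ AD [::] Phi, forall z, nrm z <= 1 -> closure Omega (Phi z),
      forall z, nrm z < 1 -> Omega (Phi z), forall t, Phi (expi t) = gamma (expi t) &
  [/\ {within closure Omega, continuous iPhi},
      forall w, closure Omega w -> nrm (iPhi w) <= 1 /\ Phi (iPhi w) = w,
      forall z, nrm z <= 1 -> iPhi (Phi z) = z,
      forall w, Omega w -> nrm (iPhi w) < 1 /\ cdiffable iPhi w &
      forall z, nrm z < 1 -> exists2 d, d != 0 & cdiff Phi z d]].
Proof.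
move=> Oo [[phiD phiI phiS] phih [g gh gphi]] [P [[[PD PI PS] Pc [g0 g0c g0P]] Pphi Pgam]].
rewrite closure_disc in PD PI PS Pc g0P.
pose Phi z := P (ret z).
have PhiE z : nrm z <= 1 -> Phi z = P z by move=> z1; rewrite /Phi ret_id.
have Phiphi z : nrm z < 1 -> Phi z = phi z.
  by move=> z1; rewrite PhiE ?ltW // Pphi //; exact/unit_discP.
have PhiAD : AD [::] Phi.
  apply: AD_ret => [z|z z1 _]; first by apply: within_comp Pc _ (ret_cont z) => w; exact: ret_le1.
  have /cdiffP H : derivable phi z 1 /\ derive1 phi z = derive1 phi z.
    by split => //; apply: phih; exact/unit_discP.
  exists (derive1 phi z); apply: cdiff_near H; have := disc_near z1; apply: filterS => w w1.
  by rewrite Pphi //; exact/unit_discP.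
have PhiO z : nrm z < 1 -> Omega (Phi z).
  by move=> z1; rewrite Phiphi //; apply: phiD; exact/unit_discP.
have inv z : nrm z <= 1 -> g0 (Phi z) = z by move=> z1; rewrite PhiE // g0P.
have g0O w : Omega w -> nrm (g0 w) < 1 /\ g0 w = g w.
  move=> Ow; have [z /unit_discP z1 <-] := phiS w Ow.
  by rewrite gphi ?unit_discP // -Phiphi // inv // ltW.
have g0d w : Omega w -> cdiffable g0 w.
  move=> Ow; exists (derive1 g w); apply: (@cdiff_near _ g).
    by have := nbhs_open Oo Ow; apply: filterS => v /g0O[].
  by apply/cdiffP; split => //; exact: gh.
exists Phi, g0; split; [exact: PhiAD| |exact: PhiO| |].
- by move=> z z1; rewrite PhiE //; exact: PD.
- by move=> t; rewrite /Phi ret_expi -Pgam //; exact: unit_circle_expi.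
split; [exact: g0c| |exact: inv| |].
- by move=> w /PS[z z1 <-]; rewrite -PhiE // inv.
- by move=> w Ow; split; [have [] := g0O w Ow|exact: g0d].
- move=> z z1; have [_ Pd] := PhiAD; have [d Hd] := Pd z z1 isT; exists d => //.
  have [e He] := g0d _ (PhiO z z1); apply/eqP => d0.
  have : cdiff id z (e * d).
    apply: cdiff_near (cdiff_comp Hd He); have := disc_near z1; apply: filterS => w w1.
    by rewrite inv // ltW.
  move=> H; have := cdiff_uniq H (dq_id _ _); rewrite d0 mulr0 => /eqP.
  by rewrite eq_sym oner_eq0.
Qed.

(** [E w] is the extended exterior map at [1 / w], so that the disc parametrizes the exterior,
    infinity included. The function [rho] is provided off [0], where [1 / w] is infinite, and off
    [w0], where [E] is. Inversion reverses the circle, whence [expi (- t)]. The last clause lifts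
    curves in the boundary of [Omega] to the circle by the inverse homeomorphism. *)
Lemma exterior_setup Omega (psi : S -> S) (delta : C -> C) : 
  exterior_riemann_map Omega psi -> exterior_boundary_map Omega psi delta ->
  exists (E : C -> S) (w0 : C),
  [/\ forall w, cont_at E w, forall w, sphere_compl Omega (E w),
      forall x, sphere_compl Omega x -> exists2 w, nrm w <= 1 & E w = x,
      nrm w0 < 1 /\ E w0 = None &
  [/\ forall w v, nrm w <= 1 -> nrm v <= 1 -> E w = E v -> w = v,
      forall t, E (expi (- t)) = Some (delta (expi t)) /\ closure Omega (delta (expi t)),
      forall w, nrm w < 1 -> w \notin [:: 0; w0] -> exists rho : C -> C,
        [/\ cdiffable rho w, ~ closure Omega (rho w) & \forall v \near w, E v = Some (rho v)] &
      forall c : R -> C, (forall t, cont_at c t) -> (forall t, ~ Omega (c t) /\ closure Omega (c t)) ->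
        exists om : R -> C, forall t, [/\ cont_at om t, nrm (om t) = 1 & E (om t) = Some (c t)]]].
Proof.
move=> [[psiD psiI psiS] psih [g gh gpsi]] [P [[[PD PI PS] Pc [G Gc GP]] Ppsi Pdel]].
rewrite closure_disc in psiD psiI psiS psih gpsi Ppsi.
pose E w := P (inv_chart (ret w)).
have dom w : nrm w <= 1 -> sphere_compl (unit_disc R) (inv_chart w).
  move=> w1; rewrite /inv_chart; case: eqP => [_|/eqP w0]; first exact: sphere_compl_none.
  apply/sphere_compl_some => /unit_discP; rewrite nrmV; apply/negP; rewrite -leNgt.
  by rewrite invf_ge1 // nrm_gt0.
have dom' w : nrm w < 1 -> sphere_compl [set z : C | nrm z <= 1] (inv_chart w).
  move=> w1; rewrite /inv_chart; case: eqP => [_|/eqP w0]; first exact: sphere_compl_none.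
  apply/sphere_compl_some => /=; rewrite nrmV; apply/negP; rewrite -ltNge.
  by rewrite invf_gt1 // nrm_gt0.
have surj x : sphere_compl (unit_disc R) x -> exists2 w, nrm w <= 1 & inv_chart w = x.
  case: x => [z /sphere_compl_some nz|_]; last by exists 0; rewrite ?nrm0 // /inv_chart eqxx.
  have z1 : 1 <= nrm z by rewrite leNgt; apply/negP => z1; apply: nz; exact/unit_discP.
  have z0 : z != 0 by rewrite -nrm_gt0 (lt_le_trans ltr01).
  exists z^-1; first by rewrite nrmV invf_le1 // (lt_le_trans ltr01).
  by rewrite /inv_chart invr_eq0 (negbTE z0) invrK.
have icI w v : inv_chart w = inv_chart v -> w = v.
  rewrite /inv_chart; case: eqP => [->|_]; case: eqP => [->|_] //.
  by case=> /invr_inj.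
have EE w : nrm w <= 1 -> E w = P (inv_chart w) by move=> w1; rewrite /E ret_id.
have Epsi w : nrm w < 1 -> E w = psi (inv_chart w).
  by move=> w1; rewrite EE ?ltW // Ppsi //; exact: dom'.
have EI w v : nrm w <= 1 -> nrm v <= 1 -> E w = E v -> w = v.
  by move=> w1 v1; rewrite !EE // => H; apply: icI; apply: PI H; rewrite inE; exact: dom.
have [x0 x0D x0N] := psiS _ (@sphere_compl_none (closure Omega)).
have [w0 w01 w0E] : exists2 w0, nrm w0 < 1 & inv_chart w0 = x0.
  case: x0 x0D {x0N} => [z /sphere_compl_some nz|_]; last by exists 0; rewrite ?nrm0 // /inv_chart eqxx.
  have z1 : 1 < nrm z by rewrite ltNge; apply/negP => z1; exact: nz.
  have z0 : z != 0 by rewrite -nrm_gt0 (lt_trans ltr01).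
  exists z^-1; first by rewrite nrmV invf_lt1 // (lt_trans ltr01).
  by rewrite /inv_chart invr_eq0 (negbTE z0) invrK.
have Ew0 : E w0 = None by rewrite Epsi // w0E.
exists E, w0; split => //.
- move=> w; apply: (within_comp (g := fun w => inv_chart (ret w))) Pc _ _.
    by move=> v; apply: dom; exact: ret_le1.
  by apply: cont_comp; [exact: ret_cont|exact: inv_chart_cont].
- by move=> w; apply: PD; apply: dom; exact: ret_le1.
- by move=> x /PS[y /surj[w w1 <-] <-]; exists w => //; rewrite EE.
split.
- exact: EI.
- move=> t; have Edel : E (expi (- t)) = Some (delta (expi t)); last first.
    (* Otherwise the point would be a value of [psi] off the closed disc, against injectivity of the
       extension. *)
    split=> //; apply: contrapT => nd; have [x xD xE] := psiS (Some (delta (expi t))) ltac:(exact/sphere_compl_some).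
    have xE' : P x = P (Some (expi t)) by rewrite Ppsi // xE Pdel //; exact: unit_circle_expi.
    have : x = Some (expi t).
      apply: PI xE'; rewrite inE.
        by move=> [z /unit_discP z1 zx]; apply: xD; exists z => //=; exact: ltW.
      by apply/sphere_compl_some => /unit_discP; rewrite nrm_expi ltxx.
    by move=> xt; apply: xD; exists (expi t) => //=; rewrite nrm_expi.
  rewrite EE ?nrm_expi // expiN /inv_chart invr_eq0 (negbTE (expi_neq0 _)) invrK.
  by rewrite Pdel //; exact: unit_circle_expi.
- move=> w w1; rewrite !inE negb_or => /andP[wn0 wnw0].
  have nN v : nrm v < 1 -> v != w0 -> E v <> None.
    move=> v1 vw0 Ev; move/eqP: vw0; apply; apply: EI; rewrite ?ltW //.
    by rewrite Ev Ew0.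
  have Dw := dom' w w1; rewrite /inv_chart (negbTE wn0) in Dw.
  have [_] := psih _ Dw; rewrite /sphere_derivable.
  case Ez : (psi (Some w^-1)) => [z|]; last first.
    by case: (nN w w1 wnw0); rewrite Epsi // /inv_chart (negbTE wn0).
  move=> rd; pose rho u := sphere_chart (Some z : S) (psi (Some u)).
  have rhod : cdiff rho w^-1 (derive1 rho w^-1) by apply/cdiffP; split => //; exact: rd.
  have ed : cdiff (fun v => v^-1) w (- 1 / w ^+ 2).
    by apply: dqV; [exact: inj_id|exact: cont_id|exact: wn0|exact: dq_id].
  exists (fun v => rho v^-1); split.
  + by eexists; exact: cdiff_comp ed rhod.
  + by have := psiD _ Dw; rewrite Ez /rho Ez /= => /sphere_compl_some.
  + have h1 : \forall v \near w, v != 0 by exact: cont_neq0 (@cont_id _ w) wn0.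
    have h2 : \forall v \near w, v != w0.
      have := cont_neq0 (contB (@cont_id _ w) (cont_cst w w0)); rewrite subr_eq0 => /(_ wnw0).
      by apply: filterS => v; rewrite subr_eq0.
    have h3 := disc_near w1.
    near=> v; have v1 : nrm v < 1 by near: v.
    have v0 : v != 0 by near: v.
    have vw0 : v != w0 by near: v.
    have := nN v v1 vw0; rewrite Epsi // /inv_chart (negbTE v0) /rho.
    by case: (psi _).
- move=> c cc cO.
  have cD t : sphere_compl Omega (Some (c t)) by apply/sphere_compl_some; have [] := cO t.
  (* A preimage of modulus above [1], or at infinity, would be mapped by [psi] off the closure of
     [Omega]. *)
  have Gom t : exists om, [/\ nrm om = 1, G (Some (c t)) = Some om & P (Some om) = Some (c t)].
    have [x xD xE] := PS _ (cD t); have GE : G (Some (c t)) = x by rewrite -xE GP.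
    case: x xD xE GE => [om /sphere_compl_some omD xE GE|_ xE _].
      have om1 : 1 <= nrm om by rewrite leNgt; apply/negP => h; apply: omD; exact/unit_discP.
      have om1' : nrm om <= 1.
        rewrite leNgt; apply/negP => h.
        have D : sphere_compl [set z : C | nrm z <= 1] (Some om).
          by apply/sphere_compl_some => /=; apply/negP; rewrite -ltNge.
        have := psiD _ D; rewrite -Ppsi // xE => /sphere_compl_some; apply.
        by have [] := cO t.
      have omE : nrm om = 1 by apply/eqP; rewrite eq_le om1 om1'.
      by exists om.
    have D : sphere_compl [set z : C | nrm z <= 1] None by exact: sphere_compl_none.
    have := psiD _ D; rewrite -Ppsi // xE => /sphere_compl_some H.
    by exfalso; apply: H; have [] := cO t.
  have [om omP] := choice Gom; exists (fun t => (om t)^-1) => t.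
  have [n1 gE dE] := omP t; have n0 : om t != 0 by rewrite -nrm_gt0 n1.
  have n1' : nrm (om t)^-1 = 1 by rewrite nrmV n1 invr1.
  split => //; last by rewrite EE ?n1' // /inv_chart invr_eq0 (negbTE n0) invrK.
  apply: contV => //.
  have sc : cont_at (fun t => Some (c t) : S) t.
    apply: (cont_comp (cc t)); apply/cont_atP; exact: one_point_compactification_some_continuous.
  have /cont_atP := within_comp Gc cD sc; rewrite gE => Gcvg.
  apply/contP => e e0.
  have W : nbhs (om t) [set v | nrm (v - om t) < e] by apply/nbhsCP; exists e.
  have : \forall s \near t, [set Some w | w in [set v | nrm (v - om t) < e]] (G (Some (c s))).
    exact: (Gcvg _ (sphere_nbhs_some W)).
  by apply: filterS => s [v vP]; have [_ -> _] := omP s => -[<-].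
Unshelve. all: by end_near. Qed.

End PlaneTopology.

(** * Functions on the exterior, pulled back to the disc *)

Section ExteriorFunctions.
Variable R : realType.
Local Notation C := (Cplx R).
Local Notation S := (sphere R).
Implicit Types (z w d : C) (t r e M : R) (f g h G : C -> C).

(** The outer space of order [0], for every [p]; [h] is already the extension to the complement of
    [Omega]. *)
Definition Aext (Omega : set C) h :=
  [/\ {within ~` Omega, continuous h}, forall z, ~ closure Omega z -> cdiffable h z &
      forall e, 0 < e -> exists M, forall z, ~ Omega z -> M < nrm z -> nrm (h z) < e].

Definition at_infty0 h (x : S) : C := if x is Some z then h z else 0.

(** Points of the circle are approached radially. The centre is left out because Cauchy's formula
    along [gamma] is only derived for points other than it. *)
Lemma circle_eq0 G t : (forall z, cont_at G z) -> (forall z, nrm z < 1 -> z != 0 -> G z = 0) ->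
  G (expi t) = 0.
Proof.
move=> Gc z0; apply/eqP; rewrite -nrm_eq0 eq_le nrm_ge0 andbT leNgt; apply/negP => G0.
have /contP/(_ _ G0)/nbhsCP[r r0 rP] := Gc (expi t).
pose q := Num.min (r / 2) (1 / 2).
have q0 : 0 < q by rewrite lt_min !divr_gt0.
have q1 : q <= 1 / 2 by rewrite ge_min lexx orbT.
have qr : q <= r / 2 by rewrite ge_min lexx.
have /rP : nrm (rc (1 - q) * expi t - expi t) < r.
  have -> : rc (1 - q) * expi t - expi t = - (rc q * expi t) by rewrite rcB rc1; ring.
  by rewrite nrmN nrmM nrm_expi mulr1 nrm_rc gtr0_norm //; lra.
have qn : nrm (rc (1 - q) * expi t) = 1 - q.
  by rewrite nrmM nrm_expi mulr1 nrm_rc gtr0_norm; lra.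
rewrite z0 ?sub0r ?nrmN ?ltxx // -?nrm_gt0 qn; lra.
Qed.

Section Pullback.
Variables (Omega : set C) (E : C -> S) (w0 : C).
Hypothesis Ec : forall w, cont_at E w.
Hypothesis EO : forall w, sphere_compl Omega (E w).
Hypothesis Esurj : forall x, sphere_compl Omega x -> exists2 w, nrm w <= 1 & E w = x.
Hypothesis Ehol : forall w, nrm w < 1 -> w \notin [:: 0; w0] -> exists rho : C -> C,
  [/\ cdiffable rho w, ~ closure Omega (rho w) & \forall v \near w, E v = Some (rho v)].

(** Where [E w] is finite, continuity comes from that of [h]; where it is infinite, from the decay
    of [h]. Differentiability at [0] and [w0] follows by removability. *)
Lemma Aext_AD h : Aext Omega h -> AD [::] (fun w => at_infty0 h (E w)).
Proof.
move=> [/within_nearP hc hd hi]; apply: (@AD_removable _ [:: 0; w0]); split=> [w|w w1 wn].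
  have EOw : sphere_compl Omega (E w) by exact: EO.
  have /cont_atP Ew := Ec w; apply/contP => e e0.
  case Ez : (E w) => [z|].
    rewrite Ez in Ew EOw; have /sphere_compl_some nz := EOw.
    have H := Ew _ (sphere_nbhs_some (hc z nz e e0)).
    have : \forall v \near w, [set Some y | y in [set y | (~` Omega) y -> nrm (h y - h z) < e]] (E v) by exact: H.
    apply: filterS => v [y yP Ey]; have : sphere_compl Omega (E v) by exact: EO.
    rewrite -Ey => /sphere_compl_some ny /=.
    exact: yP.
  rewrite Ez in Ew; have [M MP] := hi e e0.
  have : \forall v \near w, [set x : S | if x is Some z then M < nrm z else True] (E v) by exact: (Ew _ (sphere_nbhs_none M)).
  apply: filterS => v; have : sphere_compl Omega (E v) by exact: EO.
  case: (E v) => [z /sphere_compl_some nz /= Mz|_ _] /=.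
    by rewrite subr0; exact: MP.
  by rewrite subrr nrm0.
have [rho [[d rd] rO rE]] := Ehol w1 wn; have [e he] := hd _ rO; exists (e * d).
by apply: cdiff_near (cdiff_comp rd he); apply: filterS rE => v ->.
Qed.

Lemma Aext_bound h M : Aext Omega h -> (forall t, nrm (at_infty0 h (E (expi t))) <= M) ->
  forall z, ~ Omega z -> nrm (h z) <= M.
Proof.
move=> hA hM z nz; have /Esurj[w w1 Ew] : sphere_compl Omega (Some z) by exact/sphere_compl_some.
by have := max_principle_closed (Aext_AD hA) hM w1; rewrite Ew.
Qed.

Lemma AextB h1 h2 : Aext Omega h1 -> Aext Omega h2 -> Aext Omega (fun z => h1 z - h2 z).
Proof.
move=> [/within_nearP c1 d1 i1] [/within_nearP c2 d2 i2]; split.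
- apply/within_nearP => z nz e e0; have e20 : 0 < e / 2 by rewrite divr_gt0.
  apply: filterS2 (c1 z nz _ e20) (c2 z nz _ e20) => w w1 w2 nw.
  have := nrmB (h1 w - h1 z) (h2 w - h2 z); have := w1 nw; have := w2 nw.
  by rewrite (_ : h1 w - h2 w - (h1 z - h2 z) = h1 w - h1 z - (h2 w - h2 z)); [lra|ring].
- by move=> z nz; have [e1 H1] := d1 z nz; have [e2 H2] := d2 z nz; exists (e1 - e2); exact: dqB.
- move=> e e0; have e20 : 0 < e / 2 by rewrite divr_gt0.
  have [M1 M1P] := i1 _ e20; have [M2 M2P] := i2 _ e20; exists (Num.max M1 M2) => z nz.
  rewrite gt_max => /andP[m1 m2]; have := nrmB (h1 z) (h2 z).
  have := M1P z nz m1; have := M2P z nz m2; lra.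
Qed.
Lemma Aext0 : Aext Omega (fun z => 0).
Proof.
split; first by apply/within_nearP => z _ e e0; apply: filterE => w _; rewrite subrr nrm0.
  by move=> z _; exists 0; exact: dq_cst.
by move=> e e0; exists 0 => z _ _; rewrite nrm0.
Qed.
Lemma AextD h1 h2 : Aext Omega h1 -> Aext Omega h2 -> Aext Omega (fun z => h1 z + h2 z).
Proof.
move=> H1 H2; have := AextB H1 (AextB Aext0 H2); congr (Aext _ _); apply/funext => z; ring.
Qed.
Lemma AextZ c h : Aext Omega h -> Aext Omega (fun z => c * h z).
Proof.
move=> [/within_nearP c1 d1 i1]; have n0 : 0 < nrm c + 1 by rewrite ltr_wpDl ?nrm_ge0.
have key e z : 0 < e -> nrm z < e / (nrm c + 1) -> nrm (c * z) < e.
  move=> e0; rewrite ltr_pdivlMr // nrmM => h1; apply: le_lt_trans h1.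
  by rewrite mulrC ler_wpM2l ?nrm_ge0 // lerDl.
split.
- apply/within_nearP => z nz e e0; have e20 : 0 < e / (nrm c + 1) by rewrite divr_gt0.
  by apply: filterS (c1 z nz _ e20) => w w1 nw; rewrite -mulrBr; apply: key => //; exact: w1.
- by move=> z nz; have [e1 H1] := d1 z nz; exists (c * e1); exact: dqZ.
- move=> e e0; have e20 : 0 < e / (nrm c + 1) by rewrite divr_gt0.
  by have [M1 M1P] := i1 _ e20; exists M1 => z nz zM; apply: key => //; exact: M1P.
Qed.

(** The maximum principle, pulled back to the disc, spreads uniform convergence from the boundary
    over the complement of [Omega]. *)
Lemma Aext_lim (h : nat -> C -> C) : (forall n, Aext Omega (h n)) ->
  ucauchy setT (fun n t => at_infty0 (h n) (E (expi t))) ->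
  exists2 g, Aext Omega g & ulim (~` Omega) h g.
Proof.
move=> hA hc; have hU : ucauchy (~` Omega) h.
  move=> e /hc[N NP]; exists N => n m z Nn Nm nz.
  apply: (Aext_bound (AextB (hA n) (hA m))) nz => t.
  have := NP n m t Nn Nm I; case: (E (expi t)) => //=.
  by rewrite subrr.
have [g gP] := ucauchy_lim hU; exists g => //; split.
- apply/within_nearP => z nz e e0; have e30 : 0 < e / 4 by rewrite divr_gt0.
  have [N NP] := gP _ e30; have [/within_nearP hNc _ _] := hA N.
  apply: filterS (hNc z nz _ e30) => w wP nw.
  have := wP nw; have := NP N w (leqnn _) nw; have := NP N z (leqnn _) nz.
  have := nrm_tri (h N w) (g w) (g z); have := nrm_tri (h N z) (h N w) (g z).
  rewrite (nrmC (g w) (h N w)); lra.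
- move=> z nz; have : nbhs z (~` closure Omega).
    by apply: nbhs_open => //; apply: closed_openC; exact: closed_closure.
  move=> /nbhsCP[r r0 rP]; apply: (@ulim_holomorphic _ h g z r) => //.
    by move=> n w wr; have [_ d _] := hA n; apply: d; exact: rP.
  move=> e /gP[N NP]; exists N => n w Nn wr; apply: NP => // Ow.
  by apply: (rP w wr); exact: subset_closure.
- move=> e e0; have e20 : 0 < e / 2 by rewrite divr_gt0.
  have [N NP] := gP _ e20; have [_ _ i] := hA N; have [M MP] := i _ e20.
  exists M => z nz zM; have := MP z nz zM; have := NP N z (leqnn _) nz.
  by have := nrmD (g z - h N z) (h N z); rewrite subrK (nrmC (g z)); lra.
Qed.

End Pullback.

(** * Uniqueness for boundaries of capacity zero *)

Section Capacity.
Variables (Omega : set C) (Phi iPhi : C -> C).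
Hypothesis Oo : open Omega.
Hypothesis PhiAD : AD [::] Phi.
Hypothesis PhiO : forall z, nrm z < 1 -> Omega (Phi z).
Hypothesis iPhic : {within closure Omega, continuous iPhi}.
Hypothesis iPhiK : forall w, closure Omega w -> nrm (iPhi w) <= 1 /\ Phi (iPhi w) = w.
Hypothesis PhiK : forall z, nrm z <= 1 -> iPhi (Phi z) = z.
Hypothesis iPhid : forall w, Omega w -> nrm (iPhi w) < 1 /\ cdiffable iPhi w.

Lemma boundary_circle w : closure Omega w -> ~ Omega w -> exists t, Phi (expi t) = w.
Proof.
move=> cw nw; have [w1 wE] := iPhiK cw; have : nrm (iPhi w) = 1.
  apply/eqP; rewrite eq_le w1 leNgt; apply/negP => h; apply: nw.
  by rewrite -wE; exact: PhiO.
by move=> /circle_expi[t [_ E]]; exists t; rewrite -E wE.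
Qed.

Lemma bounded_closure : exists M, forall z, closure Omega z -> nrm z <= M.
Proof.
have [M MP] := bounded_disc 1 PhiAD.1; exists M => z /iPhiK[z1 <-]; exact: MP.
Qed.

Variables (G h : C -> C).
Hypothesis GAD : AD [::] G.
Hypothesis hA : Aext Omega h.
Hypothesis Gh : forall t, G (expi t) = h (Phi (expi t)).

Definition glue z : C := if pselect (closure Omega z) is left _ then G (iPhi z) else h z.

Lemma glue_in z : closure Omega z -> glue z = G (iPhi z).
Proof. by rewrite /glue; case: pselect. Qed.
(** Every boundary point is some [Phi (expi t)], where the two definitions agree. Continuity of
    [glue] can then be checked separately on two closed sets. *)
Lemma glue_out z : ~ Omega z -> glue z = h z.
Proof.
rewrite /glue; case: pselect => // cz nz; have [t <-] := boundary_circle cz nz.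
by rewrite PhiK ?nrm_expi.
Qed.

Lemma glue_cont z : cont_at glue z.
Proof.
apply/contP => e e0; have [/within_nearP hc _ _] := hA.
have c1 : \forall w \near z, closure Omega w -> nrm (glue w - glue z) < e.
  have [cz|nz] := pselect (closure Omega z); last first.
    have : nbhs z (~` closure Omega).
      by apply: nbhs_open => //; apply: closed_openC; exact: closed_closure.
    by apply: filterS.
  have /within_nearP ic := iPhic; have /contP/(_ _ e0)/nbhsCP[r r0 rP] := GAD.1 (iPhi z).
  apply: filterS (ic z cz r r0) => w wP cw; rewrite !glue_in //.
  by apply: rP; exact: wP.
have c2 : \forall w \near z, ~ Omega w -> nrm (glue w - glue z) < e.
  have [Oz|nz] := pselect (Omega z).
    by have := nbhs_open Oo Oz; apply: filterS.
  by apply: filterS (hc z nz e e0) => w wP nw; rewrite !glue_out //; exact: wP.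
apply: filterS2 c1 c2 => w w1 w2; have [Ow|nw] := pselect (Omega w); last exact: w2.
by apply: w1; exact: subset_closure.
Qed.

Lemma glue_diff z : Omega z \/ ~ closure Omega z -> cdiffable glue z.
Proof.
case=> [Oz|nz].
  have [z1 [d zd]] := iPhid Oz; have [e Ge] := GAD.2 _ z1 isT; exists (e * d).
  apply: cdiff_near (cdiff_comp zd Ge); have := nbhs_open Oo Oz; apply: filterS => w Ow.
  by rewrite glue_in //; exact: subset_closure.
have [_ hd _] := hA; have [d Hd] := hd z nz; exists d; apply: cdiff_near Hd.
have : nbhs z (~` closure Omega).
  by apply: nbhs_open => //; apply: closed_openC; exact: closed_closure.
by apply: filterS => w nw; rewrite glue_out // => Ow; apply: nw; exact: subset_closure.
Qed.

Lemma glue_infty e : 0 < e -> exists M, forall z, M < nrm z -> nrm (glue z) < e.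
Proof.
move=> e0; have [_ _ hi] := hA; have [M MP] := hi e e0; have [B BP] := bounded_closure.
exists (Num.max M B) => z; rewrite gt_max => /andP[zM zB].
have nz : ~ Omega z.
  by move=> /subset_closure /BP; rewrite leNgt zB.
by rewrite glue_out //; exact: MP.
Qed.

Lemma glue_sphere_cont (x : S) : cont_at (at_infty0 glue) x.
Proof.
apply/contP => e e0; case: x => [z|].
  have /contP/(_ _ e0)/sphere_nbhs_some : cont_at glue z by exact: glue_cont.
  by apply: filterS => _ [w wP <-].
have [M MP] := glue_infty e0; have := sphere_nbhs_none M; apply: filterS.
by case=> [z zM|_] /=; rewrite subr0 ?nrm0 //; exact: MP.
Qed.

(* The difference quotient of the glued function at [z0] is admissible after scaling,
   and behaves like [- glue z0 / z] at infinity. *)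
Lemma capacity0_glue z0 : continuous_analytic_capacity (boundary Omega) = 0%:E ->
  Omega z0 -> glue z0 = 0.
Proof.
move=> cap0 Oz0; have [d0 fd0] := glue_diff (or_introl Oz0).
pose q := slope id z0 glue d0.
have qc z : cont_at q z by apply: slope_cont => //; exact: glue_cont.
(* At [z0] itself the quotient is continuous, and differentiable nearby, so the singularity is
   removable. *)
have qd z : Omega z \/ ~ closure Omega z -> cdiffable q z.
  move=> Oz; have [->|zz0] := eqVneq z z0; last exact: slope_diff (glue_diff Oz).
  have /nbhsCP[r r0 rP] := nbhs_open Oo Oz0; apply: (@removable _ _ _ r) => // w wr wz.
  by apply: slope_diff => //; apply: glue_diff; left; exact: rP.
have qE z : z != z0 -> q z = (glue z - glue z0) / (z - z0).
  by move=> zz; rewrite /q /slope /= (negbTE zz).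
(* The expression equals [(z * glue z - glue z0 * z0) / (z - z0)]. For large [z] both terms of the
   numerator are at most [nrm z * e / 8], and [nrm z <= 2 * nrm (z - z0)]. *)
have far e : 0 < e -> exists M, forall z, M < nrm z -> z != z0 /\ nrm (z * q z + glue z0) < e.
  move=> e0; have e80 : 0 < e / 8 by rewrite divr_gt0.
  have [M MP] := glue_infty e80; pose K := nrm (glue z0) * nrm z0.
  have K0 : 0 <= K by rewrite mulr_ge0 ?nrm_ge0.
  exists (Num.max M (Num.max (2 * nrm z0) (8 * K / e))) => z.
  rewrite !gt_max => /andP[zM /andP[zz zK]].
  have z00 := nrm_ge0 z0.
  have half : nrm z <= 2 * nrm (z - z0) by have := nrmD (z - z0) z0; rewrite subrK; lra.
  have zpos : 0 < nrm z by apply: le_lt_trans zz; rewrite mulr_ge0.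
  have zz0 : z != z0 by apply/eqP => E; move: zz; rewrite E; lra.
  split => //; have zz0' : z - z0 != 0 by rewrite subr_eq0.
  have alg (a b : C) : z * ((a - b) / (z - z0)) + b = (z * a - b * z0) / (z - z0).
    by apply: (mulIf zz0'); rewrite mulrDl -mulrA !divfK //; ring.
  have -> : z * q z + glue z0 = (z * glue z - glue z0 * z0) / (z - z0).
    by rewrite (qE _ zz0) alg.
  have dpos : 0 < nrm (z - z0) by rewrite nrm_gt0.
  rewrite nrmM nrmV ltr_pdivrMr //; have := nrmB (z * glue z) (glue z0 * z0).
  rewrite !nrmM -/K; have := MP z zM => g8.
  have : nrm z * nrm (glue z) <= nrm z * (e / 8) by rewrite ler_pM2l // ltW.
  move: zK; rewrite ltr_pdivrMr // => zK.
  have : nrm z * e <= 2 * nrm (z - z0) * e by rewrite ler_pM2r.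
  lra.
pose Q (x : S) := at_infty0 q x.
have Qc (x : S) : cont_at Q x.
  apply/contP => e e0; case: x => [z|].
    have /contP/(_ _ e0)/sphere_nbhs_some : cont_at q z by exact: qc.
    by apply: filterS => _ [w wP <-].
  pose L := nrm (glue z0) + 1; have L0 : 0 < L by rewrite ltr_wpDl ?nrm_ge0.
  have [M MP] := far 1 ltr01.
  have := sphere_nbhs_none (Num.max M (L / e)); apply: filterS.
  case=> [z|_] /=; rewrite subr0 ?nrm0 // gt_max => /andP[zM zL].
  have [_] := MP z zM; have := nrmB (z * q z + glue z0) (glue z0); rewrite addrK nrmM => h1 h2.
  have Le0 : 0 < L / e by rewrite divr_gt0.
  have zpos : 0 < nrm z by exact: lt_trans zL.
  rewrite -(ltr_pM2l zpos); move: zL; rewrite ltr_pdivrMr // /L; lra.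
have [M MP] : exists M, forall x, nrm (Q x) <= M.
  have Kc : compact (Q @` [set: S]).
    apply: continuous_compact; last exact: one_point_compactification_compact.
    by apply: continuous_subspaceT; apply/cont_at_continuous.
  by have [M MP] := compact_bounded_nrm Kc; exists M => x; apply: MP; exists x.
pose N := Num.max M 1; have N0 : 0 < N by rewrite lt_max ltr01 orbT.
have N0' : rc N != 0 :> C by rewrite rc_eq0 gt_eqF.
pose Q' (x : S) := (rc N)^-1 * Q x.
have adm : capacity_admissible (boundary Omega) Q'.
  split.
  - by apply/cont_at_continuous => x; exact: contZ.
  - case=> [z /sphere_compl_some nb|_].
      have : cdiffable q z.
        apply: qd; have [Oz|nz] := pselect (Omega z); [by left|right => cz; apply: nb].
        by split => // /interior_subset.
      move=> [d Hd]; have /cdiffP[H _] : cdiff (fun z => (rc N)^-1 * q z) z ((rc N)^-1 * d) by exact: dqZ.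
      exact: H.
    suff /cdiffP[H _] : cdiff (fun u => (rc N)^-1 * Q (inv_chart u)) 0 ((rc N)^-1 * - glue z0) by exact: H.
    apply: dqZ.
    have den : \forall u \near (0 : C), 1 - z0 * u != 0.
      apply: cont_neq0; last by rewrite mulr0 subr0 oner_eq0.
      by apply: contB; [exact: cont_cst|apply: contZ; exact: cont_id].
    (* In the coordinate [u = 1 / z] the quotient is this product. Its slope at [0] is the first
       factor, which is continuous with value [- glue z0] there. *)
    apply: (@cdiff_near _ (fun u => (at_infty0 glue (inv_chart u) - glue z0) / (1 - z0 * u) * u)).
      apply: filterS den => u du; rewrite /inv_chart; case: eqP => [->|/eqP u0]; first by rewrite mulr0.
      have uz : u^-1 != z0.
        apply: contra du => /eqP <-; by rewrite mulVf // subrr.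
      rewrite /Q /= qE // mulrAC -mulrA; congr (_ * _).
      rewrite -[u in LHS]invrK -invfM; congr (_^-1).
      by rewrite invrK mulrBr mulr1 mulrCA mulVf // mulr1.
    exists (fun u => (at_infty0 glue (inv_chart u) - glue z0) / (1 - z0 * u)); split.
    + apply: contM; last first.
        apply: contV; first by rewrite mulr0 subr0 oner_eq0.
        by apply: contB; [exact: cont_cst|apply: contZ; exact: cont_id].
      apply: contB; last exact: cont_cst.
      exact: (cont_comp (inv_chart_cont 0) (glue_sphere_cont _)).
    + by rewrite /inv_chart eqxx /= mulr0 subr0 divr1 sub0r.
    + by move=> u; rewrite mulr0 !subr0.
  - move=> x; rewrite nrmE -rc1 rc_le nrmM nrmV nrm_rc gtr0_norm // ler_pdivrMl // mulr1.
    by rewrite le_max MP.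
have lim : z * (Q' (Some z) - Q' None) @[z --> infty_nbhs R] --> ((rc N)^-1 * - glue z0 : C).
  move=> W /nbhsCP[e e0 eW]; have eN0 : 0 < e * N by rewrite mulr_gt0.
  have [K KP] := far _ eN0; exists K => // z /=; rewrite nrmE => Kz.
  have {}Kz : K < nrm z by rewrite -rc_lt.
  have [_ h1] := KP z Kz; apply: eW; rewrite /Q' /Q /= mulr0 subr0 mulrCA -mulrBr opprK.
  by rewrite nrmM nrmV nrm_rc gtr0_norm // ltr_pdivrMl // [N * e]mulrC.
have l0 : complex.Re `|(rc N)^-1 * - glue z0| <= 0.
  rewrite -lee_fin -cap0; apply: ereal_sup_ubound; exists ((rc N)^-1 * - glue z0) => //.
  by exists Q'.
have : nrm ((rc N)^-1 * - glue z0) = 0 by apply/eqP; rewrite eq_le nrm_ge0 andbT.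
by move=> /eqP; rewrite nrm_eq0 mulf_eq0 invr_eq0 (negbTE N0') oppr_eq0 => /eqP.
Qed.

Lemma capacity0_uniq : continuous_analytic_capacity (boundary Omega) = 0%:E ->
  forall t, G (expi t) = 0.
Proof.
move=> cap0; have z0 z : nrm z < 1 -> G z = 0.
  move=> z1; have Oz := PhiO z1; have := capacity0_glue cap0 Oz.
  by rewrite glue_in ?PhiK //; [exact: ltW|exact: subset_closure].
by move=> t; apply: circle_eq0 => [z|z z1 _]; [exact: GAD.1|exact: z0].
Qed.

End Capacity.
End ExteriorFunctions.

(** * Uniqueness for smooth boundaries *)

Section SmoothUniqueness.
Variable R : realType.
Local Notation C := (Cplx R).
Local Notation S := (sphere R).
Implicit Types (z w d a : C) (s t x r e M : R) (f F : C -> C).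

Lemma lim_uniq (x : nat -> C) (l l' : C) :
  (forall e, 0 < e -> exists N : nat, forall n, (N <= n)%N -> nrm (x n - l) <= e) ->
  (forall e, 0 < e -> exists N : nat, forall n, (N <= n)%N -> nrm (x n - l') <= e) -> l = l'.
Proof.
move=> H H'; apply/eqP; rewrite -subr_eq0 -nrm_eq0 eq_le nrm_ge0 andbT leNgt; apply/negP => l0.
have e0 : 0 < nrm (l - l') / 3 by rewrite divr_gt0.
have [N NP] := H _ e0; have [N' NP'] := H' _ e0.
have := NP _ (leq_maxl N N'); have := NP' _ (leq_maxr N N'); rewrite (nrmC _ l).
have := nrm_tri (x (maxn N N')) l l'; lra.
Qed.

Lemma per_uniform_cont (u : R -> C) e : 0 < e -> (forall t, cont_at u t) ->
  (forall t, u (t + 2 * pi) = u t) ->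
  exists2 h : R, 0 < h & forall t s, `|s - t| < h -> nrm (u s - u t) < e.
Proof.
move=> e0 uc up; have uc' z : cont_at (fun z : C => u (re z)) z.
  by apply: cont_comp (uc _); apply/cont_atP; exact: re_continuous.
have [h h0 hP] := heine (2 * pi) e0 uc'; exists h => // t s st.
have [x [/andP[x0 x1] xE]] := per_reduce t.
have -> : u t = u x by exact: per_expi.
have -> : u s = u (x + (s - t)).
  by apply: per_expi => //; rewrite expiD -xE -expiD; congr expi; ring.
apply: (hP (rc x) (rc (x + (s - t)))); rewrite ?nrm_rc ?ger0_norm //.
by rewrite -rcB nrm_rc; have -> : x + (s - t) - x = s - t by ring.
Qed.

Lemma inv_nat_lt (e : R) : 0 < e -> exists N : nat, forall n, (N <= n)%N -> n.+1%:R^-1 < e.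
Proof.
move=> e0; exists (Num.truncn e^-1) => n Nn; rewrite -[e]invrK ltf_pV2 ?posrE ?invr_gt0 //.
have /archimedean.Num.Theory.truncn_itv/andP[_ h] : 0 <= e^-1 by rewrite invr_ge0 ltW.
by apply: lt_le_trans h _; rewrite ler_nat.
Qed.

(* The rotated difference quotients of [F] lie in the disc algebra and converge uniformly on
   the circle to [c'], hence on the whole disc. *)
Lemma tangent F (c c' : R -> C) : AD [::] F -> (forall t, F (expi t) = c t) ->
  (forall t, rdiff c t (c' t)) -> (forall t, cont_at c' t) ->
  exists W, [/\ AD [::] W, forall t, W (expi t) = c' t &
    forall z d, nrm z < 1 -> cdiff F z d -> W z = iu R * z * d].
Proof.
move=> FA Fc cd cc'; have cp t : c (t + 2 * pi) = c t by rewrite -!Fc expiD2pi.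
have cp' := rdiff_per cd cp.
pose h n : R := n.+1%:R^-1; have h0 n : 0 < h n by rewrite invr_gt0.
pose f n z := (rc (h n))^-1 * (F (z * expi (h n)) - F z).
have fA n : AD [::] (f n).
  split=> [z|z z1 _].
    apply: contZ; apply: contB; last exact: FA.1.
    apply: cont_comp (FA.1 _); apply: contM; [exact: cont_id|exact: cont_cst].
  have z1' : nrm (z * expi (h n)) < 1 by rewrite nrmM nrm_expi mulr1.
  have [d1 H1] := FA.2 _ z1' isT; have [d2 H2] := FA.2 _ z1 isT.
  have H3 : cdiff (fun z => z * expi (h n)) z (1 * expi (h n) + z * 0).
    by apply: dqM; [exact: cont_id|exact: dq_id|exact: dq_cst].
  by eexists; apply: dqZ; apply: dqB H2; exact: (cdiff_comp H3 H1).
have fc n t : f n (expi t) = (rc (h n))^-1 * (c (t + h n) - c t).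
  by rewrite /f -expiD !Fc.
have flim : ulim setT (fun n t => f n (expi t)) c'.
  move=> e e0; have [k k0 kP] := per_uniform_cont e0 cc' cp'.
  have [N NP] := inv_nat_lt k0; exists N => n t /NP hk _; rewrite fc.
  have hn0 : rc (h n) != 0 :> C by rewrite rc_eq0 gt_eqF.
  have -> : (rc (h n))^-1 * (c (t + h n) - c t) - c' t =
      (rc (h n))^-1 * (c (t + h n) - c' t * rc (t + h n) - (c t - c' t * rc t)).
    have -> : rc (t + h n) = rc t + rc (h n) :> C by rewrite rcD.
    apply: (mulfI hn0); rewrite mulrBr !mulVKf //; ring.
  rewrite nrmM nrmV nrm_rc gtr0_norm // ler_pdivrMl // [h n * e]mulrC.
  have -> : e * h n = e * (t + h n - t) by congr (_ * _); ring.
  apply: (@mean_value _ (fun s => c s - c' t * rc s) (fun s => c' s - c' t * 1)).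
  - by rewrite lerDl ltW.
  - by move=> s _; apply: (dqB (cd s)); apply: dqZ; exact: dq_id.
  - move=> s /andP[s1 s2]; rewrite mulr1; apply: ltW; apply: kP; rewrite ger0_norm ?subr_ge0 //.
    by apply: le_lt_trans hk; rewrite lerBlDl.
have [W WA Wlim] := AD_circle_lim fA (ulim_ucauchy flim).
exists W; split => // [t|z d z1 Fd].
  apply: (@lim_uniq (fun n => f n (expi t))) => e e0.
    by have [N NP] := Wlim e e0; exists N => n Nn; apply: NP => //; rewrite /= nrm_expi.
  by have [N NP] := flim e e0; exists N => n Nn; exact: NP.
apply: (@lim_uniq (fun n => f n z)) => e e0.
  by have [N NP] := Wlim e e0; exists N => n Nn; apply: NP => //; exact: ltW.
(* At an interior point the rotated quotients converge to the derivative of [F] along the circle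
   through [z], which is compared with the limit [W z]. *)
have rot : rdiff (fun s => z * expi s) 0 (z * (iu R * expi 0)) by apply: dqZ; exact: expi_diff.
have Fd' : cdiff F (z * expi 0) d by rewrite expi0 mulr1.
have [q [qc q0 qP]] := rdiff_comp rot Fd'.
have /contP/(_ _ e0)[k /= k0 kP] := qc.
have [N NP] := inv_nat_lt k0; exists N => n /NP hk.
have hn0 : rc (h n) != 0 :> C by rewrite rc_eq0 gt_eqF.
have -> : f n z = q (h n).
  by rewrite /f; have := qP (h n); rewrite expi0 mulr1 rc0 subr0 => ->; rewrite mulrCA mulVf ?mulr1.
have -> : iu R * z * d = q 0 by rewrite q0 expi0; ring.
apply: ltW; apply: kP; rewrite /= sub0r normrN gtr0_norm //.
Qed.

Lemma inner_kernel (g v b u a : C) : b != 0 -> u - a != 0 -> a != 0 ->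
  g * v / b = a^-1 * (g * v / (b / (u - a)) * u / (u - a) - g * v / (b / (u - a))).
Proof. by move=> b0 u0 a0; field; rewrite b0 u0 a0. Qed.

Section Interior.
Variables (Phi iPhi G : C -> C) (c c' : R -> C).
Hypothesis PhiAD : AD [::] Phi.
Hypothesis PhiK : forall z, nrm z <= 1 -> iPhi (Phi z) = z.
Hypothesis Phid : forall z, nrm z < 1 -> exists2 d, d != 0 & cdiff Phi z d.
Hypothesis Phic : forall t, Phi (expi t) = c t.
Hypothesis cd : forall t, rdiff c t (c' t).
Hypothesis cc' : forall t, cont_at c' t.
Hypothesis GAD : AD [::] G.

(** With [q] the difference quotient of [Phi] at [a] and [W z = i z Phi' z], the function
    [F = G W / q] lies in the disc algebra, [F 0 = 0] and [F a = i a G a]. On the circle the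
    integrand is [F / (e - a)], where [e = expi t], and [1 / (e - a) = a^-1 (e / (e - a) - 1)]
    reduces its mean to Cauchy's formula and the mean value property; hence [a != 0]. *)
Lemma inner_cauchy a : nrm a < 1 -> a != 0 ->
  cavg (fun t => G (expi t) * c' t / (c t - Phi a)) = iu R * G a.
Proof.
move=> a1 a0; have [W [WA Wc Wd]] := tangent PhiAD Phic cd cc'.
have [d d0 Hd] := Phid a1; pose q := slope id a Phi d.
have qc z : cont_at q z by apply: slope_cont => //; exact: PhiAD.1.
have Phine z : nrm z <= 1 -> z != a -> Phi z - Phi a != 0.
  move=> z1; apply: contra; rewrite subr_eq0 => /eqP E; apply/eqP.
  by rewrite -(PhiK z1) E PhiK // ltW.
have qE z : z != a -> q z = (Phi z - Phi a) / (z - a).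
  by move=> za; rewrite /q /slope /= (negbTE za).
have qn0 z : nrm z <= 1 -> q z != 0.
  move=> z1; have [->|za] := eqVneq z a; first by rewrite /q /slope eqxx.
  by rewrite qE // mulf_neq0 ?Phine // invr_neq0 // subr_eq0.
pose F z := G z * W z / q z.
have FA : AD [:: a] (fun z => F (ret z)).
  apply: AD_ret => [z|z z1].
    apply: contM; first by apply: contM; apply: cont_comp (ret_cont z) _; [exact: GAD.1|exact: WA.1].
    by apply: contV; [apply: qn0; exact: ret_le1|exact: (cont_comp (ret_cont z) (qc _))].
  rewrite inE => za; have [d1 H1] := GAD.2 _ z1 isT; have [d2 H2] := WA.2 _ z1 isT.
  have [d3 H3] : cdiffable q z by apply: slope_diff => //; exact: PhiAD.2.
  eexists; apply: dq_div H3; [exact: inj_id|exact: cont_id|apply: qn0; exact: ltW|].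
  by apply: dqM H1 H2; exact: cont_id.
have {}FA := AD_removable FA.
have := cauchy_formula FA a1 (FA.2 _ a1 isT); have := AD_avg FA.
rewrite !ret_id ?nrm0 ?ltW //.
have F0 : F 0 = 0.
  have z1 : nrm (0 : C) < 1 by rewrite nrm0 ltr01.
  by have [e _ He] := Phid z1; rewrite /F (Wd _ _ z1 He) mulr0 mul0r mulr0 mul0r.
have Fa : F a = iu R * a * G a.
  by rewrite /F (Wd _ _ a1 Hd) /q /slope eqxx !mulrA mulfK //; ring.
have Ec t : cont_at (fun t => F (ret (expi t))) t by exact: (AD_expi_cont t FA).
have Ec' t : cont_at (fun t => F (ret (expi t)) * expi t / (expi t - a)) t.
  by apply: contM; [apply: contM => //; exact: expi_cont|exact: kernel_cont].
rewrite F0 Fa => e0 ea.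
transitivity (a^-1 * (cavg (fun t => F (ret (expi t)) * expi t / (expi t - a))
                      - cavg (fun t => F (ret (expi t))))); last first.
  by rewrite e0 -ea subr0 -!mulrA mulrCA mulKf.
rewrite -cavgB // -cavgZ => [|t]; last by exact: contB.
apply: cavg_eq => t; rewrite ret_expi.
have za : expi t - a != 0 by exact: disc_sub_neq0.
have ca : c t - Phi a != 0.
  by rewrite -Phic; apply: Phine; rewrite ?nrm_expi // -subr_eq0.
have zt : expi t != a by rewrite -subr_eq0.
rewrite /F (qE _ zt) Wc Phic.
exact: inner_kernel.
Qed.

End Interior.


(** Pulled back by [E], this function serves as a coordinate of the exterior that is finite at
    infinity. *)
Lemma Aext_pole (Omega : set C) z0 : Omega z0 -> Aext Omega (fun z => (z - z0)^-1).
Proof.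
move=> Oz0; have ne z : ~ Omega z -> z - z0 != 0.
  by move=> nz; rewrite subr_eq0; apply/eqP => E; apply: nz; rewrite E.
have lc z : cont_at (fun z => z - z0) z by apply: contB; [exact: cont_id|exact: cont_cst].
split.
- apply/within_nearP => z nz e e0.
  have H : cont_at (fun w => (w - z0)^-1) z by apply: contV (lc z); exact: ne.
  by move/contP: H => /(_ _ e0); apply: filterS.
- move=> z nz; have n0 : z - z0 != 0 by apply: ne => Oz; apply: nz; exact: subset_closure.
  have H : cdiff (fun z => z - z0) z (1 - 0) by apply: dqB; [exact: dq_id|exact: dq_cst].
  by eexists; apply: dqV H; [exact: inj_id|exact: cont_id|].
- move=> e e0; exists (nrm z0 + e^-1) => z nz zM; rewrite nrmV -[e]invrK.
  have := nrmD (z - z0) z0; rewrite subrK => h.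
  have e1 : 0 < e^-1 by rewrite invr_gt0.
  by rewrite ltf_pV2 ?posrE ?nrm_gt0 ?ne //; lra.
Qed.

(* Locally [e ^ (i s t)] lifts [om] through an arcsine. *)
Lemma local_lift (om : R -> C) t0 : (forall t, cont_at om t) -> (forall t, nrm (om t) = 1) ->
  exists s : R -> R, [/\ cont_at s t0, s t0 = 0 &
    \forall t \near t0, om t = om t0 * expi (s t)].
Proof.
move=> omc om1; have n0 t : om t != 0 by rewrite -nrm_gt0 om1.
pose q t := om t / om t0; have qc t : cont_at q t by apply: contM; [exact: omc|exact: cont_cst].
have q0 : q t0 = 1 by rewrite /q divff.
have q1 t : nrm (q t) = 1 by rewrite /q nrmM nrmV !om1 invr1 mulr1.
exists (fun t => asin (im (q t))); split.
- have ic : cont_at (fun t => im (q t)) t0.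
    by apply: (cont_comp (qc t0)); apply/cont_atP; exact: im_continuous.
  apply: (cont_comp ic); apply/cont_atP; apply: continuous_asin.
  by rewrite q0 /= oppr_lt0 ltr01.
- by rewrite q0 /= -[X in asin X]sin0 sinK // in_itv /= oppr_le0 divr_ge0 ?pi_ge0.
- have /contP/(_ _ ltr01) := qc t0; apply: filterS => t; rewrite q0 => qt.
  have rp : 0 < re (q t).
    have := re_le (q t - 1); rewrite reB /= ler_norml => /andP[h _].
    by have : re (1 : C) = 1 by []; lra.
  have e2 : re (q t) ^+ 2 + im (q t) ^+ 2 = 1 by rewrite -nrm2 q1 expr1n.
  have i1 : -1 <= im (q t) <= 1 by rewrite -ler_norml -(q1 t); exact: im_le.
  have -> : expi (asin (im (q t))) = q t; last by rewrite /q mulrC divfK.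
  apply: cplxP; rewrite ?re_expi ?im_expi ?asinK // cos_asin //.
  have -> : 1 - im (q t) ^+ 2 = re (q t) ^+ 2 by rewrite -e2 addrK.
  by rewrite sqrtr_sqr gtr0_norm.
Qed.

Lemma pole_kernel (a b x z0 z1 : C) : x - z0 != 0 -> x - z1 != 0 ->
  a * ((z1 - z0) / ((x - z0) * (x - z1))) * b =
  - 1 * (a * (- b / (x - z0) ^+ 2) * ((z1 - z0) / (1 - (z1 - z0) / (x - z0)))).
Proof.
move=> d0 d1; have -> : 1 - (z1 - z0) / (x - z0) = (x - z1) / (x - z0).
  by rewrite -{1}(divff d0) -mulrBl opprB addrA subrK.
by rewrite invf_div; field; rewrite d0 d1.
Qed.

Lemma pole_difference (u v x z0 z1 : C) : x - z0 != 0 -> x - z1 != 0 ->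
  u * v / (x - z1) - u * v / (x - z0) = u * ((z1 - z0) / ((x - z0) * (x - z1))) * v.
Proof. by move=> n0 n1; field; rewrite n0 n1. Qed.

(** * Integrals of exterior functions along the two parametrizations *)

Section Exterior.
Variables (Omega : set C) (E : C -> S) (w0 : C) (D D' c c' om : R -> C).
Hypothesis Ec : forall w, cont_at E w.
Hypothesis EO : forall w, sphere_compl Omega (E w).
Hypothesis Ehol : forall w, nrm w < 1 -> w \notin [:: 0; w0] -> exists rho : C -> C,
  [/\ cdiffable rho w, ~ closure Omega (rho w) & \forall v \near w, E v = Some (rho v)].
Hypothesis EI : forall w v, nrm w <= 1 -> nrm v <= 1 -> E w = E v -> w = v.
Hypothesis ED : forall t, E (expi t) = Some (D t).
Hypothesis Dd : forall t, rdiff D t (D' t).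
Hypothesis Dc' : forall t, cont_at D' t.
Hypothesis D'0 : forall t, D' t != 0.
Hypothesis cd : forall t, rdiff c t (c' t).
Hypothesis cc' : forall t, cont_at c' t.
Hypothesis cp : forall t, c (t + 2 * pi) = c t.
Hypothesis omc : forall t, cont_at om t.
Hypothesis om1 : forall t, nrm (om t) = 1.
Hypothesis Eom : forall t, E (om t) = Some (c t).

Section Balance.
Variable k : C -> C.
Hypothesis kc : forall t, cont_at (fun t => k (D t)) t.
Hypothesis k0 : cavg (fun t => k (D t) * D' t) = 0.

Lemma D_per t : D (t + 2 * pi) = D t.
Proof. by have := ED (t + 2 * pi); rewrite expiD2pi ED => -[]. Qed.

(* An integral over the boundary does not depend on its parametrization: the primitive along
   [D] is a function on the boundary, and composing it with [c] gives a primitive along [c]. *)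
Lemma balance_transfer : (forall t, cont_at (fun t => k (c t)) t) ->
  cavg (fun t => k (c t) * c' t) = 0.
Proof.
move=> kcc; pose u t := k (D t) * D' t.
have uc t : cont_at u t by exact: contM.
have up t : u (t + 2 * pi) = u t by rewrite /u D_per (rdiff_per Dd D_per).
pose N := prim u; have Nd t : rdiff N t (u t) by exact: prim_diff.
(* The vanishing of the mean along [D] enters here; periodicity makes [N] a function of the boundary
   point. *)
have Np t : N (t + 2 * pi) = N t.
  have H x : rdiff (fun s => N (s + 2 * pi) - N s) x 0.
    by rewrite -(subrr (u x)); apply: dqB (Nd x); apply: rdiff_shift; rewrite -up; exact: Nd.
  have N0 : N (0 + 2 * pi) - N 0 = 0.
    have pi0 : rc (2 * pi) != 0 :> C by rewrite rc_eq0 gt_eqF ?pi2_gt0.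
    move: k0; rewrite /cavg /integ add0r => /eqP.
    by rewrite mulf_eq0 invr_eq0 (negbTE pi0) => /eqP.
  apply/eqP; rewrite -subr_eq0 -N0; apply/eqP.
  have [t0|t0] := leP 0 t.
    by symmetry; apply: (rdiff0_cst (u := fun s => N (s + 2 * pi) - N s)).
  by apply: (rdiff0_cst (u := fun s => N (s + 2 * pi) - N s)) => //; exact: ltW.
(* [tau] may jump, but [N (tau t)] depends only on [expi (tau t)]. *)
have /choice[tau tauP] t : exists x, expi x = om t :> C.
  by have [x [_ ->]] := circle_expi (om1 t); exists x.
have Nn t : rdiff (fun t => N (tau t)) t (k (c t) * c' t).
  have [s [sc s0 sP]] := local_lift t omc om1.
  have cE x : om x = expi (tau t + s x) -> c x = D (tau t + s x).
    by move=> ox; have := Eom x; rewrite ox ED => -[].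
  have oE : om t = expi (tau t + s t) by rewrite s0 addr0 tauP.
  have ct : c t = D (tau t) by rewrite cE // s0 addr0.
  have {}sP : \forall x \near t, om x = expi (tau t + s x).
    by apply: filterS sP => x ->; rewrite -tauP -expiD.
  have tc : cont_at (fun x => tau t + s x) t.
    by have := cont_comp sc (shift_cont (tau t) (s t)); congr (cont_at _ _); apply/funext => x; rewrite addrC.
  have [q [qc q0 qP]] := Dd (tau t); have [m [mc m0 mP]] := cd t.
  have [n [nc n0 nP]] := Nd (tau t).
  have qsc : cont_at (fun x => q (tau t + s x)) t by apply: (cont_comp tc); rewrite s0 addr0.
  have nsc : cont_at (fun x => n (tau t + s x)) t by apply: (cont_comp tc); rewrite s0 addr0.
  have qs0 : q (tau t + s t) != 0 by rewrite s0 addr0 q0.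
  (* The implicit function step: [D (tau t + s x) = c x] and the nonvanishing derivative of [D] give
     the slope of the local lift [s]. *)
  have sE : \forall x \near t, rc (s x) = m x / q (tau t + s x) * (rc x - rc t).
    apply: filterS2 sP (cont_neq0 qsc qs0) => x ox qx0.
    have := qP (tau t + s x); rewrite -cE // -ct rcD [rc _ + _]addrC addrK => H.
    by apply: (mulfI qx0); rewrite -H mP mulrA [_ * (m x / _)]mulrC divfK.
  apply: (@rdiff_near _ (fun x => N (tau t) + n (tau t + s x) * (m x / q (tau t + s x)) * (rc x - rc t))).
    apply: filterS2 sP sE => x ox sx.
    have -> : N (tau x) = N (tau t + s x) by apply: per_expi => //; rewrite tauP.
    have := nP (tau t + s x); rewrite rcD [rc (tau t) + _]addrC addrK sx mulrA => H.
    by rewrite -[N (tau t + s x)](subrK (N (tau t))) H addrC.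
  exists (fun x => n (tau t + s x) * (m x / q (tau t + s x))); split.
  - by apply: contM => //; apply: contM => //; exact: contV.
  - rewrite s0 addr0 n0 q0 m0 /u ct; have := D'0 (tau t).
    by move: (k _) (D' _) (c' t) => a b d b0; field.
  - by move=> x; rewrite subrr mulr0 addr0 [LHS]addrC addKr.
apply: (@cavg_derive _ (fun t => N (tau t))) => [t||].
- by apply: contM.
- exact: Nn.
have cpi : c (2 * pi) = c 0 by rewrite -[2 * pi]add0r cp.
apply: per_expi => //; rewrite !tauP; apply: EI; rewrite ?om1 //.
by rewrite !Eom cpi.
Qed.

End Balance.

Variable h : C -> C.
Hypothesis hA : Aext Omega h.

(** In terms of [eta = 1 / (z - z0)] the difference of the two kernels is [eta^2] times
    [(z1 - z0) / (1 - (z1 - z0) eta)]. The factor [eta^2] cancels against [dz = - d eta / eta^2], so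
    the integrand pulls back to the disc algebra without a pole at infinity. It contains the factor
    [W] of [tangent], which vanishes at [0]; hence so does the mean. *)
Lemma outer_balance z0 z1 : Omega z0 -> Omega z1 ->
  cavg (fun t => h (c t) * ((z1 - z0) / ((c t - z0) * (c t - z1))) * c' t) = 0.
Proof.
move=> Oz0 Oz1; have ne z (x : C) : Omega z -> sphere_compl Omega (Some x) -> x - z != 0.
  move=> Oz /sphere_compl_some nx; rewrite subr_eq0; apply/eqP => E1.
  by apply: nx; rewrite E1.
have Dne t z : Omega z -> D t - z != 0 by move=> Oz; apply: ne => //; rewrite -ED; exact: EO.
have cne t z : Omega z -> c t - z != 0 by move=> Oz; apply: ne => //; rewrite -Eom; exact: EO.
have pull g : Aext Omega g -> AD [::] (fun w => at_infty0 g (E w)) by exact: (Aext_AD Ec EO Ehol).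
have etaA := pull _ (Aext_pole Oz0); have HA := pull _ hA.
pose eta w := at_infty0 (fun z => (z - z0)^-1) (E w).
pose eta' t := - D' t / (D t - z0) ^+ 2.
have lin z t : cont_at (fun t => D t - z) t.
  by apply: contB; [exact: rdiff_cont|exact: cont_cst].
have etad t : rdiff (fun t => (D t - z0)^-1) t (eta' t).
  apply: dqV; [exact: (@rc_inj R)|exact: rc_cont|exact: Dne|].
  by rewrite -[D' t]subr0; apply: dqB; [exact: Dd|exact: dq_cst].
have etac' t : cont_at eta' t.
  apply: contM; first by exact: contN.
  by apply: contV; [rewrite expf_neq0 // Dne|exact: contX].
have etaE t : eta (expi t) = (D t - z0)^-1 by rewrite /eta ED.
have [W [WA Wc Wd]] := tangent etaA etaE etad etac'.
have W0 : W 0 = 0.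
  have n1 : nrm (0 : C) < 1 by rewrite nrm0 ltr01.
  by have [d Hd] := etaA.2 0 n1 isT; rewrite (Wd _ _ n1 Hd) mulr0 mul0r.
pose den w := 1 - (z1 - z0) * eta w.
have den0 w : den w != 0.
  rewrite /den /eta; have : sphere_compl Omega (E w) by exact: EO.
  case: (E w) => [x xO|_] /=; last by rewrite mulr0 subr0 oner_eq0.
  have x0 := ne z0 x Oz0 xO; have x1 := ne z1 x Oz1 xO.
  by rewrite -(divff x0) -mulrBl mulf_neq0 ?invr_neq0 // opprB addrA subrK.
pose J w := at_infty0 h (E w) * W w * ((z1 - z0) / den w).
have JA : AD [::] J.
  have denA : AD [::] den.
    by apply: AD_B; [exact: AD_cst|apply: AD_M; [exact: AD_cst|exact: etaA]].
  apply: AD_M; first exact: AD_M.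
  split=> [w|w w1 _].
    by apply: contM; [exact: cont_cst|apply: contV => //; exact: denA.1].
  have [d Hd] := denA.2 w w1 isT; eexists.
  by apply: dqZ; apply: dqV Hd; [exact: inj_id|exact: cont_id|exact: den0].
have := AD_avg JA; rewrite /J W0 mulr0 mul0r => J0.
pose k z := h z * ((z1 - z0) / ((z - z0) * (z - z1))).
have hD (b : R -> C) t : (forall t, cont_at b t) -> (forall t, sphere_compl Omega (Some (b t))) ->
    cont_at (fun t => k (b t)) t.
  move=> bc bO; have [hc _ _] := hA; apply: contM.
    by apply: (within_comp hc) => // s; apply/sphere_compl_some.
  apply: contM; first exact: cont_cst.
  apply: contV; first by rewrite mulf_neq0 // ne.
  by apply: contM; apply: contB => //; exact: cont_cst.
apply: (balance_transfer (k := k)).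
- by move=> t; apply: hD => s; [exact: rdiff_cont|rewrite -ED; exact: EO].
- transitivity (- cavg (fun t => J (expi t))); last by rewrite J0 oppr0.
  rewrite -mulN1r -cavgZ => [|t]; last exact: (AD_expi_cont t JA).
  apply: cavg_eq => t; rewrite /J /den etaE ED Wc /k /eta' /=.
  have d0 := Dne t z0 Oz0; have d1 := Dne t z1 Oz1.
  exact: pole_kernel.
- by move=> t; apply: hD => s; [exact: rdiff_cont|rewrite -Eom; exact: EO].
Qed.

Variables Phi iPhi G : C -> C.
Hypothesis PhiAD : AD [::] Phi.
Hypothesis PhiO : forall z, nrm z < 1 -> Omega (Phi z).
Hypothesis PhiK : forall z, nrm z <= 1 -> iPhi (Phi z) = z.
Hypothesis Phid : forall z, nrm z < 1 -> exists2 d, d != 0 & cdiff Phi z d.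
Hypothesis Phic : forall t, Phi (expi t) = c t.
Hypothesis GAD : AD [::] G.
Hypothesis Gh : forall t, G (expi t) = h (c t).
Hypothesis cD : forall t, exists x, c x = D t.
Hypothesis w01 : nrm w0 < 1.
Hypothesis Ew0 : E w0 = None.

Lemma smooth_uniq t : G (expi t) = 0.
Proof.
have Geq a b : nrm a < 1 -> a != 0 -> nrm b < 1 -> b != 0 -> G b = G a.
  move=> a1 a0 b1 b0; have Oa := PhiO a1; have Ob := PhiO b1.
  have ne x z : Omega z -> c x - z != 0.
    have : sphere_compl Omega (Some (c x)) by rewrite -Eom; exact: EO.
    by move=> /sphere_compl_some nx Oz; rewrite subr_eq0; apply/eqP => e; apply: nx; rewrite e.
  have kc z x : Omega z -> cont_at (fun t => G (expi t) * c' t / (c t - z)) x.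
    move=> Oz; apply: contM; first by apply: contM => //; exact: AD_expi_cont GAD.
    apply: contV; first exact: ne.
    by apply: contB; [exact: rdiff_cont|exact: cont_cst].
  apply: (mulfI (iu_neq0 R)); apply/eqP; rewrite -subr_eq0; apply/eqP.
  rewrite -(inner_cauchy PhiAD PhiK Phid Phic cd cc' GAD b1 b0).
  rewrite -(inner_cauchy PhiAD PhiK Phid Phic cd cc' GAD a1 a0) -cavgB => [|x|x]; last 2 first.
  - exact: kc.
  - exact: kc.
  rewrite -(outer_balance Oa Ob); apply: cavg_eq => x; rewrite Gh.
  exact: pole_difference (ne x _ Oa) (ne x _ Ob).
pose K := G (rc 2^-1).
have r1 : nrm (rc (2^-1 : R) : C) < 1 by rewrite nrm_rc_ge0; lra.
have r0 : rc (2^-1 : R) != 0 :> C by rewrite rc_eq0; lra.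
have GK x : G (expi x) = K.
  apply/eqP; rewrite -subr_eq0; apply/eqP; apply: (circle_eq0 (G := fun z => G z - K)) => [z|z z1 z0].
    by apply: contB; [exact: GAD.1|exact: cont_cst].
  by rewrite (Geq _ _ r1 r0 z1 z0) subrr.
(* The pull-back of [h] equals [K] on the circle, hence on the disc, and at [w0] it takes the value
   [0] of [h] at infinity. *)
have HA := Aext_AD Ec EO Ehol hA.
have := AD_eq HA (AD_cst K) _ (ltW w01); rewrite Ew0 /= GK => -> // x.
by rewrite ED /=; have [y <-] := cD x; rewrite -Gh GK.
Qed.

End Exterior.

End SmoothUniqueness.

(** * Decompositions *)

Section BoundaryRegularity.
Variable R : realType.
Local Notation C := (Cplx R).
Implicit Types (z w d : C) (s t r e M : R).

Lemma Ck_le n m (u : R -> C) : (m <= n)%N -> Ck n u -> Ck m u.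
Proof.
by elim: n => [|n IH]; rewrite leq_eqVlt => /predU1P[->//|mn] // /CkS; exact: IH.
Qed.

Lemma derive1n_holomorphic (Omega : set C) (f : C -> C) l z : open Omega ->
  holomorphic_on Omega f -> Omega z -> cdiff f^`(l)%classic z (f^`(l.+1)%classic z).
Proof.
move=> Oo fh; elim: l z => [|l IH] z Oz.
  by apply/cdiffP; split; [rewrite derive1n0; exact: fh|rewrite derive1nS derive1n0].
have /nbhsCP[r r0 rP] := nbhs_open Oo Oz.
have [d Hd] : cdiffable f^`(l.+1)%classic z.
  by apply: (@derivative_holomorphic _ f^`(l)%classic _ _ r) => // w wr; apply: IH; exact: rP.
by have /cdiffP[H E] := Hd; apply/cdiffP; split => //; rewrite [in RHS]derive1nS.
Qed.

(* Along the circles of radius less than 1 this is the chain rule. *)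
Lemma boundary_rdiff (A B W : C -> C) (c' : R -> C) t : AD [::] A -> AD [::] B -> AD [::] W ->
  (forall t, W (expi t) = c' t) ->
  (forall z, nrm z < 1 -> exists d, [/\ cdiff A z (B z * d) & W z = iu R * z * d]) ->
  rdiff (fun s => A (expi s)) t (B (expi t) * c' t).
Proof.
move=> AA BA WA Wc Ad; pose rho n : R := 1 - n.+1%:R^-1.
have unif (F : C -> C) : (forall z, cont_at F z) ->
    ulim setT (fun n t => F (rc (rho n) * expi t)) (fun t => F (expi t)).
  move=> Fc e e0; have [k k0 kP] := heine 1 e0 Fc; have [N NP] := inv_nat_lt k0.
  exists N => n x /NP nk _; apply: ltW; apply: kP; first by rewrite nrm_expi.
  have -> : rc (rho n) * expi x - expi x = - (rc n.+1%:R^-1 * expi x).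
    by rewrite /rho rcB rc1; ring.
  by rewrite nrmN nrmM nrm_expi mulr1 nrm_rc_ge0 // invr_ge0.
rewrite -Wc; have BWA := AD_M BA WA.
apply: (ulim_rdiff (g' := fun s => B (expi s) * W (expi s)) _ (unif _ AA.1) (unif _ BWA.1)).
  move=> n x; have z1 : nrm (rc (rho n) * expi x) < 1.
    rewrite nrmM nrm_expi mulr1 nrm_rc_ge0 /rho; first by rewrite gtrBl invr_gt0.
    by rewrite subr_ge0 invf_le1 // ler1n.
  have [d [Hd Wd]] := Ad _ z1; rewrite Wd.
  have Hr : rdiff (fun s => rc (rho n) * expi s) x (rc (rho n) * (iu R * expi x)).
    by apply: dqZ; exact: expi_diff.
  have := rdiff_comp Hr Hd; congr (rdiff _ _ _); ring.
exact: (AD_expi_cont t BWA).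
Qed.

Section Setting.
Variables (Omega : set C) (Phi : C -> C) (c : R -> C) (p : nat).
Hypothesis Oo : open Omega.
Hypothesis PhiAD : AD [::] Phi.
Hypothesis PhiO : forall z, nrm z < 1 -> Omega (Phi z).
Hypothesis PhiC : forall z, nrm z <= 1 -> closure Omega (Phi z).
Hypothesis Phic : forall t, Phi (expi t) = c t.
Hypothesis cC : Ck p c.
Hypothesis cB : forall t, boundary Omega (c t).

(** [A l] is the extended [l]-th derivative of [f], pulled back by [Phi]; its derivative along the
    circle is [A l.+1 * c']. Since [c'] is of class [C^(p - 1)], induction on the number [m] of
    derivatives applies. *)
Lemma Ap_boundary_Ck u : Ap_boundary p Omega u ->
  exists2 G, AD [::] G & (forall t, G (expi t) = u (c t)) /\ Ck p (fun t => G (expi t)).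
Proof.
move=> [f [g0 [[fh fe] [g0c g0f] ug]]].
have [g gP gg0] : exists2 g : nat -> C -> C, forall l, (l <= p)%N ->
    continuous_extension Omega (closure Omega) f^`(l)%classic (g l) & g 0%N = g0.
  have /choice[g gP] l : exists g, (l <= p)%N ->
      continuous_extension Omega (closure Omega) f^`(l)%classic g.
    have [lp|lp] := leqP l p; first by have [g gP] := fe l lp; exists g.
    by exists f.
  (* Entry [0] is the given extension, whose boundary values are those of [u]. *)
  exists (fun l => if l is 0%N then g0 else g l); last exact: erefl.
  case=> [_|l]; last exact: gP.
  by rewrite derive1n0; exact: conj g0c g0f.
pose A l z := g l (Phi (ret z)).
have AA l : (l <= p)%N -> AD [::] (A l).
  move=> lp; have [gc gf] := gP l lp.
  apply: (AD_ret (F := fun z => g l (Phi z))) => [z|z z1 _].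
    apply: (within_comp gc) => [w|]; first by apply: PhiC; exact: ret_le1.
    exact: (cont_comp (ret_cont z) (PhiAD.1 _)).
  have [d Hd] := PhiAD.2 z z1 isT; eexists.
  apply: cdiff_near (cdiff_comp Hd (derive1n_holomorphic l Oo fh (PhiO z1))).
  by have := disc_near z1; apply: filterS => w w1; rewrite gf //; exact: PhiO.
have Ad l : (l < p)%N -> forall z, nrm z < 1 -> forall d, cdiff Phi z d -> cdiff (A l) z (A l.+1 z * d).
  move=> lp z z1 d Hd; have [_ gf] := gP l (ltnW lp); have [_ gf'] := gP l.+1 lp.
  have -> : A l.+1 z = f^`(l.+1)%classic (Phi z).
    by rewrite /A ret_id ?ltW // gf' //; exact: PhiO.
  apply: cdiff_near (cdiff_comp Hd (derive1n_holomorphic l Oo fh (PhiO z1))).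
  have := disc_near z1; apply: filterS => w w1; rewrite /A ret_id ?ltW // gf //.
  exact: PhiO.
have main m l : (l + m <= p)%N -> Ck m (fun t => A l (expi t)).
  elim: m l => [|m IH] l lm.
    by move=> t; apply: AD_expi_cont (AA l _); rewrite addn0 in lm.
  have [q pq] : exists q, p = q.+1 by exists p.-1; rewrite prednK //; lia.
  have [c' cd c'C] : exists2 c', forall t, rdiff c t (c' t) & Ck q c'.
    by move: cC; rewrite pq.
  have [W [WA Wc Wd]] := tangent PhiAD Phic cd (Ck_cont c'C).
  have lp : (l < p)%N by lia.
  exists (fun t => A l.+1 (expi t) * c' t) => [t|].
    apply: (boundary_rdiff t (AA l (ltnW lp)) (AA l.+1 lp) WA Wc) => z z1.
    have [d Hd] := PhiAD.2 z z1 isT; exists d.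
    by split; [exact: Ad|exact: Wd].
  by apply: CkM; [apply: IH; lia|apply: (Ck_le _ c'C); lia].
exists (A 0%N); first exact: AA.
split=> [t|]; last exact: main.
by rewrite /A ret_expi Phic gg0 -ug.
Qed.

End Setting.
End BoundaryRegularity.

(** * The graph of the inner part and the contradiction *)

Section Decomposition.
Variable R : realType.
Local Notation C := (Cplx R).
Local Notation S := (sphere R).
Implicit Types (z w d : C) (s t r e M : R).

Lemma A0p_boundary_Aext (Omega : set C) p u B : (forall z, closure Omega z -> nrm z <= B) ->
  A0p_boundary p Omega u -> exists2 h, Aext Omega h & forall z, boundary Omega z -> u z = h z.
Proof.
move=> OB [f [h [[fh _ flim] [hc hf] uh]]]; exists h; last exact: uh.
split; first exact: hc.
- move=> z nz; exists (derive1 f z); apply: (@cdiff_near _ f).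
    have : nbhs z (~` closure Omega).
      by apply: nbhs_open nz; apply: closed_openC; exact: closed_closure.
    by apply: filterS => w nw; exact/esym/hf.
  by apply/cdiffP; split; [exact: fh|exact: erefl].
- move=> e e0; have [M _ MP] : infty_nbhs R [set z | nrm (f z) < e].
    by apply: (flim [set z | nrm z < e]); apply/nbhsCP; exists e => // w; rewrite subr0.
  (* Beyond [B] the point lies off the closure, where [h] and [f] agree. *)
  exists (Num.max M B) => z nz; rewrite gt_max => /andP[zM zB].
  have ncz : ~ closure Omega z by move=> /OB; rewrite leNgt zB.
  by rewrite (hf _ ncz); apply: MP; rewrite /= nrmE rc_lt.
Qed.

Lemma rdiff_expi_scale (a t : R) : rdiff (fun s => expi (a * s)) t (iu R * rc a * expi (a * t)).
Proof.
have E s : cexp (iu R * rc a * rc s) = expi (a * s).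
  rewrite /cexp !(reM, imM, re_iu, im_iu, re_rc, im_rc) !(mul0r, mul1r, mulr0, subr0, subrr, addr0, add0r).
  by rewrite oppr0 expR0 mul1r.
apply: (dq_eq E); rewrite -E.
have Hl : rdiff (fun s => iu R * rc a * rc s) t (iu R * rc a * 1) by apply: dqZ; exact: dq_id.
by have := rdiff_comp Hl (cexp_diff _); rewrite mulr1 [cexp _ * _]mulrC.
Qed.

Lemma epos_jet p k : jet p (@epos R k).
Proof.
have ed l t : rdiff (epos k l) t (epos k l.+1 t).
  have := dqZ ((iu R * k%:R) ^+ l) (rdiff_expi_scale k%:R t).
  by rewrite rcn mulrA -exprSr.
apply: chain_jet => [l t _|l t _|t]; [exact: ed|exact: rdiff_cont (ed l t)|].
by rewrite /epos !expiMn expiD2pi.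
Qed.

Lemma eneg_jet p k : jet p (@eneg R k).
Proof.
have ed l t : rdiff (eneg k l) t (eneg k l.+1 t).
  have H := dqZ ((- iu R * k%:R) ^+ l) (rdiff_expi_scale (- k%:R) t).
  have -> : eneg k l.+1 t = (- iu R * k%:R) ^+ l * (iu R * rc (- k%:R) * expi (- k%:R * t)).
    by rewrite /eneg rcN rcn !mulNr mulrN exprSr mulrA.
  by apply: dq_eq H => s; rewrite /eneg; congr (_ * expi _); exact: mulNr.
apply: chain_jet => [l t _|l t _|t]; [exact: ed|exact: rdiff_cont (ed l t)|].
by rewrite /eneg !expiN !expiMn expiD2pi.
Qed.

Variables (p : nat) (Omega : set C) (c : R -> C) (E : C -> S) (w0 : C).
Hypothesis Ec : forall w, cont_at E w.
Hypothesis EO : forall w, sphere_compl Omega (E w).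
Hypothesis Esurj : forall x, sphere_compl Omega x -> exists2 w, nrm w <= 1 & E w = x.
Hypothesis Ehol : forall w, nrm w < 1 -> w \notin [:: 0; w0] -> exists rho : C -> C,
  [/\ cdiffable rho w, ~ closure Omega (rho w) & \forall v \near w, E v = Some (rho v)].
Hypothesis Ecircle : forall t, exists s, E (expi t) = Some (c s).
Hypothesis cO : forall t, ~ Omega (c t).

Definition split_circle (G h : C -> C) (f : R -> C) :=
  [/\ AD [::] G, Aext Omega h & forall t, f t = G (expi t) + h (c t)].

Hypothesis uniq : forall G h, split_circle G h (fun=> 0) -> forall t, G (expi t) = 0.
Hypothesis total : forall f, jet p f -> exists G h g,
  [/\ split_circle G h (f 0%N), jet p g & forall t, g 0%N t = G (expi t)].

(** The graph for the closed graph theorem. Order [p] concerns [f] and [g]; of [h] only continuity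
    up to the boundary is asked. *)
Definition holomorphic_part (f g : nat -> R -> C) :=
  [/\ jet p f, jet p g & exists2 G, forall t, g 0%N t = G (expi t) &
    exists h, split_circle G h (f 0%N)].

Lemma decomposition_absurd : False.
Proof.
have AE h : Aext Omega h -> Aext Omega (fun z => (- 1) * h z) by exact: AextZ.
have add f g f' g' : holomorphic_part f g -> holomorphic_part f' g' ->
    holomorphic_part (fun l t => f l t + f' l t) (fun l t => g l t + g' l t).
  move=> [jf jg [G gG [h [GA hA fE]]]] [jf' jg' [G' gG' [h' [GA' hA' fE']]]].
  split; [exact: jetD|exact: jetD|exists (fun z => G z + G' z) => [t|]; first by rewrite gG gG'].
  exists (fun z => h z + h' z); split; [exact: AD_D|exact: AextD|].
  by move=> t; rewrite fE fE' addrACA.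
have scale a f g : holomorphic_part f g ->
    holomorphic_part (fun l t => a * f l t) (fun l t => a * g l t).
  move=> [jf jg [G gG [h [GA hA fE]]]].
  split; [exact: jetZ|exact: jetZ|exists (fun z => a * G z) => [t|]; first by rewrite gG].
  exists (fun z => a * h z); split; [apply: AD_M => //; exact: AD_cst|exact: AextZ|].
  by move=> t; rewrite fE mulrDr.
(* Convergence of order [0] yields the limits: the inner parts converge on the disc, and the outer
   parts, equal to [F n - K n] along [c], on the complement of [Omega]. *)
have closed (F K : nat -> nat -> R -> C) f g : (forall n, holomorphic_part (F n) (K n)) ->
    jet p f -> jet p g -> (forall l, (l <= p)%N -> ulim setT (fun n => F n l) (f l)) ->
    (forall l, (l <= p)%N -> ulim setT (fun n => K n l) (g l)) -> holomorphic_part f g.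
  move=> FK jf jg Ff Kg.
  have /choice[GH GHP] n : exists GH : (C -> C) * (C -> C),
      (forall t, K n 0%N t = GH.1 (expi t)) /\ split_circle GH.1 GH.2 (F n 0%N).
    by have [_ _ [G KG [h fE]]] := FK n; exists (G, h).
  pose G n := (GH n).1; pose H n := (GH n).2.
  have GA n : AD [::] (G n) by have [_ []] := GHP n.
  have HA n : Aext Omega (H n) by have [_ []] := GHP n.
  have KE n t : K n 0%N t = G n (expi t) by have [] := GHP n.
  have HE n t : H n (c t) = F n 0%N t - K n 0%N t.
    by have [_ [_ _ ->]] := GHP n; rewrite KE addrC addKr.
  have [G0 G0A G0P] : exists2 g, AD [::] g & ulim [set z | nrm z <= 1] G g.
    apply: AD_circle_lim => // e /(ulim_ucauchy (Kg 0%N isT))[N NP].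
    by exists N => n m t Nn Nm _; rewrite -!KE; exact: NP.
  have [H0 H0A H0P] : exists2 g, Aext Omega g & ulim (~` Omega) H g.
    apply: (Aext_lim Ec EO Esurj Ehol) => // e e0; have e20 : 0 < e / 2 by rewrite divr_gt0.
    have [N NP] := ulim_ucauchy (Kg 0%N isT) e20; have [N' NP'] := ulim_ucauchy (Ff 0%N isT) e20.
    exists (maxn N N') => n m t; rewrite !geq_max => /andP[n1 n2] /andP[m1 m2] _.
    have [s ->] := Ecircle t; rewrite /= !HE.
    have := NP n m s n1 m1 I; have := NP' n m s n2 m2 I.
    have := nrmB (F n 0%N s - F m 0%N s) (K n 0%N s - K m 0%N s).
    have -> : F n 0%N s - K n 0%N s - (F m 0%N s - K m 0%N s) =
      F n 0%N s - F m 0%N s - (K n 0%N s - K m 0%N s) by ring.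
    lra.
  have gE t : g 0%N t = G0 (expi t).
    apply: (@lim_uniq _ (fun n => K n 0%N t)) => e e0.
      by have [N NP] := Kg 0%N isT e e0; exists N => n Nn; exact: NP.
    by have [N NP] := G0P e e0; exists N => n Nn; rewrite KE; apply: NP; rewrite //= nrm_expi.
  split => //; exists G0 => //; exists H0; split => // t; rewrite -gE addrC.
  apply/eqP; rewrite -subr_eq; apply/eqP.
  apply: (@lim_uniq _ (fun n => F n 0%N t - K n 0%N t)) => e e0.
    have e20 : 0 < e / 2 by rewrite divr_gt0.
    have [N NP] := Kg 0%N isT _ e20; have [N' NP'] := Ff 0%N isT _ e20.
    exists (maxn N N') => n; rewrite geq_max => /andP[n1 n2].
    have := NP n t n1 I; have := NP' n t n2 I.
    have := nrmB (F n 0%N t - f 0%N t) (K n 0%N t - g 0%N t).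
    have -> : F n 0%N t - K n 0%N t - (f 0%N t - g 0%N t) =
      F n 0%N t - f 0%N t - (K n 0%N t - g 0%N t) by ring.
    lra.
  by have [N NP] := H0P e e0; exists N => n Nn; rewrite -HE; apply: NP => //; exact: cO.
have uniqg f g g' : holomorphic_part f g -> holomorphic_part f g' ->
    forall l t, (l <= p)%N -> g l t = g' l t.
  move=> [_ [gd _ _] [G gG [h [GA hA fE]]]] [_ [gd' _ _] [G' gG' [h' [GA' hA' fE']]]].
  elim=> [|l IH] t lp.
    rewrite gG gG'; apply/eqP; rewrite -subr_eq0; apply/eqP.
    apply: (uniq (G := fun z => G z - G' z) (h := fun z => h z - h' z)); split.
    - exact: AD_B.
    - exact: AextB.
    - move=> x; have := fE x; rewrite fE' => H; apply/esym/eqP.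
      by rewrite addrACA -opprD -H subrr.
  apply: rdiff_uniq (gd l t lp) _; apply: dq_eq (gd' l t lp) => x.
  by rewrite IH // ltnW.
have jets f g : holomorphic_part f g -> jet p f /\ jet p g by case.
have tot f : jet p f -> exists g, holomorphic_part f g.
  by move=> jf; have [G [h [g [GH jg gG]]]] := total jf; exists g; split => //; exists G => //; exists h.
apply: (riesz_unbounded add scale) (Gam_bounded jets tot add scale closed uniqg).
- move=> k; split; [exact: epos_jet|exact: epos_jet|].
  exists (fun z => z ^+ k) => [t|]; first by rewrite /epos expr0 mul1r expiMn.
  exists (fun=> 0); split; [exact: AD_X (AD_id _)|exact: Aext0|].
  by move=> t; rewrite addr0 /epos expr0 mul1r expiMn.
(* The mean is the value at [0] of [z^(k + 1) G z], a function in the disc algebra that vanishes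
   there. *)
- move=> k; have [g gP] := tot _ (eneg_jet p k.+1); exists g.
  have [_ jg [G gG [h [GA _ _]]]] := gP; split => //.
  have ZA := AD_M (AD_X k.+1 (AD_id R)) GA.
  transitivity (cavg (fun t => expi t ^+ k.+1 * G (expi t))).
    by apply: cavg_eq => t; rewrite expiMn gG.
  by rewrite (AD_avg ZA) expr0n mul0r.
Qed.

End Decomposition.

Lemma opp_cont (R : realType) (t : R) : cont_at (fun s : R => - s) t.
Proof. by apply/cont_atP; exact: (@oppr_continuous R R^o). Qed.

Lemma dtheta_rdiff (R : realType) (u : Cplx R -> Cplx R) (t : R) (d : Cplx R) :
  rdiff (fun s => u (expi s)) t d -> dtheta u t = d.
Proof.
move=> /rdiffP[hr hi]; rewrite /dtheta !derive1E.
by apply: cplxP; [exact: (derive_val (is_derive := hr))|exact: (derive_val (is_derive := hi))].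
Qed.

Lemma rdiff_reverse (R : realType) (u : R -> Cplx R) (t : R) (d : Cplx R) :
  rdiff u (- t) d -> rdiff (fun s => u (- s)) t (- d).
Proof.
move=> [q [qc qd qP]]; exists (fun s => - q (- s)); split.
- by apply: contN; exact: (cont_comp (opp_cont t) qc).
- by rewrite qd.
- by move=> s; rewrite qP !rcN; ring.
Qed.

Theorem theorem27 (R : realType) (p : nat) (Omega : set (Cplx R))
    (phi : Cplx R -> Cplx R) (psi : sphere R -> sphere R)
    (gamma delta : Cplx R -> Cplx R) :
  jordan_domain Omega ->
  interior_riemann_map Omega phi ->
  exterior_riemann_map Omega psi ->
  interior_boundary_map Omega phi gamma ->
  exterior_boundary_map Omega psi delta ->
  (p = 0%N /\ continuous_analytic_capacity (boundary Omega) = 0%:E)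
  \/
  [/\ (1 <= p)%N, Cp_circle p gamma, Cp_circle p delta &
      forall t : R, dtheta gamma t != 0 /\ dtheta delta t != 0] ->
  exists2 f : Cplx R -> Cplx R, Cp_boundary p gamma f &
    ~ exists g h : Cplx R -> Cplx R,
        [/\ Ap_boundary p Omega g, A0p_boundary p Omega h &
            forall z, boundary Omega z -> f z = g z + h z].
Proof.
move=> [Oo _ _ _] hphi hpsi hgamma hdelta hyp; apply: contrapT => nodec.
have dec f : Cp_boundary p gamma f -> exists g h : Cplx R -> Cplx R,
    [/\ Ap_boundary p Omega g, A0p_boundary p Omega h &
        forall z, boundary Omega z -> f z = g z + h z].
  by move=> fC; apply: contrapT => nd; apply: nodec; exists f.
have [Phi [iPhi [PhiAD PhiC PhiO Phigam [iPhic iPhiK PhiK iPhid Phid]]]] := interior_setup Oo hphi hgamma.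
have [E [w0 [Ec EO Esurj [w01 Ew0] [EI Edel Ehol Elift]]]] := exterior_setup hpsi hdelta.
pose c t := gamma (expi t).
have cC t : closure Omega (c t) by rewrite /c -Phigam; apply: PhiC; rewrite nrm_expi.
have cO t : ~ Omega (c t).
  by rewrite /c -Phigam => /iPhid[]; rewrite PhiK ?nrm_expi // ltxx.
have cB t : boundary Omega (c t) by split=> // /interior_subset; exact: cO.
have cc t : cont_at c t.
  by have := AD_expi_cont t PhiAD; apply: cont_at_near; apply: filterE => s; exact: Phigam.
have cI s t : c s = c t -> expi s = expi t :> Cplx R.
  by rewrite /c -!Phigam => st; rewrite -(PhiK (expi s)) ?nrm_expi // st PhiK ?nrm_expi.
have Ecircle t : exists s, E (expi t) = Some (c s).
  have [] := Edel (- t); rewrite opprK => Et dC.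
  have dO : ~ Omega (delta (expi (- t))).
    by apply/sphere_compl_some; rewrite -Et; exact: EO.
  have [s sE] := boundary_circle PhiO iPhiK dC dO.
  by exists s; rewrite Et -sE /c Phigam.
have cCk : Ck p c.
  case: hyp => [[-> _]//|[_ /Cp_circle_jet[U Uj U0] _ _]].
  by have := jet_Ck Uj; congr (Ck p _); apply/funext => t; exact: U0.
have [B BP] := bounded_closure PhiAD iPhiK.
apply: (decomposition_absurd (p := p) Ec EO Esurj Ehol Ecircle cO) => [G h [GA hA GhE] t|f fj].
  (* A decomposition of [0] reads [G = - h] on the boundary; the sign is absorbed by the outer
     function. *)
  have hA' := AextZ (- 1) hA.
  have Gh x : G (expi x) = - 1 * h (c x).
    by apply/eqP; rewrite mulN1r -subr_eq0 opprK -GhE.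
  case: hyp => [[_ cap0]|[p1 /Cp_circle_jet[U Uj U0] /Cp_circle_jet[V Vj V0] dn0]].
    apply: (capacity0_uniq Oo PhiAD PhiO iPhic iPhiK PhiK iPhid GA hA' _ cap0) => x.
    by rewrite Phigam; exact: Gh.
  have cd x : rdiff c x (U 1%N x).
    by have [Ud _ _] := Uj; apply: dq_eq (Ud 0%N x p1) => s; exact: U0.
  have dd x : rdiff (fun s => delta (expi s)) x (V 1%N x).
    by have [Vd _ _] := Vj; apply: dq_eq (Vd 0%N x p1) => s; exact: V0.
  have [om omP] := Elift c cc (fun x => conj (cO x) (cC x)).
  (* [E] contains the inversion [w |-> 1 / w], which reverses the circle; hence the argument
     [- x]. *)
  pose D x := delta (expi (- x)); pose D' x := - V 1%N (- x).
  have ED x : E (expi x) = Some (D x) by have [] := Edel (- x); rewrite opprK.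
  have Dd x : rdiff D x (D' x) by apply: (rdiff_reverse (u := fun s => delta (expi s))).
  have Dc' x : cont_at D' x.
    have [_ Vc _] := Vj; apply: contN; apply: (cont_comp (opp_cont x)); exact: Vc.
  have D'0 x : D' x != 0.
    by rewrite oppr_eq0 -(dtheta_rdiff (dd _)); have [] := dn0 (- x).
  have cc' x : cont_at (U 1%N) x by have [_ Uc _] := Uj; exact: Uc.
  have cp x : c (x + 2 * pi) = c x by rewrite /c expiD2pi.
  have omc x : cont_at om x by have [] := omP x.
  have om1 x : nrm (om x) = 1 by have [] := omP x.
  have Eom x : E (om x) = Some (c x) by have [] := omP x.
  have cD x : exists s, c s = D x.
    by have [s] := Ecircle x; rewrite ED => -[Ds]; exists s.
  exact: (smooth_uniq Ec EO Ehol EI ED Dd Dc' D'0 cd cc' cp omc om1 Eom hA' PhiAD PhiO PhiK Phid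
            Phigam GA Gh cD w01 Ew0).
have fper s t : c s = c t -> f 0%N s = f 0%N t.
  by move=> /cI; apply: per_expi => x; have [_ _ fp] := fj; exact: fp.
(* Carries [f] to the boundary by choosing an angle; by [fper] the choice is immaterial, and the
   default [0] concerns only points outside the range of [c]. *)
pose u z := f 0%N (xget 0 [set t | c t = z]).
have uE t : u (c t) = f 0%N t.
  by apply: fper; exact: (xgetPex 0 (ex_intro (fun s => c s = c t) t erefl)).
have uC : Cp_boundary p gamma u by apply: (jet_Cp_circle fj) => t; rewrite -uE.
have [g [h [gA hA gh]]] := dec u uC.
have [G GA [Gg GC]] := Ap_boundary_Ck Oo PhiAD PhiO PhiC Phigam cCk cB gA.
have [h' hA' hh'] := A0p_boundary_Aext BP hA.
have [g' gj g'E] := Ck_jet GC (fun t => congr1 G (expiD2pi t)).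
exists G, h', g'; split => //; last by move=> t; rewrite g'E.
by split => // t; rewrite -uE gh ?Gg ?hh'.
Qed.
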